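(* For $1<p<\infty$ and $0<s<\infty$ let $C_{s,p}$ denote the optimal (smallest) constant such that $$\big\|\,(|P_+f|^s+|P_-f|^s)^{1/s}\,\big\|_{L^p(\mathbf{T})}\le C_{s,p}\,\|f\|_{L^p(\mathbf{T})}\qquad\text{for all complex-valued } f\in L^p(\mathbf{T}).$$ (i) If $1<p\le \frac54$ and $0<s\le 4$, or if $\frac54<p<2$ and $0<s\le 2$, then $$C_{s,p}=\frac{2^{1/s}}{2\cos\frac{\pi}{2p}}.$$ (ii) If $2\le p<\infty$ and $0<s\le p$, then $$C_{s,p}=\frac{2^{1/s}}{2\sin\frac{\pi}{2p}}.$$
   Context: $\mathbf{T}=\{z\in\mathbf{C}:|z|=1\}$ is the unit circle with arc-length measure, and $L^p(\mathbf{T})$ is the complex Lebesgue space. For $f\in L^p(\mathbf{T})$, $\hat f(n)=\frac1{2\pi}\int_0^{2\pi}f(e^{it})e^{-int}\,dt$. For $1<p<\infty$ the Riesz projection $P_+$ on $L^p(\mathbf{T})$ is the bounded operator given by $P_+f(\zeta)=\sum_{n\ge 0}\hat f(n)\zeta^n$, and $P_-=I-P_+$ is the co-analytic projection, $P_-f(\zeta)=\sum_{n\le -1}\hat f(n)\zeta^n$. *)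

(* Defs.v *)
From HB Require Import structures.
From mathcomp Require Import all_boot all_order all_algebra.
From mathcomp Require Import all_classical all_reals all_analysis.
From mathcomp Require Import measurable_realfun complex.

Set Implicit Arguments.
Unset Strict Implicit.
Unset Printing Implicit Defensive.
Import Order.TTheory GRing.Theory Num.Theory.
Import numFieldNormedType.Exports.
Import ComplexField.Normc.

Local Open Scope classical_set_scope.
Local Open Scope ring_scope.
Local Open Scope complex_scope.

Section UnitCircle.
Context {R : realType}.

Definition expi (t : R) : R[i] := cos t +i* sin t.

Lemma normc_expi (t : R) : normc (expi t) = 1.
Proof. by rewrite /normc /= cos2Dsin2 sqrtr1. Qed.

Record circle := Circle { circle_val :> R[i]; _ : normc circle_val == 1 }.

HB.instance Definition _ := [isSub for circle_val].
HB.instance Definition _ := [Choice of circle by <:].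

Definition circle_expi (t : R) : circle := Circle (introT eqP (normc_expi t)).

HB.instance Definition _ := isPointed.Build circle (circle_expi 0).

(* The Borel sigma-algebra of the circle: the traces on the circle of the Borel
   sets of the plane, in the coordinates (Re z, Im z). *)
Definition circle_coord (z : circle) : R * R := (complex.Re z, complex.Im z).

Definition circle_measurable : set (set circle) :=
  preimage_set_system setT circle_coord measurable.

Definition circle_display : measure_display.
Proof. by constructor. Qed.

Lemma circle_sigma_algebra : sigma_algebra setT circle_measurable.
Proof.
apply: sigma_algebra_preimage; split.
- exact: measurable0.
- by move=> A mA; rewrite setTD; exact: measurableC.
- by move=> F mF; exact: bigcupT_measurable.
Qed.

Let circle_measurable0 : circle_measurable set0.
Proof. by case: circle_sigma_algebra. Qed.

Let circle_measurableC A : circle_measurable A -> circle_measurable (~` A).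
Proof. by rewrite -setTD; case: circle_sigma_algebra => _ + _; exact. Qed.

Let circle_measurableU (F : (set circle)^nat) :
  (forall i, circle_measurable (F i)) -> circle_measurable (\bigcup_i F i).
Proof. by case: circle_sigma_algebra => _ _; exact. Qed.

HB.instance Definition _ := @isMeasurable.Build circle_display circle
  circle_measurable circle_measurable0 circle_measurableC circle_measurableU.

Lemma measurable_circle_expi : measurable_fun [set: R] circle_expi.
Proof.
move=> _ _ [B mB <-]; rewrite !setTI -comp_preimage -[X in measurable X]setTI.
suff: measurable_fun [set: R] (circle_coord \o circle_expi) by exact.
have -> : circle_coord \o circle_expi = fun t : R => (cos t, sin t) by [].
apply/measurable_fun_pair; apply: continuous_measurable_fun.
  exact: continuous_cos.
exact: continuous_sin.
Qed.

End UnitCircle.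
Arguments circle R : clear implicits.

Section ArcLength.
Context (R : realType).

Lemma measurable_period : measurable (`[0, 2 * pi]%classic : set R).
Proof. exact: measurable_itv. Qed.

(* The image of Lebesgue measure on [0, 2 pi] under t |-> e^{it}, so the circle
   has total mass 2 pi. *)
Definition arclength : set (circle R) -> \bar R :=
  pushforward (mrestr (@lebesgue_measure R) measurable_period) circle_expi.

Let pushforward_measure mf : {measure set (circle R) -> \bar R} :=
  @measure_function_pushforward__canonical__measure_function_Measure
    _ _ _ _ _ (mrestr (@lebesgue_measure R) measurable_period) circle_expi mf.

Let arclength0 : arclength set0 = 0%E.
Proof. exact: (measure0 (pushforward_measure measurable_circle_expi)). Qed.

Let arclength_ge0 A : (0 <= arclength A)%E.
Proof. exact: (measure_ge0 (pushforward_measure measurable_circle_expi)). Qed.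

Let arclength_sigma_additive : semi_sigma_additive arclength.
Proof.
exact: (@measure_semi_sigma_additive _ _ _
  (pushforward_measure measurable_circle_expi)).
Qed.

HB.instance Definition _ := isMeasure.Build _ _ _ arclength
  arclength0 arclength_ge0 arclength_sigma_additive.

End ArcLength.

Section RieszProjection.
Context {R : realType}.
Implicit Types (f g : circle R -> R[i]) (p s C : R).

Definition Lp_norm p f : \bar R :=
  Lnorm (@arclength R) p%:E (fun z => (normc (f z))%:E).

Definition Lp p : set (circle R -> R[i]) :=
  [set f | [/\ measurable_fun setT (fun z => complex.Re (f z)),
               measurable_fun setT (fun z => complex.Im (f z)) &
               (Lp_norm p f < +oo)%E]].

Definition period_integral (h : R -> R[i]) : R[i] :=
  Rintegral lebesgue_measure `[0, 2 * pi] (fun t => complex.Re (h t)) +i*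
  Rintegral lebesgue_measure `[0, 2 * pi] (fun t => complex.Im (h t)).

Definition fourier_coef f (n : int) : R[i] :=
  ((2 * pi)^-1)%:C *
  period_integral (fun t => f (circle_expi t) * expi (- (n%:~R * t))).

Definition analytic_partial_sum f (N : nat) (z : circle R) : R[i] :=
  \sum_(0 <= n < N) fourier_coef f n%:Z * (z : R[i]) ^+ n.

Definition is_analytic_sum p f g :=
  Lp p g /\
  Lp_norm p (fun z => analytic_partial_sum f N z - g z) @[N --> \oo] --> 0%E.

(* P_+ f is the sum in L^p of the analytic half of the Fourier series of f.  It
   is determined up to a null set, and [xget] picks a representative.  For
   1 < p < oo and f in L^p the sum exists by M. Riesz's theorem, so the default
   value 0 is not used. *)
Definition riesz_plus p f : circle R -> R[i] :=
  xget (fun=> 0) [set g | is_analytic_sum p f g].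

Definition riesz_minus p f : circle R -> R[i] :=
  fun z => f z - riesz_plus p f z.

Definition riesz_bound s p C :=
  forall f, Lp p f ->
    (Lnorm (@arclength R) p%:E (fun z =>
       ((normc (riesz_plus p f z) `^ s + normc (riesz_minus p f z) `^ s)
          `^ s^-1)%:E)
     <= C%:E * Lp_norm p f)%E.

Definition is_optimal_riesz_constant s p C :=
  riesz_bound s p C /\ forall C', riesz_bound s p C' -> C <= C'.

End RieszProjection.

(* Main.v *)
Require Import Defs.

(* Upper bound.  For [p < 2] let [v] be the function [|z|^(p/2) cos (p arg z / 2)],
   for [p >= 2] a truncation of its negative.  It has trigonometric minorants at every
   point, hence is subharmonic, and an elementary inequality in the moduli
   [r = |g|], [q = |w|] and the angle of [g w] bounds
   [(|g|^s + |w|^s)^(p/s) + T v(+- g w)] by [C^p |g + conj w|^p].  If [g] and [w] are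
   polynomials and [w(0) = 0], the mean of [v(+- g w)] over the circle is nonnegative, so
   integrating proves the bound for trigonometric polynomials [f = g + conj w].  Fejer means
   preserve analyticity and do not increase the L^p norm; they converge in L^1, hence almost
   everywhere along a subsequence, and Fatou's lemma gives all of L^p.
   Lower bound.  Take [f = H + conj H], with [H] the rotation by a constant of
   [z S_N(r z)], where [S_N] is a partial sum of [(1 - z)^(-1/p)].  As [r -> 1] the mass of
   [|H|^p ~ 1/|1 - r z|] diverges logarithmically and concentrates where the argument of
   [H] is close to that constant plus or minus [pi/(2p)], so that [|f|/|H|] is close to
   [2 cos (pi/(2p))] or [2 sin (pi/(2p))]. *)

From HB Require Import structures.
From mathcomp Require Import all_boot all_order all_algebra.
From mathcomp Require Import all_classical all_reals all_analysis.
From mathcomp Require Import measurable_realfun complex ring lra.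

Set Implicit Arguments.
Unset Strict Implicit.
Unset Printing Implicit Defensive.
Import Order.TTheory GRing.Theory Num.Theory.
Import numFieldNormedType.Exports.

Local Open Scope classical_set_scope.
Local Open Scope ring_scope.


(** * Derivatives and continuity of real functions *)

(** Equality in the pointwise inequality occurs at [|g| = |w|] with the angle of [g w] (or of
    [- g w]) equal to [pi / p]. There the factor [cos (p u)] of the correction vanishes, and [T] is
    the value that makes the two sides tangent. Only the largest exponent needs this analysis: power
    means increase with [s], and [2 ^ (1/s)] is their normalization, which leaves [s = 2], [4] or
    [p]. For [s = 4] the argument asks for [tan (pi / (2 p)) >= 3], which holds for [p <= 5/4]; for
    [s = 2] it asks for [>= 1]. The obstacle in the subharmonic part is that [v] need not be smooth
    across a ray and that [v o Q] has no expansion at the zeros of the polynomial [Q].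
    Subharmonicity is therefore tested on the four points [z +- rho], [z +- i rho], up to
    [o(rho^2)]; a small multiple of [ln |Q|] keeps the maximum away from the zeros; and the harmonic
    functions used for comparison are real parts of polynomials, built from Fejer means of the
    boundary values. Both ranges of [p] are packaged in [riesz_majorant], so that the passage to L^p
    is made once. *)

Notation der x f df :=
  (@is_derive _ (GRing.regular _) (GRing.regular _) x 1 f df) (only parsing).

Section Der.
Context {R : realType}.
Implicit Types (f g : R -> R) (x a b : R).

Lemma der_cst c x : der x (fun _ : R => c) 0.
Proof. exact: is_derive_cst. Qed.

Lemma der_id x : der x (fun t : R => t) 1.
Proof. exact: is_derive_id. Qed.

Lemma derD f g x a b : der x f a -> der x g b ->
  der x (fun t => f t + g t) (a + b).
Proof. by move=> fa gb; exact: is_deriveD. Qed.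

Lemma derN f x a : der x f a -> der x (fun t => - f t) (- a).
Proof. by move=> fa; exact: is_deriveN. Qed.

Lemma derM f g x a b : der x f a -> der x g b ->
  der x (fun t => f t * g t) (f x * b + g x * a).
Proof. by move=> fa gb; exact: is_deriveM. Qed.

Lemma der_comp f g x a b : der (g x) f a -> der x g b ->
  der x (fun t => f (g t)) (a * b).
Proof. by move=> fa gb; exact: is_derive1_comp. Qed.

Lemma derX f n x a : der x f a ->
  der x (fun t => f t ^+ n) (n%:R * f x ^+ n.-1 * a).
Proof.
move=> fa; rewrite (_ : (fun _ => _) = (f ^+ n : R -> R)).
  exact: is_deriveX.
by apply/funext => t; rewrite exprfctE.
Qed.

Lemma der_sin f x a : der x f a ->
  der x (fun t => sin (f t)) (cos (f x) * a).
Proof. by move=> fa; apply: der_comp => //; exact: is_derive_sin. Qed.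

Lemma der_cos f x a : der x f a ->
  der x (fun t => cos (f t)) (- sin (f x) * a).
Proof. by move=> fa; apply: der_comp => //; exact: is_derive_cos. Qed.

Lemma der_expR f x a : der x f a ->
  der x (fun t => expR (f t)) (expR (f x) * a).
Proof. by move=> fa; apply: der_comp => //; exact: is_derive_expR. Qed.

Lemma der_ln f x a : 0 < f x -> der x f a ->
  der x (fun t => ln (f t)) ((f x)^-1 * a).
Proof. by move=> f0 fa; apply: der_comp => //; exact: is_derive1_ln. Qed.

Lemma der_atan f x a : der x f a ->
  der x (fun t => atan (f t)) ((1 + f x ^+ 2)^-1 * a).
Proof. by move=> fa; apply: der_comp => //; exact: is_derive1_atan. Qed.

Lemma der_powR f k x a : 0 < f x -> der x f a ->
  der x (fun t => f t `^ k) (k * f x `^ (k - 1) * a).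
Proof. by move=> f0 fa; exact: (der_comp (is_derive1_powR k f0) fa). Qed.

Lemma derV f x a : f x != 0 -> der x f a ->
  der x (fun t => (f t)^-1) (- (f x) ^- 2 * a).
Proof.
move=> f0 fa; split; first exact: derivableV.
by rewrite deriveV// derive_val.
Qed.

Lemma derE f x a b : der x f a -> a = b -> der x f b.
Proof. by move=> fa <-. Qed.

Lemma der_cont f x a : der x f a -> {for x, continuous f}.
Proof.
by move=> fa; apply: differentiable_continuous; apply/derivable1_diffP.
Qed.

End Der.

Ltac der_step :=
  lazymatch goal with
  | |- is_derive _ _ ?f _ =>
    lazymatch f with
    | (fun _ => ?c) => eapply der_cst
    | (fun t => t) => eapply der_id
    | (fun t => @?a t + @?b t) => eapply (derD (f := a) (g := b))
    | (fun t => - @?a t) => eapply (derN (f := a))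
    | (fun t => @?a t ^+ _) => eapply (derX (f := a))
    | (fun t => @?a t * @?b t) => eapply (derM (f := a) (g := b))
    | (fun t => @?a t `^ _) => eapply (der_powR (f := a))
    | (fun t => sin (@?a t)) => eapply (der_sin (f := a))
    | (fun t => cos (@?a t)) => eapply (der_cos (f := a))
    | (fun t => ln (@?a t)) => eapply (der_ln (f := a))
    | (fun t => expR (@?a t)) => eapply (der_expR (f := a))
    | (fun t => atan (@?a t)) => eapply (der_atan (f := a))
    | (fun t => (@?a t)^-1) => eapply (derV (f := a))
    | _ => eassumption
    end
  end.
Ltac der_auto := eapply derE; [repeat der_step | cbv beta].

Section Mono.
Context {R : realType}.
Implicit Types (f df : R -> R) (a b x : R).

Lemma within_cont_set (T : topologicalType) (A : set T) (f : T -> R) :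
  (forall y : T, A y -> {for y, continuous f}) -> {within A, continuous f}.
Proof. by move=> fc; apply: continuous_in_subspaceT => y; rewrite inE; exact: fc. Qed.

Lemma within_cont_eq f g a b : (forall x, a <= x <= b -> f x = g x) ->
  (forall x, a <= x <= b -> {for x, continuous g}) ->
  {within `[a, b], continuous f}.
Proof.
move=> fg gc; apply: (@subspace_eq_continuous _ _ _ g).
  by move=> x; rewrite inE/= in_itv/= => /fg.
by apply: continuous_in_subspaceT => x; rewrite inE/= in_itv/=; exact: gc.
Qed.

Lemma within_cont f a b : (forall x, a <= x <= b -> {for x, continuous f}) ->
  {within `[a, b], continuous f}.
Proof. exact: within_cont_eq. Qed.

Lemma der_le f df a b : a <= b -> {within `[a, b], continuous f} ->
  (forall x, a < x < b -> der x f (df x)) ->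
  (forall x, a < x < b -> 0 <= df x) -> f a <= f b.
Proof.
move=> ab fc fd fp; have [->//|nab] := eqVneq a b.
have {nab}ab' : a < b by rewrite lt_neqAle nab.
have fd' x : x \in `]a, b[ -> der x f (df x) by rewrite in_itv/= => /fd.
have [c] := MVT ab' fd' fc.
rewrite in_itv/= => ac e; rewrite -subr_ge0 e mulr_ge0 ?fp ?subr_ge0//.
Qed.

Lemma der_lt f df a b : a < b -> {within `[a, b], continuous f} ->
  (forall x, a < x < b -> der x f (df x)) ->
  (forall x, a < x < b -> 0 < df x) -> f a < f b.
Proof.
move=> ab fc fd fp.
have fd' x : x \in `]a, b[ -> der x f (df x) by rewrite in_itv/= => /fd.
have [c] := MVT ab fd' fc.
rewrite in_itv/= => ac e; rewrite -subr_gt0 e mulr_gt0 ?fp ?subr_gt0//.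
Qed.

Lemma der_ge f df a b : a <= b -> {within `[a, b], continuous f} ->
  (forall x, a < x < b -> der x f (df x)) ->
  (forall x, a < x < b -> df x <= 0) -> f b <= f a.
Proof.
move=> ab fc fd fp; have [->//|nab] := eqVneq a b.
have {nab}ab' : a < b by rewrite lt_neqAle nab.
have fd' x : x \in `]a, b[ -> der x f (df x) by rewrite in_itv/= => /fd.
have [c] := MVT ab' fd' fc.
rewrite in_itv/= => ac e; rewrite -subr_le0 e mulr_le0_ge0 ?fp ?subr_ge0//.
Qed.
End Mono.

Section Cont.
Context {R : realType} {T : topologicalType}.
Implicit Types (f g : T -> R) (x : T) (h : R -> R).

Lemma cont_cst (c : R) x : {for x, continuous (fun _ : T => c)}.
Proof. exact: cst_continuous. Qed.

Lemma contD f g x : {for x, continuous f} -> {for x, continuous g} ->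
  {for x, continuous (fun t => f t + g t)}.
Proof. by move=> fc gc; exact: continuousD. Qed.

Lemma contN f x : {for x, continuous f} -> {for x, continuous (fun t => - f t)}.
Proof. by move=> fc; exact: continuousN. Qed.

Lemma contM f g x : {for x, continuous f} -> {for x, continuous g} ->
  {for x, continuous (fun t => f t * g t)}.
Proof. by move=> fc gc; exact: continuousM. Qed.

Lemma contX f n x : {for x, continuous f} ->
  {for x, continuous (fun t => f t ^+ n)}.
Proof.
move=> fc; elim: n => [|n ih]; first exact: cont_cst.
rewrite (_ : (fun _ => _) = (fun t => f t * f t ^+ n)); first exact: contM.
by apply/funext => t; rewrite exprS.
Qed.

Lemma cont_norm f x : {for x, continuous f} ->
  {for x, continuous (fun t => `|f t|)}.
Proof. by move=> fc; exact: cvg_norm. Qed.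

Lemma contV f x : f x != 0 -> {for x, continuous f} ->
  {for x, continuous (fun t => (f t)^-1)}.
Proof. by move=> f0 fc; exact: cvgV. Qed.

Lemma cont_comp h f x : {for f x, continuous h} -> {for x, continuous f} ->
  {for x, continuous (fun t => h (f t))}.
Proof. by move=> hc fc; exact: continuous_comp. Qed.

Lemma cont_sin f x : {for x, continuous f} ->
  {for x, continuous (fun t => sin (f t))}.
Proof. by move=> fc; apply: cont_comp => //; exact: continuous_sin. Qed.

Lemma cont_cos f x : {for x, continuous f} ->
  {for x, continuous (fun t => cos (f t))}.
Proof. by move=> fc; apply: cont_comp => //; exact: continuous_cos. Qed.

Lemma cont_ln f x : 0 < f x -> {for x, continuous f} ->
  {for x, continuous (fun t => ln (f t))}.
Proof. by move=> f0 fc; apply: cont_comp => //; exact: continuous_ln. Qed.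

Lemma cont_sqrt f x : {for x, continuous f} ->
  {for x, continuous (fun t => Num.sqrt (f t))}.
Proof. by move=> fc; apply: cont_comp => //; exact: sqrt_continuous. Qed.

Lemma cont_max f g x : {for x, continuous f} -> {for x, continuous g} ->
  {for x, continuous (fun t => Num.max (f t) (g t))}.
Proof. by move=> fc gc; exact: continuous_max. Qed.

Lemma cont_min f g x : {for x, continuous f} -> {for x, continuous g} ->
  {for x, continuous (fun t => Num.min (f t) (g t))}.
Proof. by move=> fc gc; exact: continuous_min. Qed.

Lemma powR_gt0_cont (k y : R) : 0 < y -> {for y, continuous (fun u : R => u `^ k)}.
Proof. by move=> y0; apply: der_cont; exact: is_derive1_powR. Qed.

Lemma cont_powR f k x : 0 < f x -> {for x, continuous f} ->
  {for x, continuous (fun t => f t `^ k)}.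
Proof.
by move=> f0 fc; exact: (cont_comp (powR_gt0_cont f0) fc).
Qed.

(** With the absolute value the power is continuous at 0 too, which [powR_gt0_cont] does not cover.
    For this reason nonnegative bases are rewritten as norms below before continuity is claimed. *)
Lemma norm_powR_cont (k y : R) : 0 < k -> {for y, continuous (fun u : R => `|u| `^ k)}.
Proof.
move=> k0; have [->|y0] := eqVneq y 0; last first.
  apply: (@continuous_comp _ _ _ (fun u : R => `|u|) (fun u : R => u `^ k)).
    exact: norm_continuous.
  by apply: powR_gt0_cont; rewrite normr_gt0.
rewrite /prop_for /continuous_at normr0 powR0 ?gt_eqF//.
apply/cvgrPdist_lt => e e0; near=> u.
rewrite sub0r normrN ger0_norm ?powR_ge0//.
have kn0 : k != 0 by rewrite gt_eqF.
rewrite -[e](@powRr1) ?ltW// -(mulVf kn0) powRrM.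
rewrite gt0_ltr_powR ?nnegrE ?powR_ge0//.
near: u; apply: (@nbhs0_lt _ R^o); by rewrite powR_gt0.
Unshelve. all: by end_near. Qed.

Lemma cont_norm_powR f k x : 0 < k -> {for x, continuous f} ->
  {for x, continuous (fun t => `|f t| `^ k)}.
Proof.
by move=> k0 fc; exact: (cont_comp (norm_powR_cont k0) fc).
Qed.

Lemma contE f g x : f = g -> {for x, continuous f} -> {for x, continuous g}.
Proof. by move=> <-. Qed.
End Cont.

Lemma cont_id {R : realType} (x : R) : {for x, continuous (fun t : R => t)}.
Proof. exact: cvg_id. Qed.

Lemma cont_fst {U V : topologicalType} (x : U * V) :
  {for x, continuous (fun t : U * V => t.1)}.
Proof. exact: cvg_fst. Qed.

Lemma cont_snd {U V : topologicalType} (x : U * V) :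
  {for x, continuous (fun t : U * V => t.2)}.
Proof. exact: cvg_snd. Qed.

Ltac cont_step :=
  lazymatch goal with
  | |- prop_for _ (inPhantom (continuous ?f)) =>
    lazymatch f with
    | (fun _ => ?c) => exact: cont_cst
    | (fun t => t) => exact: cont_id
    | (fun t => @?a t + @?b t) => refine (contD (f := a) (g := b) _ _)
    | (fun t => - @?a t) => refine (contN (f := a) _)
    | (fun t => @?a t ^+ _) => refine (contX (f := a) _)
    | (fun t => @?a t * @?b t) => refine (contM (f := a) (g := b) _ _)
    | (fun t => `|@?a t| `^ _) => refine (cont_norm_powR (f := a) _ _)
    | (fun t => @?a t `^ _) => refine (cont_powR (f := a) _ _)
    | (fun t => `|@?a t|) => refine (cont_norm (f := a) _)
    | (fun t => sin (@?a t)) => refine (cont_sin (f := a) _)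
    | (fun t => cos (@?a t)) => refine (cont_cos (f := a) _)
    | (fun t => ln (@?a t)) => refine (cont_ln (f := a) _ _)
    | (fun t => Num.sqrt (@?a t)) => refine (cont_sqrt (f := a) _)
    | (fun t => Num.max (@?a t) (@?b t)) => refine (cont_max (f := a) (g := b) _ _)
    | (fun t => Num.min (@?a t) (@?b t)) => refine (cont_min (f := a) (g := b) _ _)
    | (fun t => (@?a t)^-1) => refine (contV (f := a) _ _)
    | (fun t => t.1) => exact: cont_fst
    | (fun t => t.2) => exact: cont_snd
    end
  end.
Ltac cont_auto := repeat cont_step.

(** * The pointwise inequality for [p < 2] *)

Section CosinePower.
Context {R : realType}.
Notation pi := (@pi R).
Implicit Types (p g u : R).

(** This is the numerator of the derivative of the quotient in [quot_sin_cos_le]. It vanishes at 0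
    and its own derivative is [p (2 - p) sin v sin ((p - 1) v)]. *)
Lemma quot_sin_cos_num_ge0 p u : 1 < p -> p < 2 -> 0 <= u <= pi / 2 ->
  0 <= p * sin u * cos ((p - 1) * u) - sin (p * u).
Proof.
move=> p1 p2 /andP[u0 u1]; have p0 := pi_gt0 R.
pose f (v : R) := p * sin v * cos ((p - 1) * v) - sin (p * v).
rewrite -[X in X <= _](_ : f 0 = 0); last by rewrite /f !mulr0 sin0; ring.
apply: (@der_le _ f (fun v => p * (2 - p) * (sin v * sin ((p - 1) * v)))) => //.
- apply: within_cont => x _; rewrite /f; cont_auto.
- move=> x _; rewrite /f; der_auto.
  rewrite (_ : p * x = (p - 1) * x + x); last by ring.
  rewrite cosD; ring.
- move=> x /andP[x0 xu].
  by rewrite mulr_ge0 ?mulr_ge0 ?sin_ge0_pi//; nra.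
Qed.

(** The derivative of the function minimized in [cos_powR_ge] is a positive factor times a multiple
    of this quotient minus a constant, so monotonicity leaves it a single sign change, at [g]. *)
Lemma quot_sin_cos_le p u v : 1 < p -> p < 2 -> 0 < u -> u <= v -> v < pi / 2 ->
  sin (p * u) / (sin u * cos u `^ (p - 1)) <=
  sin (p * v) / (sin v * cos v `^ (p - 1)).
Proof.
move=> p1 p2 u0 uv vpi; have p0 := pi_gt0 R.
have sc x : u <= x <= v -> 0 < sin x /\ 0 < cos x.
  by move=> /andP[? ?]; split; [apply: sin_gt0_pihalf|apply: cos_gt0_pihalf];
    apply/andP; split; lra.
pose q (x : R) := sin (p * x) / (sin x * cos x `^ (p - 1)).
pose q' (x : R) := (p * sin x * cos ((p - 1) * x) - sin (p * x)) /
    (sin x ^+ 2 * (cos x `^ (p - 1) * cos x)).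
have dq x : u <= x <= v -> der x q (q' x).
  move=> xuv; have [s0 c0] := sc _ xuv.
  have c1 : 0 < cos x `^ (p - 1) by rewrite powR_gt0.
  have nz : sin x * cos x `^ (p - 1) != 0 by rewrite gt_eqF// mulr_gt0.
  rewrite /q; der_auto => //; rewrite /q'.
  have -> : cos x `^ (p - 1 - 1) = cos x `^ (p - 1) / cos x.
    by rewrite powRB ?powRr1 ?ltW// (gt_eqF c0) implybT.
  have e1 := cos2Dsin2 x.
  rewrite (_ : (p - 1) * x = p * x - x); last by ring.
  rewrite cosB.
  apply/eqP; rewrite -subr_eq0; apply/eqP.
  set C := cos x `^ (p - 1) in c1 *.
  transitivity (((cos x ^+ 2 + sin x ^+ 2) - 1) * - sin (p * x) /
    (sin x ^+ 2 * (C * cos x))); last by rewrite e1 subrr !mul0r.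
  by field; rewrite !gt_eqF.
apply: (@der_le _ q q') => //.
- by apply: within_cont => x /dq /der_cont.
- by move=> x /andP[? ?]; apply: dq; apply/andP; split; lra.
move=> x /andP[ux xv]; have [s0 c0] : 0 < sin x /\ 0 < cos x by apply: sc; apply/andP; split; lra.
have c1 : 0 < cos x `^ (p - 1) by rewrite powR_gt0.
rewrite /q' divr_ge0//.
  by apply: quot_sin_cos_num_ge0 => //; apply/andP; split; lra.
by rewrite !mulr_ge0// ltW.
Qed.

(** The difference of the two terms that depend on [u] is least at [u = g], where [cos (p u) = 0]
    and it equals 1; [tan g] is the coefficient for which the derivative vanishes there ([qg]). This
    is the pointwise inequality for equal moduli. *)
Lemma cos_powR_ge p g u : 1 < p -> p < 2 -> p * g = pi / 2 -> 0 <= u <= pi / 2 ->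
  1 + tan g * cos (p * u) <= cos u `^ p / cos g `^ p.
Proof.
move=> p1 p2 pg /andP[u0 u1]; have p0 := pi_gt0 R.
have g0 : 0 < g by nra.
have g1 : g < pi / 2 by nra.
have sg : 0 < sin g by apply: sin_gt0_pihalf; rewrite g0.
have cg : 0 < cos g by apply: cos_gt0_pihalf; apply/andP; split; lra.
have cgp : 0 < cos g `^ p by rewrite powR_gt0.
pose f (x : R) := cos x `^ p / cos g `^ p - tan g * cos (p * x).
pose f' (x : R) := p * (cos x `^ (p - 1) * sin x) *
  (tan g * (sin (p * x) / (sin x * cos x `^ (p - 1))) - (cos g `^ p)^-1).
suff : f g <= f u.
  rewrite /f pg cos_pihalf mulr0 subr0 divff ?gt_eqF//.
  by rewrite lerBrDr.
have dcont a b : 0 <= a -> b <= pi / 2 -> {within `[a, b], continuous f}.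
  move=> a0 b1; apply: (@within_cont_eq _ _
    (fun x => `|cos x| `^ p / cos g `^ p - tan g * cos (p * x))).
    move=> x /andP[? ?]; rewrite /f ger0_norm//.
    by apply: cos_ge0_pihalf; apply/andP; split; lra.
  move=> x _; cont_auto; lra.
have dder x : 0 < x < pi / 2 -> der x f (f' x).
  move=> /andP[x0 x1].
  have sx : 0 < sin x by apply: sin_gt0_pihalf; rewrite x0.
  have cx : 0 < cos x by apply: cos_gt0_pihalf; apply/andP; split; lra.
  have c1 : 0 < cos x `^ (p - 1) by rewrite powR_gt0.
  rewrite /f; der_auto => //; rewrite /f'.
  by field; rewrite !gt_eqF.
have qg : tan g * (sin (p * g) / (sin g * cos g `^ (p - 1))) = (cos g `^ p)^-1.
  rewrite pg sin_pihalf -(@mulr_powRB1 _ (cos g) p) ?(ltW cg)//; last by lra.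
  by rewrite /tan; field; rewrite !gt_eqF// powR_gt0.
have tg : 0 < tan g by rewrite /tan divr_gt0.
have [gu|ug] := leP g u.
- apply: (@der_le _ f f') => //; first by apply: dcont; lra.
    by move=> x /andP[? ?]; apply: dder; apply/andP; split; lra.
  move=> x /andP[? ?]; rewrite /f' -qg -mulrBr.
  have sx : 0 < sin x by apply: sin_gt0_pihalf; apply/andP; split; lra.
  have cx : 0 < cos x by apply: cos_gt0_pihalf; apply/andP; split; lra.
  rewrite mulr_ge0//; first by rewrite !mulr_ge0 ?powR_ge0 ?ltW//; lra.
  by rewrite mulr_ge0 ?(ltW tg)// subr_ge0; apply: quot_sin_cos_le; lra.
- apply: (@der_ge _ f f') => //; [by lra|by apply: dcont; lra| |].
    by move=> x /andP[? ?]; apply: dder; apply/andP; split; lra.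
  move=> x /andP[? ?]; rewrite /f' -qg -mulrBr.
  have sx : 0 < sin x by apply: sin_gt0_pihalf; apply/andP; split; lra.
  have cx : 0 < cos x by apply: cos_gt0_pihalf; apply/andP; split; lra.
  rewrite mulr_ge0_le0//; first by rewrite !mulr_ge0 ?powR_ge0 ?ltW//; lra.
  by rewrite mulr_ge0_le0 ?(ltW tg)// subr_le0; apply: quot_sin_cos_le; lra.
Qed.

End CosinePower.

(** * Power means and the numerical bound behind the threshold 5/4 *)

Section PowerInequalities.
Context {R : realType}.
Notation pi := (@pi R).
Implicit Types (p g u : R).

(** A convex power lies above its tangent; the power mean inequality and Jensen's inequality for
    Fejer means are both read off from this. *)
Lemma powR_tangent p (m y : R) : 1 <= p -> 0 < m -> 0 <= y ->
  m `^ p + p * m `^ (p - 1) * (y - m) <= y `^ p.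
Proof.
move=> p1 m0; rewrite le_eqVlt => /predU1P[<-|y0].
  rewrite powR0 ?gt_eqF ?(lt_le_trans _ p1)// sub0r mulrN -mulrA.
  have -> : m `^ (p - 1) * m = m `^ p.
    by rewrite mulrC mulr_powRB1 ?(ltW m0)//; lra.
  have := powR_ge0 m p; nra.
pose f x := x `^ p - p * m `^ (p - 1) * x.
pose f' x : R := p * (x `^ (p - 1) - m `^ (p - 1)).
have df x : 0 < x -> der x f (f' x).
  by move=> x0; rewrite /f; der_auto => //; rewrite /f'; ring.
have cf a b : 0 < a -> {within `[a, b], continuous f}.
  move=> a0; apply: within_cont => x /andP[ax _].
  by apply: der_cont (df _ _); exact: lt_le_trans ax.
suff : f m <= f y by rewrite /f; lra.
have [my|ym] := leP m y.
  apply: (@der_le _ f f') => //; first exact: cf.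
    by move=> x /andP[mx _]; apply: df; exact: lt_trans mx.
  move=> x /andP[mx _]; rewrite /f' mulr_ge0 ?subr_ge0//; first by lra.
  by rewrite ge0_ler_powR ?nnegrE//; lra.
apply: (@der_ge _ f f'); [exact: ltW|exact: cf| |].
  by move=> x /andP[yx _]; apply: df; exact: lt_trans yx.
move=> x /andP[yx xm]; rewrite /f' mulr_ge0_le0 ?subr_le0//; first by lra.
by rewrite ge0_ler_powR ?nnegrE//; lra.
Qed.

Lemma power_mean_le (s s' r q : R) : 0 < s -> s <= s' -> 0 <= r -> 0 <= q ->
  ((r `^ s + q `^ s) / 2) `^ s^-1 <= ((r `^ s' + q `^ s') / 2) `^ s'^-1.
Proof.
move=> s0 ss r0 q0; have s'0 : 0 < s' by exact: lt_le_trans ss.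
have sn : s != 0 by rewrite gt_eqF.
have s'n : s' != 0 by rewrite gt_eqF.
have a0 := powR_ge0 r s; have b0 := powR_ge0 q s.
set m := (r `^ s + q `^ s) / 2.
have m0 : 0 <= m by rewrite /m; lra.
have e (y : R) : y `^ s' = (y `^ s) `^ (s' / s).
  by rewrite -powRrM mulrC divfK.
have h : m `^ (s' / s) <= (r `^ s' + q `^ s') / 2.
  have k1 : 1 <= s' / s by rewrite ler_pdivlMr// mul1r.
  have [mp|m0'] := ltP 0 m; last first.
    have -> : m = 0 by apply/eqP; rewrite eq_le m0'.
    rewrite powR0; last by rewrite mulf_neq0// invr_eq0.
    by rewrite divr_ge0// addr_ge0 ?powR_ge0.
  have := powR_tangent k1 mp a0; have := powR_tangent k1 mp b0.
  rewrite -!e.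
  rewrite (_ : q `^ s - m = - (r `^ s - m)); last by rewrite /m; lra.
  lra.
have -> : m `^ s^-1 = (m `^ (s' / s)) `^ s'^-1.
  by rewrite -powRrM mulrAC divff// mul1r.
by rewrite ge0_ler_powR ?nnegrE ?powR_ge0 ?invr_ge0 ?(ltW s'0)// divr_ge0// addr_ge0 ?powR_ge0.
Qed.

(** This monotonicity reduces every exponent [s] to the largest admissible one, which is why the
    constant depends on [s] through [2 ^ (1/s)] only. *)
Lemma power_mean_exp_le (s s' p r q : R) : 0 < p -> 0 < s -> s <= s' -> 0 <= r -> 0 <= q ->
  ((r `^ s + q `^ s) / 2) `^ (p / s) <= ((r `^ s' + q `^ s') / 2) `^ (p / s').
Proof.
move=> p0 s0 ss r0 q0.
rewrite [p / s]mulrC [p / s']mulrC !powRrM.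
apply: ge0_ler_powR; [exact: ltW|exact: powR_ge0|exact: powR_ge0|].
exact: power_mean_le.
Qed.

(** With [th = pi / 10] the relation [sin (2 th) = cos (3 th)] becomes [4 y^2 + 2 y - 1 = 0] for
    [y = sin th]. The bound amounts to [tan >= 3] at [2 pi / 5], the angle [pi / (2 p)] of
    [p = 5/4]. *)
Lemma cos_two_fifths_pi : cos (2 * pi / 5) ^+ 2 <= 1 / 10.
Proof.
have p0 := pi_gt0 R.
set th : R := pi / 10.
have -> : 2 * pi / 5 = pi / 2 - th by rewrite /th; lra.
have -> : cos (pi / 2 - th) = sin th.
  by rewrite cosB cos_pihalf sin_pihalf; ring.
have s0 : 0 < sin th by apply: sin_gt0_pihalf; rewrite /th; apply/andP; split; lra.
have c0 : 0 < cos th by apply: cos_gt0_pihalf; rewrite /th; apply/andP; split; lra.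
have h : sin (2 * th) = cos (3 * th).
  rewrite (_ : 2 * th = pi / 2 - 3 * th) ?sinB ?cos_pihalf ?sin_pihalf; last first.
    by rewrite /th; lra.
  ring.
have e1 := cos2sin2 th.
have : sin (2 * th) - cos (3 * th) = cos th * (4 * sin th ^+ 2 + 2 * sin th - 1).
  rewrite (_ : 3 * th = th + th + th); last by ring.
  rewrite (_ : 2 * th = th + th); last by ring.
  rewrite !cosD !sinD; ring: e1.
rewrite h subrr => /esym/eqP; rewrite mulf_eq0 (gt_eqF c0)/= => /eqP.
move: s0; set y := sin th; nra.
Qed.

(* The shift of the argument by [c >= -1] costs at most the factor [2 `^ (k - 1)]
   in the derivative, which the smallness of [K `^ k] compensates. *)
Lemma powR_shift_ge (k K c L x : R) (N N' : R -> R) :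
  0 < k -> k < 1 -> 0 < K -> -1 <= c <= 1 -> 1 <= x -> N 1 = 1 ->
  (forall y, 1 <= y -> der y N (N' y)) ->
  (forall y, 1 <= y -> N' y <= k * L * y `^ (k - 1)) ->
  2 * L * K `^ k <= 2 `^ k ->
  N x - 1 <= ((x + c) / K) `^ k - ((1 + c) / K) `^ k.
Proof.
move=> k0 k1 K0 /andP[c1 c2] x1 N1 dN N'le LK.
pose f y := ((y + c) / K) `^ k - N y.
pose f' y : R := k * ((y + c) / K) `^ (k - 1) / K - N' y.
suff : f 1 <= f x by rewrite /f N1; lra.
have cf : {within `[1, x], continuous f}.
  apply: (@within_cont_eq _ _ (fun y : R => `|(y + c) / K| `^ k - N y)) => z.
    by move=> /andP[z1 _]; rewrite ger0_norm// divr_ge0// ?(ltW K0)//; lra.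
  move=> /andP[z1 _]; apply: contD; last exact/contN/der_cont/dN.
  by cont_auto.
apply: (@der_le _ f f') => // y /andP[y1 yx]; have yc : 0 < (y + c) / K.
- by rewrite divr_gt0//; lra.
- rewrite /f; apply: (@derD _ _ (fun y : R => - N y)).
    by der_auto => //; ring.
  by apply: derN; apply: dN; exact: ltW.
- by rewrite divr_gt0//; lra.
rewrite /f' subr_ge0; apply: le_trans (N'le _ (ltW y1)) _.
have y0 : 0 < y by lra.
have h1 : (2 * y / K) `^ (k - 1) <= ((y + c) / K) `^ (k - 1).
  rewrite -[X in X <= _]invrK -[X in _ <= X]invrK lef_pV2 ?posrE ?invr_gt0 ?powR_gt0//; last first.
    by rewrite divr_gt0 ?mulr_gt0.
  rewrite -!powRN; apply: ge0_ler_powR; rewrite ?nnegrE ?(ltW yc)//; first by lra.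
    by rewrite divr_ge0 ?mulr_ge0 ?ltW.
  by rewrite ler_pM2r ?invr_gt0//; lra.
have h2 : (2 * y / K) `^ (k - 1) = 2 `^ k / 2 * y `^ (k - 1) / K `^ k * K.
  rewrite !powRM ?mulr_ge0 ?invr_ge0 ?(ltW y0) ?(ltW K0)//.
  rewrite -powR_inv1 ?(ltW K0)// -powRrM mulN1r opprB.
  have -> : K `^ (1 - k) = K / K `^ k.
    by rewrite powRB ?powRr1 ?(ltW K0)// (gt_eqF K0) implybT.
  have -> : (2 : R) `^ (k - 1) = 2 `^ k / 2.
    by rewrite powRB ?powRr1// pnatr_eq0 implybT.
  by field; rewrite gt_eqF ?powR_gt0.
have h3 : k * L * y `^ (k - 1) <= k * (2 * y / K) `^ (k - 1) / K.
  rewrite h2; have yk : 0 < y `^ (k - 1) by rewrite powR_gt0.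
  have Kk : 0 < K `^ k by rewrite powR_gt0.
  have -> : k * (2 `^ k / 2 * y `^ (k - 1) / K `^ k * K) / K =
    k * (2 `^ k / (2 * K `^ k)) * y `^ (k - 1).
    by field; rewrite !gt_eqF.
  rewrite ler_pM2r// ler_pM2l// ler_pdivlMr ?mulr_gt0//; lra.
apply: le_trans h3 _; rewrite ler_pM2r ?invr_gt0// ler_pM2l//.
Qed.

End PowerInequalities.

(** * The inequality in both moduli and the angle, [p < 2] *)

Section PointwiseBelowTwo.
Context {R : realType}.
Notation pi := (@pi R).
Implicit Types (p g u s r q : R).

Lemma powRVr (a k : R) : 0 <= a -> a^-1 `^ k = (a `^ k)^-1.
Proof. by move=> a0; rewrite -(powR_inv1 a0) -powRrM mulN1r powRN. Qed.

Lemma sqr_powR_half p (a : R) : 0 <= a -> (a ^+ 2) `^ (p / 2) = a `^ p.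
Proof.
by move=> c0; rewrite -(powR_mulrn _ c0) -powRrM mulrC divfK.
Qed.

(** At [u = 0], [cos_powR_ge] reads [(1 + tan g) cos g ^ p <= 1]. It is put here in the form of the
    last hypothesis of [powR_shift_ge], with [K = 2 cos g ^ 2] and [k = p / 2]. *)
Lemma cos_powR_le p g L : 1 < p -> p < 2 -> p * g = pi / 2 -> 0 < L ->
  2 * L <= 1 + tan g -> 2 * L * (2 * cos g ^+ 2) `^ (p / 2) <= 2 `^ (p / 2).
Proof.
move=> p1 p2 pg L0 Lt; have p0 := pi_gt0 R.
have g0 : 0 < g by nra.
have cg : 0 < cos g by apply: cos_gt0_pihalf; apply/andP; split; nra.
have h0 : 0 <= (0 : R) <= pi / 2 by apply/andP; split; lra.
have := cos_powR_ge p1 p2 pg h0.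
rewrite mulr0 cos0 mulr1 powR1.
rewrite ler_pdivlMr ?powR_gt0// => h.
rewrite powRM ?sqr_ge0// sqr_powR_half ?(ltW cg)// mulrCA -[leRHS]mulr1.
rewrite ler_pM2l ?powR_gt0//; apply: le_trans h.
by rewrite ler_pM2r// powR_gt0.
Qed.

Lemma tan_ge1_lt2 p g : 1 < p -> p < 2 -> p * g = pi / 2 -> 1 <= tan g.
Proof.
move=> p1 p2 pg; have p0 := pi_gt0 R.
by rewrite -tan_piquarter leNgt ltr_tan ?in_itv/= -?leNgt;
  [nra|apply/andP; split; nra|apply/andP; split; nra].
Qed.

(** The value 3 is what [L = 2] requires in [cos_powR_le], and [L = 2] is the growth rate that the
    exponent [s = 4] produces in [ptw_normalized]. *)
Lemma tan_ge3_le54 p g : 1 < p -> p <= 5 / 4 -> p * g = pi / 2 -> 3 <= tan g.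
Proof.
move=> p1 p2 pg; have p0 := pi_gt0 R.
have g1 : 2 * pi / 5 <= g by nra.
have g2 : g < pi / 2 by nra.
have cg : 0 < cos g by apply: cos_gt0_pihalf; apply/andP; split; nra.
have sg : 0 < sin g by apply: sin_gt0_pihalf; apply/andP; split; nra.
have cle : cos g ^+ 2 <= 1 / 10.
  apply: le_trans cos_two_fifths_pi.
  rewrite ler_sqr ?nnegrE ?(ltW cg)//; last first.
    by apply: cos_ge0_pihalf; apply/andP; split; lra.
  rewrite leNgt ltr_cos ?in_itv/= -?leNgt//; by apply/andP; split; lra.
rewrite /tan ler_pdivlMr// -ler_sqr ?nnegrE ?mulr_ge0 ?(ltW cg) ?(ltW sg)//.
by move: cle; rewrite exprMn; have := cos2Dsin2 g; lra.
Qed.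

Definition two_or_four p s := s = 2 \/ (s = 4 /\ p <= 5 / 4).

(** Division by [(r q) ^ (p/2)] leaves an inequality in [x = (r^2 + q^2) / (2 r q)]: the mean of
    [r^s] and [q^s] becomes [x] for [s = 2] and [2 x^2 - 1] for [s = 4]. At [x = 1] it is
    [cos_powR_ge]; [powR_shift_ge] then compares the growth of the two sides in [x], with [L = 1] or
    [L = 2]. *)
Lemma ptw_normalized p g s x u : 1 < p -> p < 2 -> p * g = pi / 2 ->
  two_or_four p s -> 1 <= x -> 0 <= u <= pi / 2 ->
  (if s == 2 then x else 2 * x ^+ 2 - 1) `^ (p / s) + tan g * cos (p * u)
  <= ((x + cos (2 * u)) / (2 * cos g ^+ 2)) `^ (p / 2).
Proof.
move=> p1 p2 pg hs x1 hu; have p0 := pi_gt0 R.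
have /andP[u0 u1] := hu.
have g0 : 0 < g by nra.
have cg : 0 < cos g by apply: cos_gt0_pihalf; apply/andP; split; nra.
have cu : 0 <= cos u by apply: cos_ge0_pihalf; apply/andP; split; lra.
have K0 : 0 < 2 * cos g ^+ 2 by rewrite mulr_gt0// exprn_gt0.
have cc : -1 <= cos (2 * u) <= 1 by rewrite cos_geN1 cos_le1.
have k0 : 0 < p / 2 by lra.
have k1 : p / 2 < 1 by lra.
have base : 1 + tan g * cos (p * u) <= ((1 + cos (2 * u)) / (2 * cos g ^+ 2)) `^ (p / 2).
  apply: le_trans (cos_powR_ge p1 p2 pg hu) _.
  have -> : (1 + cos (2 * u)) / (2 * cos g ^+ 2) = cos u ^+ 2 * (cos g ^+ 2)^-1.
    rewrite (_ : 2 * u = u *+ 2) ?cos_mulr2n; last by rewrite mulr_natl.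
    by field; rewrite gt_eqF.
  rewrite powRM ?sqr_ge0 ?invr_ge0 ?sqr_ge0// sqr_powR_half//.
  by rewrite powRVr ?sqr_ge0// sqr_powR_half ?(ltW cg).
apply: le_trans (_ : (if s == 2 then x else 2 * x ^+ 2 - 1) `^ (p / s) - 1 +
  ((1 + cos (2 * u)) / (2 * cos g ^+ 2)) `^ (p / 2) <= _).
  by move: base; lra.
rewrite -lerBrDr.
case: hs => [->|[-> p54]]; rewrite ?eqxx.
- apply: (@powR_shift_ge _ _ _ _ 1 _ (fun y => y `^ (p / 2))
    (fun y => p / 2 * y `^ (p / 2 - 1))) => //.
  + by rewrite powR1.
  + by move=> y y1; der_auto; [lra|ring].
  + by move=> y y1; rewrite mulr1.
  + by apply: (cos_powR_le p1 p2 pg) => //; have := tan_ge1_lt2 p1 p2 pg; lra.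
- rewrite (_ : (4 : R) == 2 = false); last by apply/negbTE/eqP; lra.
  apply: (@powR_shift_ge _ _ _ _ 2 _ (fun y => (2 * y ^+ 2 - 1) `^ (p / 4))
    (fun y => p / 2 * 2 * (y * (2 * y ^+ 2 - 1) `^ (p / 4 - 1)))) => //.
  + by rewrite (_ : 2 * 1 ^+ 2 - 1 = 1) ?powR1//; ring.
  + by move=> y y1; der_auto; [nra|rewrite /=; field].
  + move=> y y1; rewrite ler_pM2l ?mulr_gt0//; last by lra.
    have y0 : 0 < y by lra.
    have -> : y `^ (p / 2 - 1) = y * (y ^+ 2) `^ (p / 4 - 1).
      rewrite -powR_mulrn ?(ltW y0)// -powRrM -{2}[y]powRr1 ?(ltW y0)//.
      by rewrite -powRD ?(gt_eqF y0) ?implybT//; congr (_ `^ _); lra.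
    rewrite ler_pM2l// -[leLHS]invrK -[leRHS]invrK.
    rewrite lef_pV2 ?posrE ?invr_gt0 ?powR_gt0 ?exprn_gt0//; last by nra.
    rewrite -!powRN; apply: ge0_ler_powR; rewrite ?nnegrE ?sqr_ge0//; [lra|nra|nra].
  + by apply: (cos_powR_le p1 p2 pg) => //; have := tan_ge3_le54 p1 p54 pg; lra.
Qed.

(** One modulus is 0, so division by [r q] is impossible; the cosine term vanishes with [r q] and a
    comparison of constants remains. *)
Lemma ptw_lt2_axis p g s a : 1 < p -> p < 2 -> p * g = pi / 2 ->
  two_or_four p s -> 0 <= a ->
  (a `^ s / 2) `^ (p / s) <= (a ^+ 2 / (4 * cos g ^+ 2)) `^ (p / 2).
Proof.
move=> p1 p2 pg hs a0; have pi0 := pi_gt0 R.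
have g0 : 0 < g by nra.
have cg : 0 < cos g by apply: cos_gt0_pihalf; apply/andP; split; nra.
have s0 : 0 < s by case: hs => [->|[-> _]].
have C4 : 0 <= (4 * cos g ^+ 2)^-1 by rewrite invr_ge0 !mulr_ge0 ?(ltW cg).
have i2 : 0 <= (2 : R)^-1 by rewrite invr_ge0.
rewrite (powRM _ (powR_ge0 a s) i2) (powRM _ (sqr_ge0 a) C4).
have -> : (a `^ s) `^ (p / s) = (a ^+ 2) `^ (p / 2).
  have e1 : s * (p / s) = p by rewrite mulrCA divff ?mulr1 ?gt_eqF.
  have e2 : 2%:R * (p / 2) = p by lra.
  by rewrite -(powR_mulrn _ a0) -!powRrM e1 e2.
apply: ler_wpM2l; first exact: powR_ge0.
rewrite !powRVr ?mulr_ge0 ?mulr_ge0 ?(ltW cg)//.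
rewrite lef_pV2 ?posrE ?powR_gt0 ?mulr_gt0 ?exprn_gt0//.
rewrite (_ : 4 * cos g ^+ 2 = 2 * (2 * cos g ^+ 2)); last by ring.
have T0 : (0 : R) < 2 `^ (p / 2) by rewrite powR_gt0.
rewrite powRM ?mulr_ge0 ?mulr_ge0 ?(ltW cg)//.
have t1 := tan_ge1_lt2 p1 p2 pg.
case: hs => [->|[-> p54]].
- have h1 : 2 * 1 <= 1 + tan g by lra.
  have := ler_wpM2l (ltW T0) (cos_powR_le p1 p2 pg ltr01 h1).
  rewrite -powRD ?pnatr_eq0 ?implybT// (_ : p / 2 + p / 2 = p); last by lra.
  have : (2 : R) `^ p <= 2 `^ (p / 2 + 1) by rewrite ler_powR//; lra.
  have -> : (2 : R) `^ (p / 2 + 1) = 2 `^ (p / 2) * 2.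
    by rewrite powRD ?powRr1// pnatr_eq0 implybT.
  lra.
- have t3 := tan_ge3_le54 p1 p54 pg.
  have h1 : 2 * 2 <= 1 + tan g by lra.
  have := ler_wpM2l (ltW T0) (cos_powR_le p1 p2 pg (ltr0n _ 2) h1).
  rewrite -powRD ?pnatr_eq0 ?implybT// (_ : p / 2 + p / 2 = p); last by lra.
  have : (2 : R) `^ p <= 2 `^ (p / 4 + 2) by rewrite ler_powR//; lra.
  have -> : (2 : R) `^ (p / 4 + 2) = 2 `^ (p / 4) * 2 ^+ 2.
    by rewrite powRD ?powR_mulrn// pnatr_eq0 implybT.
  lra.
Qed.

Lemma ptw_lt2 p g s r q u : 1 < p -> p < 2 -> p * g = pi / 2 ->
  two_or_four p s -> 0 <= r -> 0 <= q -> 0 <= u <= pi / 2 ->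
  ((r `^ s + q `^ s) / 2) `^ (p / s) + tan g * ((r * q) `^ (p / 2) * cos (p * u))
  <= ((r ^+ 2 + q ^+ 2 + 2 * (r * q) * cos (2 * u)) / (4 * cos g ^+ 2)) `^ (p / 2).
Proof.
move=> p1 p2 pg hs r0 q0 hu; have pi0 := pi_gt0 R.
have g0 : 0 < g by nra.
have cg : 0 < cos g by apply: cos_gt0_pihalf; apply/andP; split; nra.
have s0 : 0 < s by case: hs => [->|[-> _]].
have pk : p / 2 != 0 by rewrite gt_eqF//; lra.
have := r0; rewrite le_eqVlt => /predU1P[<-|r1].
  rewrite !(mul0r, mulr0, expr0n, add0r, addr0, powR0)// ?gt_eqF//.
  exact: ptw_lt2_axis.
have := q0; rewrite le_eqVlt => /predU1P[<-|q1].
  rewrite !(mul0r, mulr0, expr0n, add0r, addr0, powR0)// ?gt_eqF//.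
  exact: ptw_lt2_axis.
have rq : 0 < r * q by rewrite mulr_gt0.
set x := (r ^+ 2 + q ^+ 2) / (2 * (r * q)).
have x1 : 1 <= x.
  rewrite /x ler_pdivlMr ?mulr_gt0// mul1r.
  by have := sqr_ge0 (r - q); nra.
have := ptw_normalized p1 p2 pg hs x1 hu.
have -> : (x + cos (2 * u)) / (2 * cos g ^+ 2) =
  (r ^+ 2 + q ^+ 2 + 2 * (r * q) * cos (2 * u)) / (4 * cos g ^+ 2) * (r * q)^-1.
  by rewrite /x; field; rewrite !gt_eqF.
have X0 : 0 <= (r ^+ 2 + q ^+ 2 + 2 * (r * q) * cos (2 * u)) / (4 * cos g ^+ 2).
  rewrite divr_ge0//; last by rewrite !mulr_ge0 ?(ltW cg).
  have := sqr_ge0 (r - q); have := cos_geN1 (2 * u); nra.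
rewrite (powRM _ X0) ?invr_ge0 ?(ltW rq)// powRVr ?(ltW rq)//.
rewrite ler_pdivlMr ?powR_gt0// => h; apply: le_trans h; rewrite [leRHS]mulrDl.
rewrite lerD//; last by rewrite le_eqVlt; apply/orP; left; apply/eqP; ring.
have P0 : 0 <= r `^ s + q `^ s by rewrite addr_ge0 ?powR_ge0.
rewrite le_eqVlt; apply/orP; left; apply/eqP.
case: hs => [->|[-> _]]; rewrite ?eqxx.
  rewrite -powRM ?(ltW rq)//; last by lra.
  by congr (_ `^ _); rewrite /x !powR_mulrn//; field; rewrite !gt_eqF.
rewrite (_ : (4 : R) == 2 = false); last by apply/negbTE/eqP; lra.
have -> : (r * q) `^ (p / 2) = ((r * q) ^+ 2) `^ (p / 4).
  by rewrite -powR_mulrn ?(ltW rq)// -powRrM; congr (_ `^ _); lra.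
rewrite -powRM ?sqr_ge0//; last by nra.
by congr (_ `^ _); rewrite /x !powR_mulrn//; field; rewrite !gt_eqF.
Qed.

End PointwiseBelowTwo.

(** * The pointwise inequality for [p >= 2] *)

Section FirstOrder.
Context {R : realType}.
Implicit Types (f : R -> R) (x d : R).

Lemma der_expansion f x d : der x f d -> forall e : R, 0 < e ->
  exists2 del : R, 0 < del &
  forall h, `|h| < del -> `|f (x + h) - f x - d * h| <= e * `|h|.
Proof.
move=> [fd <-] e e0.
have := fd; rewrite /derivable => /cvg_ex[/= l hl].
have -> : 'D_1 f x = l by exact: cvg_lim.
move/cvgrPdist_le : hl => /(_ e e0)[/= del del0 H].
exists del => // h hd; have [->|h0] := eqVneq h 0.
  by rewrite addr0 subrr mulr0 subr0 normr0 mulr0.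
have := H h; rewrite /= sub0r normrN => /(_ hd h0).
rewrite [_%:A]mulr1 (addrC h x) => hh.
rewrite (_ : f (x + h) - f x - l * h = - (l - h^-1 * (f (x + h) - f x)) * h).
  by rewrite normrM normrN ler_wpM2r.
by field.
Qed.

Lemma der_gt0_right f x d : der x f d -> 0 < d ->
  exists2 del : R, 0 < del & forall h, 0 < h < del -> f x < f (x + h).
Proof.
move=> fd d0; have d2 : 0 < d / 2 by lra.
have [del del0 H] := der_expansion fd d2; exists del => // h /andP[h0 hd].
have := H h; rewrite gtr0_norm// => /(_ hd); rewrite ler_norml => /andP[h1 _].
by rewrite -subr_gt0; nra.
Qed.

Lemma der_right_min f x d b : der x f d -> x < b ->
  (forall y, x <= y <= b -> f x <= f y) -> 0 <= d.
Proof.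
move=> fd xb H; rewrite leNgt; apply/negP => d0.
have [|del del0 h] := der_gt0_right (derN fd); first by lra.
have m0 : 0 < Num.min (del / 2) (b - x) by rewrite lt_min; apply/andP; split; lra.
have m1 : Num.min (del / 2) (b - x) <= del / 2 by rewrite ge_min lexx.
have m2 : Num.min (del / 2) (b - x) <= b - x by rewrite ge_min lexx orbT.
move: m0 m1 m2; set m := Num.min _ _ => m0 m1 m2.
have := h m; have := H (x + m).
have -> : x <= x + m <= b by apply/andP; split; lra.
have -> : 0 < m < del by apply/andP; split; lra.
by move=> /(_ isT) ? /(_ isT) ?; lra.
Qed.

Lemma der_left_min f x d a : der x f d -> a < x ->
  (forall y, a <= y <= x -> f x <= f y) -> d <= 0.
Proof.
move=> fd ax H.
have gd : der (- x) (fun t => f (- t)) (- d).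
  have fd' : der (- - x) f d by rewrite opprK.
  apply: derE (der_comp (g := fun t => - t) fd' (derN (der_id _))) _.
  exact: mulrN1.
rewrite -oppr_ge0; apply: (der_right_min gd (b := - a)); first by lra.
by move=> y /andP[? ?]; rewrite opprK; apply: H; apply/andP; split; lra.
Qed.

Lemma der_min f x d a b : der x f d -> a < x < b ->
  (forall y, a <= y <= b -> f x <= f y) -> d = 0.
Proof.
move=> fd /andP[ax xb] H; apply/eqP; rewrite eq_le; apply/andP; split.
  by apply: (der_left_min fd ax) => y /andP[? ?]; apply: H; apply/andP; split; lra.
by apply: (der_right_min fd xb) => y /andP[? ?]; apply: H; apply/andP; split; lra.
Qed.

(** A second-order test at an end point with vanishing slope. It serves the edge [u = 0] of the
    rectangle in [num_le_den], where evenness in [u] makes the first derivative vanish anyway. *)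
Lemma der2_right_min f f' x d b : (forall y, x <= y <= b -> der y f (f' y)) ->
  f' x = 0 -> der x f' d -> x < b ->
  (forall y, x <= y <= b -> f x <= f y) -> 0 <= d.
Proof.
move=> fd f0 dd xb H; rewrite leNgt; apply/negP => d0.
have [|del del0 h] := der_gt0_right (derN dd); first by lra.
have m0 : 0 < Num.min (del / 2) (b - x) by rewrite lt_min; apply/andP; split; lra.
have m1 : Num.min (del / 2) (b - x) <= del / 2 by rewrite ge_min lexx.
have m2 : Num.min (del / 2) (b - x) <= b - x by rewrite ge_min lexx orbT.
move: m0 m1 m2; set m := Num.min _ _ => m0 m1 m2.
have : - f x < - f (x + m).
  apply: (@der_lt _ (fun y => - f y) (fun y => - f' y)); first by lra.
  - apply: within_cont => y /andP[y1 y2]; apply: contN; apply: der_cont.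
    by apply: fd; apply/andP; split; lra.
  - by move=> y /andP[y1 y2]; apply: derN; apply: fd; apply/andP; split; lra.
  - move=> y /andP[y1 y2]; have := h (y - x).
    rewrite f0 oppr0 [x + _]addrC subrK; apply; apply/andP; split; lra.
have := H (x + m); have -> : x <= x + m <= b by apply/andP; split; lra.
by move=> /(_ isT); lra.
Qed.

End FirstOrder.

(** * One-variable inequalities for [p > 2] *)

Section SinePower.
Context {R : realType}.
Notation pi := (@pi R).
Implicit Types (p g u : R).

(** Up to sign, this is the numerator of the derivative of the quotient in [quot_cos_sin_le]. As
    long as [(p - 1) u <= pi / 2] its own derivative is nonnegative; beyond, the addition formula
    with [cos ((p - 1) u) <= 0] gives the sign. *)
Lemma quot_cos_sin_num_ge0 p u : 2 < p -> 0 <= u -> p * u <= pi ->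
  0 <= p * cos u * sin ((p - 1) * u) - sin (p * u).
Proof.
move=> p2 u0 u1; have pi0 := pi_gt0 R.
have u2 : u < pi / 2 by nra.
have [h|h] := leP ((p - 1) * u) (pi / 2).
- pose f (v : R) := p * cos v * sin ((p - 1) * v) - sin (p * v).
  rewrite -[X in X <= _](_ : f 0 = 0); last by rewrite /f !mulr0 sin0; ring.
  apply: (@der_le _ f (fun v => p * (p - 2) * (cos v * cos ((p - 1) * v)))) => //.
  + apply: within_cont => x _; rewrite /f; cont_auto.
  + move=> x _; rewrite /f; der_auto.
    rewrite (_ : p * x = (p - 1) * x + x); last by ring.
    rewrite cosD; ring.
  + move=> x /andP[x0 xu].
    by rewrite mulr_ge0 ?mulr_ge0 ?cos_ge0_pihalf//; [lra|lra|apply/andP; split; nra..].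
- have -> : p * u = (p - 1) * u + u by ring.
  rewrite sinD.
  have s0 : 0 <= sin ((p - 1) * u) by apply: sin_ge0_pi; apply/andP; split; nra.
  have s1 : 0 <= sin u by apply: sin_ge0_pi; apply/andP; split; nra.
  have c1 : 0 <= cos u by apply: cos_ge0_pihalf; apply/andP; split; nra.
  have c0 : cos ((p - 1) * u) <= 0.
    rewrite -oppr_ge0 -[X in - cos X](subrK pi) cosDpi opprK.
    by apply: cos_ge0_pihalf; apply/andP; split; nra.
  have h1 : 0 <= (p - 2) * (cos u * sin ((p - 1) * u)) by rewrite !mulr_ge0//; lra.
  have h3 : 0 <= cos u * sin ((p - 1) * u) by rewrite mulr_ge0.
  have h2 : 0 <= sin u * - cos ((p - 1) * u) by rewrite !mulr_ge0//; lra.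
  lra.
Qed.

Lemma quot_cos_sin_le p u v : 2 < p -> 0 < u -> u <= v -> p * v <= pi ->
  sin (p * v) / (cos v * sin v `^ (p - 1)) <=
  sin (p * u) / (cos u * sin u `^ (p - 1)).
Proof.
move=> p2 u0 uv vpi; have p0 := pi_gt0 R.
have sc x : u <= x <= v -> 0 < sin x /\ 0 < cos x.
  by move=> /andP[? ?]; split; [apply: sin_gt0_pihalf|apply: cos_gt0_pihalf];
    apply/andP; split; nra.
pose q (x : R) := sin (p * x) / (cos x * sin x `^ (p - 1)).
pose q' (x : R) := - ((p * cos x * sin ((p - 1) * x) - sin (p * x)) /
    (cos x ^+ 2 * (sin x `^ (p - 1) * sin x))).
have dq x : u <= x <= v -> der x q (q' x).
  move=> xuv; have [s0 c0] := sc _ xuv.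
  have c1 : 0 < sin x `^ (p - 1) by rewrite powR_gt0.
  have nz : cos x * sin x `^ (p - 1) != 0 by rewrite gt_eqF// mulr_gt0.
  rewrite /q; der_auto => //; rewrite /q'.
  have -> : sin x `^ (p - 1 - 1) = sin x `^ (p - 1) / sin x.
    by rewrite powRB ?powRr1 ?ltW// (gt_eqF s0) implybT.
  have e1 := cos2Dsin2 x.
  rewrite (_ : (p - 1) * x = p * x - x); last by ring.
  rewrite sinB.
  apply/eqP; rewrite -subr_eq0; apply/eqP.
  set C := sin x `^ (p - 1) in c1 *.
  transitivity (((cos x ^+ 2 + sin x ^+ 2) - 1) * sin (p * x) /
    (cos x ^+ 2 * (C * sin x))); last by rewrite e1 subrr !mul0r.
  by field; rewrite !gt_eqF.
apply: (@der_ge _ q q') => //.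
- by apply: within_cont => x /dq /der_cont.
- by move=> x /andP[? ?]; apply: dq; apply/andP; split; lra.
move=> x /andP[ux xv]; have [s0 c0] : 0 < sin x /\ 0 < cos x by apply: sc; apply/andP; split; lra.
have c1 : 0 < sin x `^ (p - 1) by rewrite powR_gt0.
rewrite /q' oppr_le0 divr_ge0//.
  by apply: quot_cos_sin_num_ge0 => //; nra.
by rewrite !mulr_ge0// ltW.
Qed.

(** The right side is least at [u = g], where it is 1; [cos g / sin g] is the coefficient for which
    its derivative vanishes there. This settles the edge [E = 1] in [num_le_den]. *)
Lemma sin_powR_ge p g u : 2 < p -> p * g = pi / 2 -> 0 <= u -> p * u <= pi ->
  1 <= sin u `^ p / sin g `^ p + cos g / sin g * cos (p * u).
Proof.
move=> p2 pg u0 u1; have p0 := pi_gt0 R.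
have g0 : 0 < g by nra.
have g1 : g < pi / 2 by nra.
have sg : 0 < sin g by apply: sin_gt0_pihalf; rewrite g0.
have cg : 0 < cos g by apply: cos_gt0_pihalf; apply/andP; split; lra.
have cgp : 0 < sin g `^ p by rewrite powR_gt0.
pose f (x : R) := sin x `^ p / sin g `^ p + cos g / sin g * cos (p * x).
pose f' (x : R) := p * (sin x `^ (p - 1) * cos x) *
  ((sin g `^ p)^-1 - cos g / sin g * (sin (p * x) / (cos x * sin x `^ (p - 1)))).
suff : f g <= f u by rewrite /f pg cos_pihalf mulr0 addr0 divff ?gt_eqF.
have dcont a b : 0 <= a -> p * b <= pi -> {within `[a, b], continuous f}.
  move=> a0 b1; apply: (@within_cont_eq _ _
    (fun x => `|sin x| `^ p / sin g `^ p + cos g / sin g * cos (p * x))).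
    move=> x /andP[? ?]; rewrite /f ger0_norm//.
    by apply: sin_ge0_pi; apply/andP; split; nra.
  move=> x _; cont_auto; lra.
have sc x : 0 < x -> p * x < pi -> 0 < sin x /\ 0 < cos x.
  by move=> ? ?; split; [apply: sin_gt0_pihalf|apply: cos_gt0_pihalf];
    apply/andP; split; nra.
have dder x : 0 < x -> p * x < pi -> der x f (f' x).
  move=> x0 x1; have [sx cx] := sc _ x0 x1.
  have c1 : 0 < sin x `^ (p - 1) by rewrite powR_gt0.
  rewrite /f; der_auto => //; rewrite /f'.
  by field; rewrite !gt_eqF.
have qg : cos g / sin g * (sin (p * g) / (cos g * sin g `^ (p - 1))) = (sin g `^ p)^-1.
  rewrite pg sin_pihalf -(@mulr_powRB1 _ (sin g) p) ?(ltW sg)//; last by lra.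
  by field; rewrite !gt_eqF// powR_gt0.
have tg : 0 < cos g / sin g by rewrite divr_gt0.
have [gu|ug] := leP g u.
- apply: (@der_le _ f f') => //; first by apply: dcont; lra.
    by move=> x /andP[? ?]; apply: dder; nra.
  move=> x /andP[? ?]; rewrite /f' -qg -mulrBr.
  have [sx cx] : 0 < sin x /\ 0 < cos x by apply: sc; nra.
  rewrite mulr_ge0//; first by rewrite !mulr_ge0 ?powR_ge0 ?(ltW cx)//; lra.
  by rewrite mulr_ge0 ?(ltW tg)// subr_ge0; apply: quot_cos_sin_le; nra.
- apply: (@der_ge _ f f') => //; [by lra|by apply: dcont; nra| |].
    by move=> x /andP[? ?]; apply: dder; nra.
  move=> x /andP[? ?]; rewrite /f' -qg -mulrBr.
  have [sx cx] : 0 < sin x /\ 0 < cos x by apply: sc; nra.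
  rewrite mulr_ge0_le0//; first by rewrite !mulr_ge0 ?powR_ge0 ?(ltW cx)//; lra.
  by rewrite mulr_ge0_le0 ?(ltW tg)// subr_le0; apply: quot_cos_sin_le; nra.
Qed.

(** It bounds the ratio [(E - E^(p-1)) / (1 - E^p)] above by [(p - 2) / p], while [sin_ratio_gt]
    bounds [sin ((p - 2) u) / sin (p u)] below by the same number. The fact [key] in
    [no_interior_critical] equates the two ratios. *)
Lemma powR_deficit_gt0 p E : 2 < p -> 0 < E -> E < 1 ->
  p * (E - E `^ (p - 1)) < (p - 2) * (1 - E `^ p).
Proof.
move=> p2 E0 E1.
have b x : 0 < x -> x < 1 -> (p - 1) * x `^ (p - 2) < 1 + (p - 2) * x `^ (p - 1).
  move=> x0 x1.
  pose f y : R := (p - 1) * y `^ (p - 2) - (p - 2) * y `^ (p - 1).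
  pose f' y : R := (p - 1) * (p - 2) * (y `^ (p - 2 - 1) - y `^ (p - 1 - 1)).
  suff : f x < f 1 by rewrite /f !powR1; lra.
  apply: (@der_lt _ f f'); first by [].
  - by apply: within_cont => y /andP[y0 _]; rewrite /f; cont_auto; lra.
  - move=> y /andP[y0 _]; have yp : 0 < y by lra.
    by rewrite /f; der_auto => //; rewrite /f'; ring.
  - move=> y /andP[y0 y1]; have yp : 0 < y by lra.
    rewrite /f' !mulr_gt0//; [lra|lra|].
    rewrite (_ : p - 1 - 1 = p - 2); last by ring.
    have <- : y * y `^ (p - 2 - 1) = y `^ (p - 2) by rewrite mulr_powRB1 ?(ltW yp)//; lra.
    have := powR_gt0 (p - 2 - 1) yp; nra.
pose f y : R := p * (y - y `^ (p - 1)) - (p - 2) * (1 - y `^ p).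
pose f' y : R := p * (1 + (p - 2) * y `^ (p - 1) - (p - 1) * y `^ (p - 2)).
suff : f E < f 1 by rewrite /f !powR1; lra.
apply: (@der_lt _ f f'); first by [].
- by apply: within_cont => y /andP[y0 _]; rewrite /f; cont_auto; lra.
- move=> y /andP[y0 _]; have yp : 0 < y by lra.
  rewrite /f; der_auto => //; rewrite /f'.
  by rewrite (_ : p - 1 - 1 = p - 2)//; ring.
- move=> y /andP[y0 y1]; rewrite /f' mulr_gt0//; first by lra.
  by rewrite subr_gt0; apply: b; lra.
Qed.

Lemma sin_ratio_gt p u : 2 < p -> 0 < u -> p * u < pi ->
  (p - 2) * sin (p * u) < p * sin ((p - 2) * u).
Proof.
move=> p2 u0 u1.
pose f y : R := p * sin ((p - 2) * y) - (p - 2) * sin (p * y).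
suff : f 0 < f u by rewrite /f !mulr0 !sin0; lra.
apply: (@der_lt _ f (fun y => p * (p - 2) * (cos ((p - 2) * y) - cos (p * y)))) => //.
- by apply: within_cont => y _; rewrite /f; cont_auto.
- by move=> y _; rewrite /f; der_auto; ring.
- move=> y /andP[y0 y1]; rewrite !mulr_gt0//; [lra|lra|].
  by rewrite subr_gt0 ltr_cos ?in_itv/=; [nra|apply/andP; split; nra..].
Qed.

(** [sin x exp (- x)] increases on [[0, pi / 4]]. Comparing its values at [g] and [pi / 4] and
    raising to the power [p], with [p g = pi / 2], reduces the claim to [ln 2 < pi / 2]. It says
    that the constant [R0] of [num_le_den] exceeds 1, the value of the quotient at [E = 0]. *)
Lemma sin_powR_lt p g : 2 < p -> p * g = pi / 2 -> 2 `^ p * sin g `^ p < 2.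
Proof.
move=> p2 pg; have pi0 := pi_gt0 R; have pi2 := pi_ge2 R.
have g0 : 0 < g by nra.
have g1 : g < pi / 4 by nra.
have sg : 0 < sin g by apply: sin_gt0_pihalf; apply/andP; split; lra.
have h : sin g * expR (- g) <= sin (pi / 4) * expR (- (pi / 4)).
  apply: (@der_le _ (fun x => sin x * expR (- x))
    (fun x => expR (- x) * (cos x - sin x))); first by lra.
  - by apply: within_cont => x _; apply: der_cont; der_auto.
  - by move=> x _; der_auto; ring.
  - move=> x /andP[x0 x1]; rewrite mulr_ge0 ?expR_ge0// subr_ge0.
    rewrite -(cosBpihalf x) -cosN opprB.
    by rewrite leNgt ltr_cos ?in_itv/= -?leNgt; [lra|apply/andP; split; lra..].
have s0 : 0 < sin (pi / 4) :> R by apply: sin_gt0_pihalf; apply/andP; split; lra.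
have c0 : 0 < cos (pi / 4) :> R by apply: cos_gt0_pihalf; apply/andP; split; lra.
have s4 : sin (pi / 4) ^+ 2 = 2^-1 :> R.
  have := tan_piquarter R; rewrite /tan => /(congr1 ( *%R^~ (cos (pi / 4)))).
  rewrite divfK ?gt_eqF// mul1r => e; have := cos2Dsin2 (pi / 4 : R).
  by rewrite -e; lra.
have -> : sin g = sin g * expR (- g) * expR g by rewrite -mulrA -expRD addNr expR0 mulr1.
have h1 : (sin g * expR (- g)) `^ p <= (sin (pi / 4) * expR (- (pi / 4))) `^ p.
  by apply: ge0_ler_powR; rewrite ?nnegrE ?mulr_ge0 ?expR_ge0 ?(ltW sg) ?(ltW s0)//; lra.
rewrite powRM ?mulr_ge0 ?expR_ge0 ?(ltW sg)//.
have E0 : 0 < expR g `^ p by rewrite powR_gt0 ?expR_gt0.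
apply: (@le_lt_trans _ _ (2 `^ p * ((sin (pi / 4) * expR (- (pi / 4))) `^ p * expR g `^ p))).
  rewrite ler_pM2l; last exact: powR_gt0.
  by rewrite (ler_pM2r E0).
clear h h1 E0.
rewrite powRM ?expR_ge0 ?(ltW s0)//.
have -> : sin (pi / 4) `^ p = (2 `^ (p / 2))^-1 :> R.
  rewrite -(sqr_powR_half _ (ltW s0)) s4; apply: powRVr; lra.
rewrite -!expRM.
have -> : 2 `^ p = 2 `^ (p / 2) * 2 `^ (p / 2) :> R.
  by rewrite -powRD ?pnatr_eq0 ?implybT//; congr (_ `^ _); lra.
have T0 : (0 : R) < 2 `^ (p / 2) by rewrite powR_gt0.
rewrite (_ : _ * _ * _ = 2 `^ (p / 2) * (expR (- (pi / 4) * p) * expR (g * p))); last first.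
  by field; rewrite gt_eqF.
rewrite -expRD {T0}.
have -> : 2 `^ (p / 2) = expR (p / 2 * ln 2) :> R by rewrite /powR pnatr_eq0.
rewrite -expRD -[X in _ < X](@lnK R 2) ?posrE// ltr_expR.
have l2 : ln 2 < pi / 2 :> R.
  rewrite -ltr_expR lnK ?posrE//; apply: (@le_lt_trans _ _ (1 + pi / 2)); first by lra.
  by apply: expR_gt1Dx; rewrite gt_eqF//; lra.
rewrite (mulrC g p) pg; nra.
Qed.

End SinePower.

(** * Exclusion of a maximum by its position, [p > 2] *)

Section CriticalPoints.
Context {R : realType}.
Notation pi := (@pi R).
Implicit Types (p g u E : R).

(** With [E = q / r], these are the two sides of the inequality divided by powers of [r], up to
    constants and the outer power; [den_fun E u] is [|1 - E e^{2iu}|^2]. *)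
Definition num_fun (p c E u : R) : R :=
  1 + E `^ p - 2 * c * (E `^ (p / 2) * cos (p * u)).
Definition den_fun (E u : R) : R := 1 + E ^+ 2 - 2 * E * cos (2 * u).

Lemma den_funE E u : den_fun E u = (1 - E) ^+ 2 + 4 * E * sin u ^+ 2.
Proof.
rewrite /den_fun (_ : 2 * u = u *+ 2) ?cos_mulr2n; last by rewrite mulr_natl.
by rewrite sin2cos2; ring.
Qed.

Lemma den_fun_ge0 E u : 0 <= E -> 0 <= den_fun E u.
Proof.
move=> E0; rewrite den_funE; apply: addr_ge0; first exact: sqr_ge0.
by apply: mulr_ge0; [lra|exact: sqr_ge0].
Qed.

Lemma der_num_u p c E u : der u (num_fun p c E) (2 * c * p * E `^ (p / 2) * sin (p * u)).
Proof. by rewrite /num_fun; der_auto; ring. Qed.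

Lemma der_den_u E u : der u (den_fun E) (4 * E * sin (2 * u)).
Proof. by rewrite /den_fun; der_auto; ring. Qed.

Lemma der_num_E p c E u : 0 < E -> der E (fun E => num_fun p c E u)
  (p * E `^ (p - 1) - p * c * E `^ (p / 2 - 1) * cos (p * u)).
Proof. by move=> E0; rewrite /num_fun; der_auto => //; field. Qed.

Lemma der_den_E E u : der E (fun E => den_fun E u) (2 * E - 2 * cos (2 * u)).
Proof. by rewrite /den_fun; der_auto; rewrite /=; ring. Qed.

(* Equality of the two one-variable ratios is what a critical point of
   [num_fun / den_fun `^ (p / 2)] would require. *)
Lemma no_interior_critical p c E u : 2 < p -> 0 < E -> E < 1 ->
  0 < u -> p * u < pi -> 0 < den_fun E u ->
  (1 - E `^ p) * den_fun E u = num_fun p c E u * (1 - E ^+ 2) ->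
  c * E `^ (p / 2) * sin (p * u) * den_fun E u = num_fun p c E u * E * sin (2 * u) ->
  False.
Proof.
move=> p2 E0 E1 u0 u1 d0 e1 e2; have pi0 := pi_gt0 R.
have s0 : 0 < sin (p * u) by apply: sin_gt0_pi; apply/andP; split; nra.
have h1 := powR_deficit_gt0 p2 E0 E1.
have h2 := sin_ratio_gt p2 u0 u1.
have EE : E `^ p = E * E `^ (p - 1) by rewrite mulr_powRB1 ?(ltW E0)//; lra.
have DP : 0 < 1 - E `^ p.
  have <- : 1 `^ p = 1 :> R by rewrite powR1.
  by rewrite subr_gt0; apply: gt0_ltr_powR; rewrite ?nnegrE//; lra.
set F := E `^ (p - 1) in h1 EE.
set G := E `^ (p / 2) in e1 e2.
set s := sin (p * u) in s0 h2 e2.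
have key : s * (E - F) = (1 - E `^ p) * sin ((p - 2) * u).
  have -> : sin ((p - 2) * u) = s * cos (2 * u) - cos (p * u) * sin (2 * u).
    by rewrite mulrBl sinB.
  apply: (mulfI (_ : 2 * E * den_fun E u != 0)); first by rewrite gt_eqF// !mulr_gt0.
  have a1 : num_fun p c E u = 1 + E `^ p - 2 * c * (G * cos (p * u)) by [].
  have a2 : den_fun E u = 1 + E ^+ 2 - 2 * E * cos (2 * u) by [].
  set n := num_fun p c E u in e1 e2 a1; set d := den_fun E u in e1 e2 a2 d0 *.
  have a3 : 2 * E * cos (2 * u) = 1 + E ^+ 2 - d by rewrite a2; ring.
  have a4 : 2 * (c * G) * cos (p * u) = 1 + E `^ p - n by rewrite a1; ring.
  have b1 : 2 * E * d * ((1 - E `^ p) * (s * cos (2 * u) - cos (p * u) * sin (2 * u)))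
     = (1 - E `^ p) * d * s * (2 * E * cos (2 * u))
     - (1 - E `^ p) * d * (2 * cos (p * u)) * (E * sin (2 * u)) by ring.
  have b2 : (1 - E `^ p) * d * (2 * cos (p * u)) * (E * sin (2 * u)) =
    (1 - E ^+ 2) * s * d * (2 * (c * G) * cos (p * u)).
    rewrite e1 (_ : n * (1 - E ^+ 2) * (2 * cos (p * u)) * (E * sin (2 * u)) =
      n * E * sin (2 * u) * ((1 - E ^+ 2) * (2 * cos (p * u)))); last by ring.
    by rewrite -e2; ring.
  rewrite b1 b2 a3 a4 EE.
  move: e1; rewrite EE => e1.
  have -> : (1 - E ^+ 2) * s * d * (1 + E * F - n) =
    (1 - E ^+ 2) * s * d * (1 + E * F) - s * d * (n * (1 - E ^+ 2)) by ring.
  by rewrite -e1; ring.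
have h3 : p * (E - F) * s < (p - 2) * (1 - E `^ p) * s by rewrite ltr_pM2r.
have h4 : (1 - E `^ p) * ((p - 2) * s) < (1 - E `^ p) * (p * sin ((p - 2) * u)).
  by rewrite ltr_pM2l.
have h5 : p * (E - F) * s = (1 - E `^ p) * (p * sin ((p - 2) * u)).
  by rewrite -mulrA (mulrC _ s) key; ring.
lra.
Qed.

(** On the edge [u = 0] the slope in [u] carries no information; the inequality among the hypotheses
    is the second-order condition [0 <= F2] of [num_le_den]. *)
Lemma no_axis_maximum p c E : 2 < p -> 0 < E -> E < 1 ->
  (1 - E `^ p) * den_fun E 0 = num_fun p c E 0 * (1 - E ^+ 2) ->
  c * (p / 2) * E `^ (p / 2) * den_fun E 0 <= num_fun p c E 0 * E -> False.
Proof.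
move=> p2 E0 E1 e1 e2.
have h1 := powR_deficit_gt0 p2 E0 E1.
have EE : E `^ p = E * E `^ (p - 1) by rewrite mulr_powRB1 ?(ltW E0)//; lra.
have a2 : den_fun E 0 = (1 - E) ^+ 2 by rewrite den_funE sin0; ring.
have a1 : num_fun p c E 0 = 1 + E `^ p - 2 * c * E `^ (p / 2).
  by rewrite /num_fun !mulr0 cos0; ring.
set F := E `^ (p - 1) in h1 EE.
set G := E `^ (p / 2) in e2 a1.
set n := num_fun p c E 0 in e1 e2 a1.
move: e1 e2; rewrite a2 EE => e1 e2.
have e3 : (1 - E * F) * (1 - E) = n * (1 + E).
  by apply: (mulIf (_ : 1 - E != 0)); [rewrite gt_eqF//; lra|rewrite -mulrA -expr2 e1; ring].
have a4 : 2 * (c * G) = 1 + E * F - n by rewrite a1 EE; ring.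
have e4 : p * ((1 + E * F - n) * (1 - E) ^+ 2) <= 4 * (n * E).
  by rewrite -a4; lra.
have e5 : p * (((1 + E * F) * (1 + E) - (1 - E * F) * (1 - E)) * (1 - E) ^+ 2) <= 4 * ((1 - E * F) * (1 - E) * E).
  rewrite e3.
  have -> : ((1 + E * F) * (1 + E) - n * (1 + E)) * (1 - E) ^+ 2 =
    (1 + E) * ((1 + E * F - n) * (1 - E) ^+ 2) by ring.
  rewrite mulrCA (_ : 4 * (n * (1 + E) * E) = (1 + E) * (4 * (n * E))); last by ring.
  by rewrite ler_pM2l//; lra.
have e6 : 2 * E * (1 - E) * (p * ((1 + F) * (1 - E))) <= 2 * E * (1 - E) * (2 * (1 - E * F)).
  have b1 : 2 * E * (1 - E) * (p * ((1 + F) * (1 - E))) =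
    p * (((1 + E * F) * (1 + E) - (1 - E * F) * (1 - E)) * (1 - E) ^+ 2) by ring.
  have b2 : 2 * E * (1 - E) * (2 * (1 - E * F)) =
    4 * ((1 - E * F) * (1 - E) * E) by ring.
  by rewrite b1 b2.
move: e6; rewrite ler_pM2l ?mulr_gt0 ?subr_gt0//.
(* Since [(1 + F) (1 - E) = (1 - E F) - (E - F)], what is left is the reverse of [h1]. *)
rewrite EE in h1; nra.
Qed.

Ltac clear_powers := repeat match goal with
  | H : ?T |- _ => lazymatch T with
    | context [powR] => clear H
    | context [num_fun] => clear H
    | context [den_fun] => clear H
    end
  end.
Ltac lra_light := clear_powers; lra.
Ltac nra_light := clear_powers; nra.

(** A violation would give the quotient [num_fun / den_fun ^ (p/2)] a maximum [M > R0 > 1] on the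
    compact set [K], and no position is possible for it: the quotient is 1 at [E = 0] and at most
    [R0] at [E = 1] by [sin_powR_ge]; the interior and the edge [u = 0] are excluded by the two
    lemmas above; on the edge [p u = pi] the slope has the wrong sign. *)
Lemma num_le_den p g E u : 2 < p -> p * g = pi / 2 -> 0 <= E <= 1 ->
  0 <= u -> p * u <= pi ->
  num_fun p (cos g / sin g) E u <=
  2 / (4 * sin g ^+ 2) `^ (p / 2) * den_fun E u `^ (p / 2).
Proof.
move=> p2 pg hE u0 u1; have pi0 := pi_gt0 R.
have g0 : 0 < g by nra.
have g1 : g < pi / 4 by nra.
have sg : 0 < sin g by apply: sin_gt0_pihalf; apply/andP; split; lra.
have sc : sin g < cos g.
  have -> : sin g = cos (pi / 2 - g) by rewrite cosB cos_pihalf sin_pihalf; ring.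
  by rewrite ltr_cos ?in_itv/=; [lra|apply/andP; split; lra..].
set c := cos g / sin g; set R0 := 2 / _.
have c1 : 1 < c by rewrite /c ltr_pdivlMr// mul1r.
have s4 : (4 * sin g ^+ 2) `^ (p / 2) = 2 `^ p * sin g `^ p.
  rewrite -powRM ?(ltW sg)// -[RHS]sqr_powR_half ?mulr_ge0 ?(ltW sg)//.
  by congr (_ `^ _); ring.
have sp0 : 0 < 2 `^ p * sin g `^ p by rewrite mulr_gt0// powR_gt0.
have R01 : 1 < R0.
  by rewrite /R0 s4 ltr_pdivlMr// mul1r; exact: sin_powR_lt.
have {}s4 := conj s4 I; have {}sp0 := conj sp0 I; have {}pg := conj pg I.
have cE := conj (erefl c) I; have R0E := conj (erefl R0) I.
rewrite {2}/c in cE; rewrite {2}/R0 in R0E; clearbody c R0.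
rewrite leNgt; apply/negP => hlt.
pose N (x : R * R) := 1 + `|x.1| `^ p - 2 * c * (`|x.1| `^ (p / 2) * cos (p * x.2)).
pose D (x : R * R) := 1 + x.1 ^+ 2 - 2 * x.1 * cos (2 * x.2).
have NE x v : 0 <= x -> N (x, v) = num_fun p c x v.
  by move=> x0; rewrite /N /= ger0_norm.
have DE x v : D (x, v) = den_fun x v by [].
have cN x : {for x, continuous N} by rewrite /N; cont_auto; lra_light.
have cD x : {for x, continuous D} by rewrite /D; cont_auto.
(* Keeping only points with nonnegative [num_fun] removes the one zero [(1, 0)] of [den_fun], where
   [num_fun] is [2 - 2 c < 0]; the quotient is then continuous on [K]. *)
pose K := (`[0, 1] `*` `[0, pi / p]) `&` (N @^-1` [set y | 0 <= y]).
have KP x v : K (x, v) <-> [/\ 0 <= x <= 1, 0 <= v, p * v <= pi & 0 <= num_fun p c x v].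
  have e : (v <= pi / p) = (p * v <= pi) by rewrite ler_pdivlMr 1?mulrC//; lra_light.
  split.
    move=> [[]] /=; rewrite !in_itv/= e => /[dup] /andP[x0 _] -> /andP[-> ->].
    by rewrite NE.
  move=> [/[dup] /andP[x0 _] hx v0 v1 n0]; split => /=; last by rewrite NE.
  by rewrite !in_itv/= hx e v0 v1.
have cK : compact K.
  have cB : compact (`[0, 1] `*` `[0, pi / p] : set (R * R)).
    by apply: compact_setX; exact: segment_compact.
  have cl : closed K.
    apply: closedI.
      by apply: compact_closed => //; exact: norm_hausdorff.
    by apply: preimage_closed; [move=> x _; exact: cN|exact: closed_ge].
  by apply: (subclosed_compact cl cB) => x [].
have dpos x v : K (x, v) -> 0 < den_fun x v.
  move=> /KP[/andP[x0 x1] v0 v1 n0]; rewrite lt_neqAle den_fun_ge0// andbT eq_sym.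
  apply/eqP => d0; move: n0; rewrite leNgt => /negP; apply.
  have /eqP := d0; rewrite den_funE paddr_eq0 ?sqr_ge0//; last first.
    by apply: mulr_ge0; [lra_light|exact: sqr_ge0].
  rewrite sqrf_eq0 => /andP[/eqP x1' ].
  have -> : x = 1 by lra_light.
  rewrite mulr1 mulf_eq0 pnatr_eq0/= sqrf_eq0 => /eqP sv.
  have v0' : v = 0.
    apply/eqP; rewrite eq_le v0 andbT leNgt; apply/negP => vp.
    by have := @sin_gt0_pi R v; rewrite sv ltxx => /(_ _)/negP[]//; apply/andP; split; nra_light.
  by rewrite v0' /num_fun !powR1 mulr0 cos0; lra.
have k0 : 0 < p / 2 by lra_light.
have K0 : K (E, u).
  apply/KP; split => //; apply/ltW; apply: le_lt_trans hlt.
  by rewrite mulr_ge0 ?powR_ge0//; lra_light.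
have cf : {within K, continuous (fun x => N x * (D x `^ (p / 2))^-1)}.
  apply: within_cont_set => -[x v] /dpos d0.
  cont_auto; [exact: cN|by rewrite DE gt_eqF// powR_gt0|by rewrite DE|exact: cD].
have [[x v]] := compact_EVT_max (ex_intro _ _ K0) cK cf.
rewrite inE => Kxv maxP.
have d0 := dpos _ _ Kxv.
have [/andP[x0 x1] v0 v1 n0] := (KP x v).1 Kxv.
pose M := num_fun p c x v / den_fun x v `^ (p / 2).
have maxQ y w : K (y, w) -> num_fun p c y w <= M * den_fun y w `^ (p / 2).
  move=> Kyw; have := maxP (y, w); rewrite inE => /(_ Kyw).
  have [/andP[y0 _] _ _ _] := (KP y w).1 Kyw.
  by rewrite !NE// !DE -/M ler_pdivrMr// powR_gt0// dpos.
have MR : R0 < M.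
  have h0 : 0 < den_fun E u `^ (p / 2) by rewrite powR_gt0// dpos.
  by rewrite -(ltr_pM2r h0); apply: lt_le_trans hlt _; exact: maxQ.
have maxD y w : 0 <= y <= 1 -> 0 <= w -> p * w <= pi ->
    num_fun p c y w <= M * den_fun y w `^ (p / 2).
  move=> hy w0 w1; have [yw|yw] := leP 0 (num_fun p c y w).
    by apply: maxQ; exact/KP.
  by apply: le_trans (ltW yw) _; rewrite mulr_ge0 ?powR_ge0//; lra_light.
have Mn : M * den_fun x v `^ (p / 2) = num_fun p c x v.
  by rewrite /M divfK// gt_eqF// powR_gt0.
have Mn1 : M * den_fun x v `^ (p / 2 - 1) * den_fun x v = num_fun p c x v.
  by rewrite -Mn -mulrA [_ `^ _ * _]mulrC mulr_powRB1// ltW.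
clear maxP maxQ cf dpos cK KP K0 Kxv K cN cD NE DE N D hlt.
clearbody M; have M0 : 0 < M by lra_light.
have {}Mn := conj Mn I; have {}Mn1 := conj Mn1 I.
have pn : p != 0 by rewrite gt_eqF//; lra_light.
have [x0'|xp] : x = 0 \/ 0 < x by move: x0; rewrite le_eqVlt => /predU1P[->|]; [left|right].
  move: Mn.1; rewrite x0' /num_fun /den_fun !powR0//; last by rewrite gt_eqF.
  by rewrite !(mul0r, mulr0, expr0n)/= !(addr0, subr0) powR1 mulr1; lra_light.
have [x1'|xp1] : x = 1 \/ x < 1 by move: x1; rewrite le_eqVlt => /predU1P[->|]; [left|right].
  have := sin_powR_ge p2 pg.1 v0 v1; rewrite -cE.1 => h.
  have sv : 0 <= sin v by apply: sin_ge0_pi; apply/andP; split; nra_light.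
  have dE : den_fun x v `^ (p / 2) = 2 `^ p * sin v `^ p.
    rewrite -powRM// -[RHS]sqr_powR_half ?mulr_ge0//.
    by congr (_ `^ _); rewrite den_funE x1'; ring.
  have hn : num_fun p c x v <= R0 * den_fun x v `^ (p / 2).
    have -> : num_fun p c x v = 2 * (1 - c * cos (p * v)).
      by rewrite x1' /num_fun !powR1; ring.
    rewrite R0E.1 dE s4.1.
    have -> : 2 / (2 `^ p * sin g `^ p) * (2 `^ p * sin v `^ p) = 2 * (sin v `^ p / sin g `^ p).
      by field; rewrite !gt_eqF ?powR_gt0.
    by rewrite ler_pM2l//; lra.
  move: hn; rewrite -Mn.1 ler_pM2r ?powR_gt0//; lra_light.
have e1 : (1 - x `^ p) * den_fun x v = num_fun p c x v * (1 - x ^+ 2).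
  pose f y := M * den_fun y v `^ (p / 2) - num_fun p c y v.
  have dF : der x f (M * (p / 2 * den_fun x v `^ (p / 2 - 1) * (2 * x - 2 * cos (2 * v)))
      - (p * x `^ (p - 1) - p * c * x `^ (p / 2 - 1) * cos (p * v))).
    have dW := @der_powR _ (fun y => den_fun y v) (p / 2) x _ d0 (der_den_E x v).
    have dN := @derN _ _ x _ (der_num_E p c v xp).
    have dMW := @derM _ _ _ x _ _ (der_cst M x) dW.
    apply: derE (@derD _ _ _ x _ _ dMW dN) _.
    ring.
  have : 0 < x < 1 by rewrite xp.
  move=> /(der_min dF) /(_ _)/eqP; rewrite subr_eq0 => /(_ _)/eqP de.
  have {}de : M * (p / 2 * den_fun x v `^ (p / 2 - 1) * (2 * x - 2 * cos (2 * v))) = p * x `^ (p - 1) - p * c * x `^ (p / 2 - 1) * cos (p * v).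
    apply: de => y /andP[y0 y1]; rewrite /f Mn.1 subrr subr_ge0.
    by apply: maxD; rewrite ?y0.
  have xE : x * x `^ (p - 1) = x `^ p by rewrite mulr_powRB1 ?(ltW xp)//; lra_light.
  have xE2 : x * x `^ (p / 2 - 1) = x `^ (p / 2) by rewrite mulr_powRB1 ?(ltW xp)//; lra_light.
  case: Mn1 => + _; set n := num_fun p c x v; set d := den_fun x v in d0 de *.
  set W := d `^ (p / 2 - 1) in de * => Mn1.
  have h1 : p * (x * (x - cos (2 * v))) * n = p * (x `^ p - c * (x `^ (p / 2) * cos (p * v))) * d.
    rewrite -Mn1 (_ : p * (x * (x - cos (2 * v))) * (M * W * d) =
      x * d * (M * (p / 2 * W * (2 * x - 2 * cos (2 * v))))); last by field.
    by rewrite de -xE -xE2; ring.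
  have h2 : 2 * (x * (x - cos (2 * v))) = d + x ^+ 2 - 1 by rewrite /d /den_fun; ring.
  have h3 : 2 * (x `^ p - c * (x `^ (p / 2) * cos (p * v))) = n + x `^ p - 1 by rewrite /n /num_fun; ring.
  apply: (mulfI pn).
  have : p * (d + x ^+ 2 - 1) * n = p * (n + x `^ p - 1) * d by rewrite -h2 -h3; lra.
  by lra_light.
pose F y := M * den_fun x y `^ (p / 2) - num_fun p c x y.
pose F' y := M * (p / 2) * den_fun x y `^ (p / 2 - 1) * (4 * x * sin (2 * y)) -
   2 * c * p * x `^ (p / 2) * sin (p * y).
have dp y : 0 < den_fun x y.
  rewrite den_funE; apply: ltr_wpDr; last by rewrite exprn_gt0//; lra_light.
  by apply: mulr_ge0; [lra_light|exact: sqr_ge0].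
have dF y : der y F (F' y).
  have dW := @der_powR _ (den_fun x) (p / 2) y _ (dp y) (der_den_u x y).
  have dN := @derN _ _ y _ (der_num_u p c x y).
  have dMW := @derM _ _ _ y _ _ (der_cst M y) dW.
  apply: derE (@derD _ _ _ y _ _ dMW dN) _.
  by rewrite /F'; ring.
have Fmin y : 0 <= y -> p * y <= pi -> F v <= F y.
  by move=> y0 y1; rewrite /F Mn.1 subrr subr_ge0; apply: maxD; rewrite ?x0.
have bE y : (y <= pi / p) = (p * y <= pi) by rewrite ler_pdivlMr 1?mulrC//; lra_light.
have [v0'|vp] : v = 0 \/ 0 < v by move: v0; rewrite le_eqVlt => /predU1P[->|]; [left|right].
  subst v; apply: (@no_axis_maximum p c x) => //.
  pose F2 := 2 * M * p * den_fun x 0 `^ (p / 2 - 1) * (2 * x) - 2 * c * p ^+ 2 * x `^ (p / 2).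
  have : 0 <= F2.
    apply: (@der2_right_min _ F F' 0 F2 (pi / p)).

    + by rewrite /F' !mulr0 sin0; ring.
    + have dW := @der_powR _ (den_fun x) (p / 2 - 1) 0 _ d0 (der_den_u x 0).
      have dN : der 0 (fun y => 2 * c * p * x `^ (p / 2) * sin (p * y))
          (2 * c * p * x `^ (p / 2) * p).
        by der_auto; rewrite mulr0 cos0; ring.
      have dS : der 0 (fun y => 4 * x * sin (2 * y)) (4 * x * 2).
        by der_auto; rewrite mulr0 cos0; ring.
      have dMW := @derM _ _ _ 0 _ _ (der_cst (M * (p / 2)) 0) dW.
      have dMS := @derM _ _ _ 0 _ _ dMW dS.
      apply: derE (@derD _ _ _ 0 _ _ dMS (@derN _ _ 0 _ dN)) _.
      by rewrite /F2 !mulr0 sin0; field.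
    + by rewrite divr_gt0//; lra_light.
    + by move=> y /andP[y0]; rewrite bE => y1; exact: Fmin.
  have hp : 0 < 4 * p by lra_light.
  move=> /(mulr_ge0 (ltW d0)) h; rewrite -subr_ge0 -(pmulr_rge0 _ hp).
  apply: le_trans h _; rewrite le_eqVlt; apply/orP; left; apply/eqP.
  by rewrite -Mn1.1 /F2; field.
have [v1'|vp1] : p * v = pi \/ p * v < pi by move: v1; rewrite le_eqVlt => /predU1P[->|]; [left|right].
  (* A minimum of [F] at the right end of the range of [u] forces a nonpositive slope, but
     [sin (p v) = 0] leaves a positive term only. *)
  have : F' v <= 0.
    by apply: (der_left_min (dF v) vp) => y /andP[y0 yv]; apply: Fmin => //; nra_light.
  rewrite /F' v1' sinpi mulr0 subr0 leNgt => /negP; apply.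
  have s2 : 0 < sin (2 * v) by apply: sin_gt0_pi; apply/andP; split; nra_light.
  have W0 := powR_gt0 (p / 2 - 1) d0.
  have x4 : 0 < 4 * x by lra_light.
  exact: mulr_gt0 (mulr_gt0 (mulr_gt0 M0 k0) W0) (mulr_gt0 x4 s2).
apply: (@no_interior_critical p c x v) => //.
have : F' v = 0.
  apply: (der_min (a := 0) (b := pi / p) (dF v)).
    by rewrite vp/= ltr_pdivlMr 1?mulrC//; lra_light.
  by move=> y /andP[y0]; rewrite bE => y1; exact: Fmin.
rewrite /F' => h.
apply: (mulfI (_ : 2 * p != 0)); first by rewrite mulf_neq0.
rewrite -Mn1.1.
transitivity (den_fun x v * (2 * c * p * x `^ (p / 2) * sin (p * v))); first by ring.
have /eqP := h; rewrite subr_eq0 => /eqP <-; by field.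
Qed.

End CriticalPoints.

(** * The inequality in both moduli and the angle, [p >= 2] *)

Section PointwiseAboveTwo.
Context {R : realType}.
Notation pi := (@pi R).
Implicit Types (p g u r q : R).

(** Ordering the moduli makes [E = q / r] at most 1. Past [p u = pi] the truncated cosine stays at
    -1 while the right side does not decrease in [u], so this range reduces to the angle
    [pi / p]. *)
Lemma ptw_ge2_ordered p g r q u : 2 <= p -> p * g = pi / 2 -> 0 <= q -> q <= r ->
  0 <= u <= pi / 2 ->
  (r `^ p + q `^ p) / 2 - cos g / sin g * ((r * q) `^ (p / 2) * cos (Num.min (p * u) pi))
  <= ((r ^+ 2 + q ^+ 2 - 2 * (r * q) * cos (2 * u)) / (4 * sin g ^+ 2)) `^ (p / 2).
Proof.
move=> p2 pg q0 qr /andP[u0 u1]; have pi0 := pi_gt0 R.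
have g0 : 0 < g by nra.
have g1 : g <= pi / 4 by nra.
have sg : 0 < sin g by apply: sin_gt0_pihalf; apply/andP; split; lra.
have cg : 0 < cos g by apply: cos_gt0_pihalf; apply/andP; split; lra.
have p0 : p != 0 by rewrite gt_eqF//; lra.
have k0 : p / 2 != 0 by rewrite gt_eqF//; lra.
have r0 : 0 <= r by lra.
have S4 : 0 < 4 * sin g ^+ 2 by rewrite mulr_gt0// exprn_gt0.
(* At [p = 2] the angle [g] is [pi / 4] and the two sides coincide; [num_le_den] takes over for
   [p > 2]. *)
have [p2'|p2'] : p = 2 \/ 2 < p by move: p2; rewrite le_eqVlt => /predU1P[->|]; [left|right].
  have -> : g = pi / 4 by nra.
  have e : sin (pi / 4) = cos (pi / 4) :> R.
    have -> : pi / 4 = pi / 2 - pi / 4 :> R by lra.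
    rewrite sinB cos_pihalf sin_pihalf (_ : pi / 2 - pi / 4 = pi / 4); last by lra.
    by ring.
  have c4 : cos (pi / 4) ^+ 2 = 2^-1 :> R.
    by have := cos2Dsin2 (pi / 4 : R); rewrite e; lra.
  have c4n : cos (pi / 4) != 0 :> R.
    by apply/eqP => h; move: c4; rewrite h expr0n /=; lra.
  rewrite e c4 divff// p2' divff// (min_idPl _); last by lra.
  have X0 : 0 <= r ^+ 2 + q ^+ 2 - 2 * (r * q) * cos (2 * u).
    have := sqr_ge0 (r - q); have := cos_le1 (2 * u); have := mulr_ge0 r0 q0; nra.
  rewrite powRr1 ?mulr_ge0// powRr1; last by rewrite divr_ge0//; lra.
  by rewrite !powR_mulrn//; lra.
have := r0; rewrite le_eqVlt => /predU1P[r00|rp].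
  have -> : q = 0 by lra.
  rewrite -r00.
  by rewrite mul0r !powR0// mul0r mulr0 addr0 mul0r subr0 powR_ge0.
set c := cos g / sin g.
pose E := q / r.
have hE : 0 <= E <= 1 by rewrite /E divr_ge0//= ler_pdivrMr// mul1r.
have qE : q = r * E by rewrite /E mulrC divfK// gt_eqF.
have E0 : 0 <= E by case/andP: hE.
have main w : 0 <= w -> p * w <= pi -> cos (2 * u) <= cos (2 * w) ->
  cos (Num.min (p * u) pi) = cos (p * w) ->
  (r `^ p + q `^ p) / 2 - c * ((r * q) `^ (p / 2) * cos (Num.min (p * u) pi))
  <= ((r ^+ 2 + q ^+ 2 - 2 * (r * q) * cos (2 * u)) / (4 * sin g ^+ 2)) `^ (p / 2).
  move=> w0 w1 cw ->.
  have h := num_le_den p2' pg hE w0 w1; rewrite -/c in h.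
  have rr : (r * q) `^ (p / 2) = r `^ p * E `^ (p / 2).
    have -> : r * q = r ^+ 2 * E by rewrite [in LHS]qE; ring.
    by rewrite (powRM _ (sqr_ge0 r) E0) sqr_powR_half.
  have qq : q `^ p = r `^ p * E `^ p by rewrite qE powRM.
  rewrite rr qq.
  have rp0 : 0 < r `^ p by rewrite powR_gt0.
  rewrite (_ : _ / 2 - _ = r `^ p * (num_fun p c E w / 2)); last by rewrite /num_fun; field.
  apply: (@le_trans _ _ (r `^ p * (den_fun E w / (4 * sin g ^+ 2)) `^ (p / 2))).
    rewrite ler_pM2l// powRM ?den_fun_ge0 ?invr_ge0 ?(ltW S4)//.
    rewrite powRVr ?(ltW S4)// ler_pdivrMr//; apply: le_trans h _.
    by rewrite le_eqVlt; apply/orP; left; apply/eqP; ring.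
  rewrite -sqr_powR_half// -powRM ?sqr_ge0//; last by rewrite divr_ge0 ?den_fun_ge0 ?(ltW S4).
  have nn : 0 <= r ^+ 2 * (den_fun E w / (4 * sin g ^+ 2)).
    by rewrite mulr_ge0 ?sqr_ge0// divr_ge0 ?den_fun_ge0 ?(ltW S4).
  have le : r ^+ 2 * (den_fun E w / (4 * sin g ^+ 2)) <=
      (r ^+ 2 + q ^+ 2 - 2 * (r * q) * cos (2 * u)) / (4 * sin g ^+ 2).
    rewrite mulrA ler_pM2r ?invr_gt0// qE /den_fun.
    have := mulr_ge0 (sqr_ge0 r) E0; set a := r ^+ 2 * E => a0.
    have h1 : a * cos (2 * u) <= a * cos (2 * w) by rewrite ler_wpM2l.
    rewrite /a in h1; lra.
  apply: ge0_ler_powR; rewrite ?nnegrE//; first by lra.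
  exact: le_trans nn le.
have [pu|] := boolP (p * u <= pi); last rewrite -ltNge => pu.
  by apply: (main u) => //; rewrite min_l.
apply: (main (pi / p)).
- by rewrite divr_ge0//; lra.
- by rewrite mulrC divfK.
- have h1 : pi / p <= u by rewrite ler_pdivrMr 1?mulrC ?(ltW pu)//; lra.
  have h2 : 0 <= pi / p by rewrite divr_ge0//; lra.
  have [->|ne] := eqVneq u (pi / p); first by [].
  by rewrite ltW// ltr_cos ?in_itv/=; [rewrite ltr_pM2l// lt_neqAle eq_sym ne|apply/andP; split; lra..].
- by rewrite (mulrC p (pi / p)) divfK// min_r// ltW.
Qed.

Lemma ptw_ge2 p g r q u : 2 <= p -> p * g = pi / 2 -> 0 <= r -> 0 <= q ->
  0 <= u <= pi / 2 ->
  (r `^ p + q `^ p) / 2 - cos g / sin g * ((r * q) `^ (p / 2) * cos (Num.min (p * u) pi))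
  <= ((r ^+ 2 + q ^+ 2 - 2 * (r * q) * cos (2 * u)) / (4 * sin g ^+ 2)) `^ (p / 2).
Proof.
move=> p2 pg r0 q0 hu; have [qr|/ltW rq] := leP q r; first exact: ptw_ge2_ordered.
have := ptw_ge2_ordered p2 pg r0 rq hu.
by rewrite (mulrC q r) [q `^ p + _]addrC [q ^+ 2 + _]addrC.
Qed.

End PointwiseAboveTwo.

(** * Subharmonicity and the maximum principle *)

Section CPow.
Context {R : realType}.
Notation pi := (@pi R).
Implicit Types (k th a b s : R).

Definition sqmod a b s : R := (1 + s * a) ^+ 2 + (s * b) ^+ 2.
Definition argt a b s : R := atan (s * b / (1 + s * a)).
(* The real part of [e^{i th} (1 + s (a + i b)) ^ k] on the half-plane where the
   base has positive real part. *)
Definition cpow k th a b s : R :=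
  sqmod a b s `^ (k / 2) * cos (k * argt a b s + th).

Lemma sqmod_gt0 a b s : 0 < 1 + s * a -> 0 < sqmod a b s.
Proof. by move=> h; rewrite /sqmod ltr_wpDr ?sqr_ge0// exprn_gt0. Qed.

Lemma sqmod_tan a b s : 0 < 1 + s * a ->
  1 + (s * b / (1 + s * a)) ^+ 2 = sqmod a b s / (1 + s * a) ^+ 2.
Proof. by move=> h; rewrite /sqmod; field; rewrite gt_eqF. Qed.

Lemma cos_argt a b s : 0 < 1 + s * a ->
  cos (argt a b s) = (1 + s * a) / Num.sqrt (sqmod a b s).
Proof.
move=> h; rewrite /argt cos_atan sqmod_tan// sqrtrM ?(ltW (sqmod_gt0 _ h))//.
by rewrite sqrtrV ?sqr_ge0// sqrtr_sqr gtr0_norm// invfM invrK mulrC.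
Qed.

Lemma sin_argt a b s : 0 < 1 + s * a ->
  sin (argt a b s) = (s * b) / Num.sqrt (sqmod a b s).
Proof.
move=> h; have c0 : cos (argt a b s) != 0.
  rewrite cos_argt// mulf_neq0 ?gt_eqF// invr_gt0 sqrtr_gt0; exact: sqmod_gt0.
have := atanK (s * b / (1 + s * a)); rewrite -/(argt a b s) /tan => e.
rewrite -[sin _](divfK c0) e cos_argt//.
by field; rewrite !gt_eqF// sqrtr_gt0 sqmod_gt0.
Qed.

Lemma der_sqmod a b s : der s (sqmod a b) (2 * (a * (1 + s * a) + s * b ^+ 2)).
Proof. by rewrite /sqmod; der_auto; rewrite /=; ring. Qed.

Lemma der_argt a b s : 0 < 1 + s * a -> der s (argt a b) (b / sqmod a b s).
Proof.
move=> h; rewrite /argt; der_auto; first by rewrite gt_eqF.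
have N0 := sqmod_gt0 b h.
rewrite sqmod_tan//; field; rewrite !gt_eqF//.
Qed.

(** In [s], the power [(1 + s (a + i b))^k] has derivative [k (a + i b)] times the power [k - 1].
    Multiplication by [i] under the real part is the phase shift [pi / 2], so all derivatives stay
    within the family [cpow]. *)
Lemma der_cpow k th a b s : 0 < 1 + s * a ->
  der s (cpow k th a b) (k * (a * cpow (k - 1) th a b s +
                              b * cpow (k - 1) (th + pi / 2) a b s)).
Proof.
move=> h; have N0 := sqmod_gt0 b h.
have dN := @der_powR _ (sqmod a b) (k / 2) s _ N0 (der_sqmod a b s).
have dA := der_argt b h.
have dk : der s (fun t => k * argt a b t + th) (k * (b / sqmod a b s)).
  by der_auto; ring.
have dC := @der_cos _ (fun t => k * argt a b t + th) s _ dk.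
apply: derE (@derM _ _ _ s _ _ dN dC) _; rewrite /cpow.
have -> : (k - 1) * argt a b s + (th + pi / 2) = (k - 1) * argt a b s + th + pi / 2.
  by rewrite addrA.
rewrite cosDpihalf.
have -> : (k - 1) * argt a b s + th = (k * argt a b s + th) - argt a b s by ring.
rewrite cosB sinB cos_argt// sin_argt//.
set C := cos _; set S := sin _; set N := sqmod a b s in N0 *.
have s0 : 0 < Num.sqrt N by rewrite sqrtr_gt0.
have -> : N `^ (k / 2) = N * N `^ (k / 2 - 1).
  rewrite -{2}(powRr1 (ltW N0)) -powRD ?(gt_eqF N0) ?implybT//.
  by congr (_ `^ _); ring.
have -> : N `^ ((k - 1) / 2) = Num.sqrt N * N `^ (k / 2 - 1).
  rewrite -powR12_sqrt ?(ltW N0)// -powRD ?(gt_eqF N0) ?implybT//.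
  by congr (_ `^ _); field.
move: (N `^ (k / 2 - 1)) => X.
by field; rewrite !gt_eqF.
Qed.

Lemma cpow0 k th a b : cpow k th a b 0 = cos th.
Proof.
by rewrite /cpow /argt /sqmod !mul0r atan0 mulr0 add0r addr0 expr1n expr0n addr0 powR1 mul1r.
Qed.

Lemma sqmod_bounds a b s : a ^+ 2 + b ^+ 2 <= 4^-1 -> 0 <= s <= 1 ->
  [/\ 0 < 1 + s * a, 4^-1 <= sqmod a b s & sqmod a b s <= 4].
Proof.
move=> ab /andP[s0 s1].
have a1 : a <= 2^-1 by have := sqr_ge0 b; nra.
have a2 : - 2^-1 <= a by have := sqr_ge0 b; nra.
have h1 : 2^-1 <= 1 + s * a by nra.
have h2 : 1 + s * a <= 3 / 2 by nra.
have sb : (s * b) ^+ 2 <= 4^-1.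
  have h3 : b ^+ 2 <= 4^-1 by have := sqr_ge0 a; lra.
  have h4 : s ^+ 2 <= 1 by rewrite expr_le1.
  rewrite exprMn; apply: le_trans h3.
  by rewrite ler_piMl ?sqr_ge0.
split; first by lra.
  by rewrite /sqmod; have := sqr_ge0 (s * b); nra.
by rewrite /sqmod; nra.
Qed.

(** For [|a + i b| <= 1/2] the squared modulus lies in [[1/4, 4]], whence a bound uniform in the
    phase; applied to third derivatives it yields the cubic remainders below. *)
Lemma cpow_bound k : exists2 B : R, 0 <= B & forall th a b s,
  a ^+ 2 + b ^+ 2 <= 4^-1 -> 0 <= s <= 1 -> `|cpow k th a b s| <= B.
Proof.
exists (4 `^ `|k / 2|) => [|th a b s ab hs]; first exact: powR_ge0.
have [h1 h2 h3] := sqmod_bounds ab hs.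
have N0 := sqmod_gt0 b h1.
rewrite /cpow normrM -[leRHS]mulr1; apply: ler_pM => //; last exact: cos_max.
rewrite ger0_norm ?powR_ge0//.
have [k0|k0] := leP 0 (k / 2).
  by rewrite ger0_norm//; apply: ge0_ler_powR; rewrite ?nnegrE// ltW.
rewrite ltr0_norm// -[k / 2 in leLHS]opprK powRN.
rewrite -[leLHS]mul1r ler_pdivrMr ?powR_gt0// -powRM// ?(ltW N0)//.
apply: le_trans (_ : (4 * sqmod a b s) `^ 0 <= _); first by rewrite powRr0.
by apply: ler_powR; lra.
Qed.

Lemma taylor3_ge (f0 f1 f2 f3 : R -> R) (M : R) :
  (forall s, 0 <= s <= 1 -> der s f0 (f1 s)) ->
  (forall s, 0 <= s <= 1 -> der s f1 (f2 s)) ->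
  (forall s, 0 <= s <= 1 -> der s f2 (f3 s)) ->
  (forall s, 0 <= s <= 1 -> `|f3 s| <= M) ->
  f0 0 + f1 0 + f2 0 / 2 - M <= f0 1.
Proof.
move=> d0 d1 d2 b3.
have M0 : 0 <= M by apply: le_trans (b3 0 _); rewrite ?normr_ge0 ?lexx ?ler01.
have step (g g' : R -> R) s : (forall s, 0 <= s <= 1 -> der s g (g' s)) ->
    0 <= s <= 1 -> (forall t, 0 <= t <= 1 -> 0 <= g' t) -> g 0 <= g s.
  move=> dg /andP[s0 s1] g0; apply: (@der_le _ g g') => //.
  - apply: within_cont => x /andP[x0 x1]; apply: der_cont (dg x _).
    by apply/andP; split; lra.
  - by move=> x /andP[x0 x1]; apply: dg; apply/andP; split; lra.
  - by move=> x /andP[x0 x1]; apply: g0; apply/andP; split; lra.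
have h2 s : 0 <= s <= 1 -> f2 0 - M <= f2 s.
  move=> hs; have := @step (fun t => f2 t + M * t) (fun t => f3 t + M) s _ hs _.
  rewrite mulr0 addr0 => h; have : f2 0 <= f2 s + M * s.
    apply: h => t ht; first by have := d2 t ht => ?; der_auto; ring.
    by have := b3 t ht; rewrite ler_norml => /andP[]; lra.
  by case/andP: hs => s0 s1; nra.
have h1 s : 0 <= s <= 1 -> f1 0 + (f2 0 - M) * s <= f1 s.
  move=> hs; have := @step (fun t => f1 t - (f2 0 - M) * t) (fun t => f2 t - (f2 0 - M)) s _ hs _.
  rewrite mulr0 subr0 => h; have : f1 0 <= f1 s - (f2 0 - M) * s.
    apply: h => t ht; first by have := d1 t ht => ?; der_auto; ring.
    by rewrite subr_ge0; exact: h2.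
  by lra.
have i01 : (0 : R) <= (1 : R) <= 1 by apply/andP; split.
have := @step (fun t => f0 t - f1 0 * t - (f2 0 - M) / 2 * t ^+ 2)
  (fun t => f1 t - (f1 0 + (f2 0 - M) * t)) 1 _ i01 _.
rewrite !mulr0 expr0n/= mulr0 !subr0 mulr1 expr1n mulr1 => h.
have : f0 0 <= f0 1 - f1 0 - (f2 0 - M) / 2.
  apply: h => t ht; first by have := d0 t ht => ?; der_auto; rewrite /=; field.
  by rewrite subr_ge0; exact: h1.
lra.
Qed.

Lemma abs_le_sqrt a b : `|a| <= Num.sqrt (a ^+ 2 + b ^+ 2) /\ `|b| <= Num.sqrt (a ^+ 2 + b ^+ 2).
Proof.
by split; rewrite -sqrtr_sqr ler_wsqrtr// ?lerDl ?lerDr sqr_ge0.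
Qed.

Lemma cubic_form_bound (a b B c0 c1 c2 c3 : R) :
  `|c0| <= B -> `|c1| <= B -> `|c2| <= B -> `|c3| <= B ->
  `|a ^+ 3 * c0 + 3 * a ^+ 2 * b * c1 + 3 * a * b ^+ 2 * c2 + b ^+ 3 * c3|
   <= 8 * B * Num.sqrt (a ^+ 2 + b ^+ 2) ^+ 3.
Proof.
move=> h0 h1 h2 h3; have [ha hb] := abs_le_sqrt a b.
set r := Num.sqrt _ in ha hb *.
have r0 : 0 <= r by exact: sqrtr_ge0.
have B0 : 0 <= B by exact: le_trans h0.
have m (x y z c : R) : `|x| <= r -> `|y| <= r -> `|z| <= r -> `|c| <= B ->
    `|x * y * z * c| <= r ^+ 3 * B.
  by move=> hx hy hz hc; rewrite !normrM exprS expr2 mulrA !ler_pM// mulr_ge0.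
have m0 := m _ _ _ _ ha ha ha h0.
have m1 := m _ _ _ _ ha ha hb h1.
have m2 := m _ _ _ _ ha hb hb h2.
have m3 := m _ _ _ _ hb hb hb h3.
move: m0 m1 m2 m3; rewrite !ler_norml => /andP[? ?] /andP[? ?] /andP[? ?] /andP[? ?].
by apply/andP; split; lra.
Qed.

Lemma cpow_local k : exists2 B : R, 0 <= B & forall th a b,
  a ^+ 2 + b ^+ 2 <= 4^-1 ->
  cos th + k * (a * cos th - b * sin th) +
    k * (k - 1) / 2 * ((a ^+ 2 - b ^+ 2) * cos th - 2 * (a * b) * sin th)
    - B * Num.sqrt (a ^+ 2 + b ^+ 2) ^+ 3 <= cpow k th a b 1.
Proof.
have [B B0 HB] := cpow_bound (k - 3).
exists (`|k * (k - 1) * (k - 2)| * (8 * B)); first by rewrite !mulr_ge0.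
move=> th a b ab.
pose f1 s := k * (a * cpow (k - 1) th a b s + b * cpow (k - 1) (th + pi / 2) a b s).
pose f2 s := k * (k - 1) * (a ^+ 2 * cpow (k - 2) th a b s +
   2 * (a * b) * cpow (k - 2) (th + pi / 2) a b s +
   b ^+ 2 * cpow (k - 2) (th + pi / 2 + pi / 2) a b s).
pose f3 s := k * (k - 1) * (k - 2) * (a ^+ 3 * cpow (k - 3) th a b s +
   3 * a ^+ 2 * b * cpow (k - 3) (th + pi / 2) a b s +
   3 * a * b ^+ 2 * cpow (k - 3) (th + pi / 2 + pi / 2) a b s +
   b ^+ 3 * cpow (k - 3) (th + pi / 2 + pi / 2 + pi / 2) a b s).
have pos s : 0 <= s <= 1 -> 0 < 1 + s * a by move=> hs; have [] := sqmod_bounds ab hs.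
have e1 : k - 1 - 1 = k - 2 by ring.
have e2 : k - 2 - 1 = k - 3 by ring.
have F1 : f1 0 = k * (a * cos th - b * sin th).
  by rewrite /f1 !cpow0 cosDpihalf; ring.
have F2 : f2 0 = k * (k - 1) * ((a ^+ 2 - b ^+ 2) * cos th - 2 * (a * b) * sin th).
  by rewrite /f2 !cpow0 !cosDpihalf sinDpihalf; ring.
apply: le_trans (@taylor3_ge (cpow k th a b) f1 f2 f3
  (`|k * (k - 1) * (k - 2)| * (8 * B) * Num.sqrt (a ^+ 2 + b ^+ 2) ^+ 3) _ _ _ _).
- rewrite F1 F2 cpow0 le_eqVlt; apply/orP; left; apply/eqP; set E := _ * _ ^+ 3.
  by field.
- by move=> s /pos; exact: der_cpow.
- move=> s /pos hs; rewrite /f1.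
  have h1 := der_cpow (k - 1) th b hs; have h2 := der_cpow (k - 1) (th + pi / 2) b hs.
  rewrite e1 in h1 h2.
  by der_auto; rewrite /f2; ring.
- move=> s /pos hs; rewrite /f2.
  have h1 := der_cpow (k - 2) th b hs; have h2 := der_cpow (k - 2) (th + pi / 2) b hs.
  have h3 := der_cpow (k - 2) (th + pi / 2 + pi / 2) b hs.
  rewrite e2 in h1 h2 h3.
  by der_auto; rewrite /f3; ring.
- move=> s hs; rewrite /f3 normrM -[leRHS]mulrA; apply: ler_wpM2l => //.
  by apply: cubic_form_bound; exact: HB.
Qed.

(** The derivative of [ln |1 + s (a + i b)|] is the real part of [(a + i b) / (1 + s (a + i b))], a
    combination of functions [cpow (- 1)], so the scheme of [cpow_local] applies. *)
Lemma ln_local : exists2 B : R, 0 <= B & forall a b,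
  a ^+ 2 + b ^+ 2 <= 4^-1 ->
  a - (a ^+ 2 - b ^+ 2) / 2 - B * Num.sqrt (a ^+ 2 + b ^+ 2) ^+ 3 <=
  ln (sqmod a b 1) / 2.
Proof.
have [B B0 HB] := cpow_bound (- 3).
exists (2 * (8 * B)); first by rewrite !mulr_ge0.
move=> a b ab.
pose f1 s := a * cpow (- 1) 0 a b s + b * cpow (- 1) (0 + pi / 2) a b s.
pose f2 s := - (a ^+ 2 * cpow (- 2) 0 a b s +
   2 * (a * b) * cpow (- 2) (0 + pi / 2) a b s +
   b ^+ 2 * cpow (- 2) (0 + pi / 2 + pi / 2) a b s).
pose f3 s := 2 * (a ^+ 3 * cpow (- 3) 0 a b s +
   3 * a ^+ 2 * b * cpow (- 3) (0 + pi / 2) a b s +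
   3 * a * b ^+ 2 * cpow (- 3) (0 + pi / 2 + pi / 2) a b s +
   b ^+ 3 * cpow (- 3) (0 + pi / 2 + pi / 2 + pi / 2) a b s).
have pos s : 0 <= s <= 1 -> 0 < 1 + s * a by move=> hs; have [] := sqmod_bounds ab hs.
have e1 : - 1 - 1 = - 2 :> R by ring.
have e2 : - 2 - 1 = - 3 :> R by ring.
have F1 : f1 0 = a by rewrite /f1 !cpow0 cosDpihalf sin0 cos0; ring.
have F2 : f2 0 = - (a ^+ 2 - b ^+ 2).
  by rewrite /f2 !cpow0 !cosDpihalf sinDpihalf sin0 cos0; ring.
have F0 : ln (sqmod a b 0) / 2 = 0.
  by rewrite /sqmod !mul0r addr0 expr1n expr0n addr0 ln1 mul0r.
apply: le_trans (@taylor3_ge (fun s => ln (sqmod a b s) / 2) f1 f2 f3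
  (2 * (8 * B) * Num.sqrt (a ^+ 2 + b ^+ 2) ^+ 3) _ _ _ _).
- rewrite F1 F2 F0 le_eqVlt; apply/orP; left; apply/eqP; set E := _ * _ ^+ 3.
  by field.
- move=> s /pos hs; have N0 := sqmod_gt0 b hs.
  have dN := @der_ln _ (sqmod a b) s _ N0 (der_sqmod a b s).
  apply: derE (@derM _ _ _ s _ _ dN (der_cst 2^-1 s)) _.
  have s2 : Num.sqrt (sqmod a b s) ^+ 2 = sqmod a b s by rewrite sqr_sqrtr// ltW.
  have s0 : 0 < Num.sqrt (sqmod a b s) by rewrite sqrtr_gt0.
  have pw : sqmod a b s `^ (-1 / 2) = (Num.sqrt (sqmod a b s))^-1.
    by rewrite mulN1r powRN powR12_sqrt// ltW.
  have c1 : cpow (- 1) 0 a b s = (1 + s * a) / sqmod a b s.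
    rewrite /cpow pw addr0 mulN1r cosN cos_argt// -{3}s2.
    by field; rewrite gt_eqF.
  have c2 : cpow (- 1) (0 + pi / 2) a b s = s * b / sqmod a b s.
    rewrite /cpow pw add0r mulN1r cosDpihalf sinN opprK sin_argt// -{3}s2.
    by field; rewrite gt_eqF.
  by rewrite /f1 c1 c2; field; rewrite gt_eqF.
- move=> s /pos hs; rewrite /f1.
  have h1 := der_cpow (- 1) 0 b hs; have h2 := der_cpow (- 1) (0 + pi / 2) b hs.
  rewrite e1 in h1 h2.
  by der_auto; rewrite /f2; ring.
- move=> s /pos hs; rewrite /f2.
  have h1 := der_cpow (- 2) 0 b hs; have h2 := der_cpow (- 2) (0 + pi / 2) b hs.
  have h3 := der_cpow (- 2) (0 + pi / 2 + pi / 2) b hs.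
  rewrite e2 in h1 h2 h3.
  by der_auto; rewrite /f3; ring.
- move=> s hs; rewrite /f3 normrM -[leRHS]mulrA (ger0_norm (ler0n _ 2)); apply: ler_wpM2l => //.
  by apply: cubic_form_bound; exact: HB.
Qed.

End CPow.

Import ComplexField.Normc.
Local Open Scope complex_scope.

(** * Complex polynomials and discrete subharmonicity *)

Section Complex.
Context {R : realType}.
Implicit Types (x y z w : R[i]) (Q T : {poly R[i]}).

Lemma Re_add x y : complex.Re (x + y) = complex.Re x + complex.Re y.
Proof. by case: x; case: y. Qed.
Lemma Im_add x y : complex.Im (x + y) = complex.Im x + complex.Im y.
Proof. by case: x; case: y. Qed.
Lemma Re_opp x : complex.Re (- x) = - complex.Re x.
Proof. by case: x. Qed.
Lemma Im_opp x : complex.Im (- x) = - complex.Im x.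
Proof. by case: x. Qed.
Lemma Re_mul x y : complex.Re (x * y) =
  complex.Re x * complex.Re y - complex.Im x * complex.Im y.
Proof. by case: x; case: y. Qed.
Lemma Im_mul x y : complex.Im (x * y) =
  complex.Re x * complex.Im y + complex.Im x * complex.Re y.
Proof. by case: x; case: y. Qed.

Lemma complex_eqP x y : complex.Re x = complex.Re y -> complex.Im x = complex.Im y -> x = y.
Proof. by case: x => a b; case: y => c d /= -> ->. Qed.

Lemma normc_ge0 x : 0 <= normc x.
Proof. by case: x => a b; exact: sqrtr_ge0. Qed.

Lemma sqr_normc_Re_Im x : normc x ^+ 2 = complex.Re x ^+ 2 + complex.Im x ^+ 2.
Proof. by case: x => a b /=; rewrite sqr_sqrtr// addr_ge0 ?sqr_ge0. Qed.

Lemma normc_gt0 x : (0 < normc x) = (x != 0).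
Proof.
rewrite lt_neqAle normc_ge0 andbT eq_sym; congr (~~ _).
by apply/eqP/eqP => [/eq0_normc//|->]; exact: normc0.
Qed.

Lemma normcX x n : normc (x ^+ n) = normc x ^+ n.
Proof. by elim: n => [|n ih]; rewrite ?expr0 ?normc1// !exprS normcM ih. Qed.

Lemma normc_triangle x y : normc (x + y) <= normc x + normc y.
Proof. exact: le_normcD. Qed.

Lemma normc_opp x : normc (- x) = normc x.
Proof. by case: x => a b /=; rewrite !sqrrN. Qed.

Lemma abs_Re_le x : `|complex.Re x| <= normc x.
Proof. by case: x => a b /=; have [] := abs_le_sqrt a b. Qed.

Lemma abs_Im_le x : `|complex.Im x| <= normc x.
Proof. by case: x => a b /=; have [] := abs_le_sqrt a b. Qed.

Lemma normc_le_ReIm x : normc x <= `|complex.Re x| + `|complex.Im x|.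
Proof.
rewrite -ler_sqr ?nnegrE ?normc_ge0 ?addr_ge0// sqr_normc_Re_Im.
rewrite sqrrD !real_normK ?num_real// -addrA lerD2l lerDr.
by rewrite mulrn_wge0// mulr_ge0.
Qed.

Lemma normc_real (a : R) : normc a%:C = `|a|.
Proof. by rewrite /= expr0n addr0 sqrtr_sqr. Qed.

Lemma poly_expand3 T : exists S : {poly R[i]}, forall z,
  T.[z] = T`_0 + T`_1 * z + T`_2 * z ^+ 2 + z ^+ 3 * S.[z].
Proof.
exists (drop_poly 3 T) => z.
rewrite -[in LHS](poly_take_drop 3 T) hornerD hornerM hornerXn.
congr (_ + _); last exact: mulrC.
rewrite /take_poly horner_poly !big_ord_recr big_ord0 /= add0r.
by rewrite expr0 mulr1 expr1.
Qed.

Lemma poly_bound T (r : R) : exists2 K : R, 0 <= K & forall z, normc z <= r -> normc T.[z] <= K.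
Proof.
elim/poly_ind: T => [|T c [K K0 HK]].
  by exists 0 => // z _; rewrite horner0 normc0.
exists (K * `|r| + normc c); first by rewrite addr_ge0 ?mulr_ge0 ?normc_ge0.
move=> z z1; rewrite hornerMXaddC; apply: le_trans (normc_triangle _ _) _.
rewrite lerD2r normcM ler_pM ?normc_ge0 ?HK//.
exact: le_trans z1 (ler_norm _).
Qed.

(** Subharmonicity at [z] with the Laplacian replaced by its five-point difference, up to
    [o(rho^2)]. The form is additive and asks for no smoothness. *)
Definition four_sub (u : R[i] -> R) (z : R[i]) := forall eta : R, 0 < eta ->
  exists2 del : R, 0 < del & forall rho, 0 < rho < del ->
  4 * u z - eta * rho ^+ 2 <=
  u (z + rho%:C) + u (z - rho%:C) + u (z + 'i * rho%:C) + u (z - 'i * rho%:C).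

(** A harmonic minorant touching [v] at [z0], the real part of a complex quadratic polynomial, is
    allowed a cubic error, which disappears in the limit of [four_sub]. *)
Definition local2 (v : R[i] -> R) (z0 : R[i]) :=
  exists c1 c2 : R[i], exists B del : R, [/\ 0 <= B, 0 < del &
  forall w, normc w < del ->
  v z0 + complex.Re (c1 * w + c2 * w ^+ 2) - B * normc w ^+ 3 <= v (z0 + w)].

(* The linear and quadratic terms cancel over the four directions. *)
Lemma four_sub_comp v Q z0 : local2 v Q.[z0] -> four_sub (fun z => v Q.[z]) z0.
Proof.
move=> [c1 [c2 [B [del [B0 del0 H]]]]] eta eta0.
pose P := Q \Po ('X + z0%:P) - Q.[z0]%:P.
have PE z : Q.[z0 + z] = Q.[z0] + P.[z].
  rewrite /P hornerD hornerN hornerC horner_comp hornerD hornerX hornerC.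
  by rewrite [z + z0]addrC; ring.
have P0 : P`_0 = 0.
  by apply: (addrI Q.[z0]); rewrite -horner_coef0 -PE !addr0.
pose T := c1%:P * P + c2%:P * P ^+ 2.
have TE z : T.[z] = c1 * P.[z] + c2 * P.[z] ^+ 2.
  by rewrite /T hornerD hornerM (hornerM c2%:P) !hornerC horner_exp.
have T0 : T`_0 = 0.
  rewrite -horner_coef0 TE.
  have -> : P.[0] = 0 by rewrite horner_coef0.
  by rewrite expr0n mulr0 mulr0 addr0.
have [S SE] := poly_expand3 T.
have [K K0 HK] := poly_bound S 1.
have [D DE] : exists D : {poly R[i]}, forall z, P.[z] = z * D.[z].
  have : root P 0 by rewrite /root horner_coef0 P0.
  move=> /factor_theorem[D ->]; exists D => z.
  by rewrite hornerM hornerXsubC subr0 mulrC.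
have [K' K'0 HK'] := poly_bound D 1.
pose C := 4 * K + 4 * (B * K' ^+ 3) + 1.
have C0 : 0 < C by rewrite /C; have := mulr_ge0 B0 (exprn_ge0 3 K'0); lra.
pose d := Num.min 1 (Num.min (del / (K' + 1)) (eta / C)).
have K1 : 0 < K' + 1 by lra.
exists d => [|rho /andP[r0]]; first by rewrite !lt_min ltr01 !divr_gt0.
rewrite !lt_min => /and3P[r1 r2 r3].
have H1 z : normc z = rho -> v Q.[z0] + complex.Re (T.[z]) - B * (K' * rho) ^+ 3 <= v Q.[z0 + z].
  move=> nz; have Pz : normc P.[z] <= K' * rho.
    by rewrite DE normcM nz mulrC ler_wpM2r ?(ltW r0)// HK'// nz ltW.
  rewrite PE; apply: le_trans (H P.[z] _); last first.
    apply: le_lt_trans Pz _; move: r2; rewrite ltr_pdivlMr//; nra.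
  rewrite TE lerB// ler_wpM2l//.
  by rewrite !exprS expr0 !mulr1 !ler_pM ?mulr_ge0 ?normc_ge0.
have H2 z : normc z = rho -> complex.Re (T`_1 * z + T`_2 * z ^+ 2) - K * rho ^+ 3 <= complex.Re T.[z].
  move=> nz; rewrite SE T0 add0r (Re_add _ (_ * S.[z])) lerD2l.
  rewrite lerNl; apply: le_trans (ler_norm _) _; rewrite normrN.
  apply: le_trans (abs_Re_le _) _.
  by rewrite normcM normcX nz mulrC ler_wpM2r ?exprn_ge0 ?(ltW r0)// HK// nz ltW.
have nr : normc rho%:C = rho by rewrite normc_real gtr0_norm.
have ni : normc ('i * rho%:C) = rho.
  by rewrite normcM nr /= expr0n add0r expr1n sqrtr1 mul1r.
have n1 := H1 _ nr; have n2 := H1 (- rho%:C); have n3 := H1 _ ni; have n4 := H1 (- ('i * rho%:C)).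
have m1 := H2 _ nr; have m2 := H2 (- rho%:C); have m3 := H2 _ ni; have m4 := H2 (- ('i * rho%:C)).
move: n2 m2 n4 m4; rewrite !normc_opp => /(_ nr) n2 /(_ nr) m2 /(_ ni) n4 /(_ ni) m4.
have sumE : complex.Re (T`_1 * rho%:C + T`_2 * rho%:C ^+ 2) +
  complex.Re (T`_1 * (- rho%:C) + T`_2 * (- rho%:C) ^+ 2) +
  complex.Re (T`_1 * ('i * rho%:C) + T`_2 * ('i * rho%:C) ^+ 2) +
  complex.Re (T`_1 * (- ('i * rho%:C)) + T`_2 * (- ('i * rho%:C)) ^+ 2) = 0.
  rewrite -!Re_add (_ : _ + _ = 0)//.
  rewrite !sqrrN !exprMn sqr_i; ring.
have r3' : C * rho < eta by rewrite mulrC -ltr_pdivlMr.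
have r4 : C * rho * rho ^+ 2 <= eta * rho ^+ 2 by rewrite ler_wpM2r ?sqr_ge0// ltW.
have e3 : C * rho * rho ^+ 2 = 4 * (K * rho ^+ 3) + 4 * (B * (K' * rho) ^+ 3) + rho ^+ 3.
  by rewrite /C; ring.
have p3 : 0 < rho ^+ 3 by rewrite exprn_gt0.
clear H1 H2 HK HK' H r3 r2 r1 SE TE DE PE T0 P0.
lra.
Qed.

End Complex.

(** * Homogeneous functions of the modulus and the angle *)

Section Homogeneous.
Context {R : realType}.
Notation pi := (@pi R).
Implicit Types (z w : R[i]) (Q L : {poly R[i]}) (u v : R[i] -> R) (W : R -> R).

Lemma acos_within_continuous : {within `[(-1 : R), 1], continuous (@acos R)}.
Proof.
have cc : {within `[0, pi], continuous (@cos R)}.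
  by apply: (@within_cont R (@cos R) 0 pi) => x _; exact: continuous_cos.
have ck : {in `[0, pi], cancel (@cos R) (@acos R)} by move=> x hx; apply: cosK.
have := segment_can_ge_continuous (pi_ge0 R) cc ck.
by rewrite cos0 cospi.
Qed.

Lemma cont_within_comp (T : topologicalType) (a b : R) (h : R -> R) (f : T -> R) (x : T) :
  {within `[a, b], continuous h} -> (forall t, a <= f t <= b) ->
  {for x, continuous f} -> {for x, continuous (fun t => h (f t))}.
Proof.
move=> hc fab fc; have fx : `[a, b]%classic (f x) by rewrite /= in_itv/= fab.
move/subspace_continuousP : hc => /(_ _ fx) hc.
move=> A /hc /= nA; have H := fc _ nA.
have H1 : nbhs x (fun t => `[a, b]%classic (f t) -> A (h (f t))) by exact: H.
suff H2 : nbhs x (fun t => A (h (f t))) by exact: H2.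
by apply: filterS H1 => t; apply; rewrite /= in_itv/= fab.
Qed.

Definition cont2 u := forall x : R * R,
  {for x, continuous (fun t : R * R => u (t.1 +i* t.2))}.

Lemma cont2_poly Q : cont2 (fun z => complex.Re Q.[z]) /\ cont2 (fun z => complex.Im Q.[z]).
Proof.
elim/poly_ind: Q => [|Q c [hR hI]].
  split=> x; [apply: (contE (f := fun=> 0)); last exact: cont_cst|apply: (contE (f := fun=> 0)); last exact: cont_cst].
  - by apply/funext => t; rewrite horner0.
  - by apply/funext => t; rewrite horner0.
split=> x.
- apply: (contE (f := fun t : R * R => complex.Re Q.[t.1 +i* t.2] * t.1 -
    complex.Im Q.[t.1 +i* t.2] * t.2 + complex.Re c)).
    by apply/funext => t; rewrite hornerMXaddC Re_add Re_mul.
  by have := hR x; have := hI x => ? ?; cont_auto.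
- apply: (contE (f := fun t : R * R => complex.Re Q.[t.1 +i* t.2] * t.2 +
    complex.Im Q.[t.1 +i* t.2] * t.1 + complex.Im c)).
    by apply/funext => t; rewrite hornerMXaddC Im_add Im_mul.
  by have := hR x; have := hI x => ? ?; cont_auto.
Qed.

Lemma cont2_comp_poly u Q : cont2 u -> cont2 (fun z => u Q.[z]).
Proof.
move=> uc x; have [hR hI] := cont2_poly Q.
pose P (t : R * R) := (complex.Re Q.[t.1 +i* t.2], complex.Im Q.[t.1 +i* t.2]).
have -> : (fun t : R * R => u Q.[t.1 +i* t.2]) = (fun t : R * R => u (t.1 +i* t.2)) \o P.
  by apply/funext => t /=; congr u; case: (Q.[_]).
apply: continuous_comp; last exact: uc.
exact: (cvg_pair (hR x) (hI x)).
Qed.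

Lemma cont2_normc : cont2 (@normc R).
Proof.
move=> x; apply: (contE (f := fun t : R * R => Num.sqrt (t.1 ^+ 2 + t.2 ^+ 2))) => //.
by cont_auto.
Qed.

Lemma acos_clamp_cont (T : topologicalType) (f : T -> R) (x : T) :
  (forall t, -1 <= f t <= 1) -> {for x, continuous f} ->
  {for x, continuous (fun t => acos (f t))}.
Proof. by move=> hf fc; exact: cont_within_comp acos_within_continuous hf fc. Qed.

Lemma cos_direction_itv z : -1 <= complex.Re z / normc z <= 1.
Proof.
have [->|z0] := eqVneq z 0; first by rewrite mul0r; apply/andP; split; lra.
have n0 : 0 < normc z by rewrite normc_gt0.
by rewrite -ler_norml normrM normfV (gtr0_norm n0) ler_pdivrMr// mul1r abs_Re_le.
Qed.

(** [acos (Re z / |z|)] is the absolute value of the argument, in [[0, pi]], so no branch of the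
    argument is chosen and the function is even in [Im z]. *)
Definition hom_fun (k : R) W z : R :=
  normc z `^ k * W (acos (complex.Re z / normc z)).

Lemma hom_fun0 k W : 0 < k -> hom_fun k W 0 = 0.
Proof. by move=> k0; rewrite /hom_fun normc0 powR0 ?mul0r// gt_eqF. Qed.

Lemma cont2_hom_fun k W : 0 < k -> continuous W -> (forall t, `|W t| <= 1) ->
  cont2 (hom_fun k W).
Proof.
move=> k0 Wc W1 x; have nc : {for x, continuous (fun t : R * R => normc (t.1 +i* t.2))} by exact: cont2_normc.
have [n0|n0] := eqVneq (normc (x.1 +i* x.2)) 0; last first.
  rewrite /hom_fun; apply: contM.
    by apply: cont_powR => //; rewrite lt_neqAle eq_sym n0 normc_ge0.
  apply: cont_comp; first exact: Wc.
  apply: acos_clamp_cont => [t|]; first exact: cos_direction_itv.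
  apply: contM; first exact: cont_fst.
  exact: contV.
have v0 : hom_fun k W (x.1 +i* x.2) = 0 by rewrite /hom_fun n0 powR0 ?mul0r// gt_eqF.
have pc : {for x, continuous (fun t : R * R => `|normc (t.1 +i* t.2)| `^ k)}.
  exact: cont_norm_powR.
rewrite /prop_for /continuous_at v0; apply/cvgrPdist_lt => e e0.
move/cvgrPdist_lt : pc => /(_ e e0); apply: filterS => t.
rewrite n0 normr0 powR0 ?gt_eqF// !sub0r !normrN => h.
apply: le_lt_trans h; rewrite /hom_fun normrM (ger0_norm (normc_ge0 _)).
by rewrite [leRHS]ger0_norm ?powR_ge0// ger0_norm ?powR_ge0// ler_piMr ?powR_ge0.
Qed.

(** With [y] the angle measured from the direction [t0], [|z|^k cos (k y + th)] is harmonic near the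
    points of that direction other than 0, so such a minorant of [W] makes [hom_fun k W] subharmonic
    off 0. [acos (cos _)] folds angles back into [[0, pi]]. *)
Definition trig_support (k : R) W := forall t0, 0 <= t0 <= pi ->
  exists th del : R, [/\ 0 < del, W t0 = cos th & forall y, `|y| < del ->
    cos (k * y + th) <= W (acos (cos (t0 + y)))].

Lemma polar_exists z : z != 0 -> exists (t sg : R),
  [/\ 0 <= t <= pi, sg = 1 \/ sg = -1, t = acos (complex.Re z / normc z),
   complex.Re z = normc z * cos (sg * t) & complex.Im z = normc z * sin (sg * t)].
Proof.
move=> z0; have n0 : 0 < normc z by rewrite normc_gt0.
have hi := cos_direction_itv z.
set t := acos (complex.Re z / normc z).
have ht : 0 <= t <= pi by rewrite /t acos_ge0// acos_lepi.
have ct : cos t = complex.Re z / normc z by rewrite /t acosK// in_itv.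
have ReE : complex.Re z = normc z * cos t by rewrite ct mulrC divfK ?gt_eqF.
have st : 0 <= sin t by exact: sin_ge0_pi.
have ImE : complex.Im z ^+ 2 = (normc z * sin t) ^+ 2.
  have := sqr_normc_Re_Im z; rewrite ReE => h.
  by rewrite [RHS]exprMn sin2cos2 mulrBr mulr1 -exprMn h; ring.
move/eqP : ImE; rewrite eqf_sqr => /orP[] /eqP ImE.
  by exists t, 1; split => //; [left|rewrite mul1r|rewrite mul1r].
by exists t, (-1); split => //; [right|rewrite mulN1r cosN|rewrite mulN1r sinN ImE; ring].
Qed.

Lemma small_argt (del : R) : 0 < del -> exists2 e : R, 0 < e &
  forall a b, a ^+ 2 + b ^+ 2 < e ^+ 2 -> `|argt a b 1| < del.
Proof.
move=> d0; have := @continuous_atan R 0; rewrite /prop_for /continuous_at atan0.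
move=> /cvgrPdist_lt /(_ del d0)[e /= e0 He].
exists (Num.min (2^-1) (e / 2)) => [|a b ab]; first by rewrite lt_min divr_gt0//; lra.
set m := Num.min _ _ in ab.
have m0 : 0 < m by rewrite lt_min divr_gt0//; lra.
have m1 : m <= 2^-1 by rewrite ge_min lexx.
have m2 : m <= e / 2 by rewrite ge_min lexx orbT.
have a1 : `|a| < m.
  by rewrite -ltr_sqr ?nnegrE ?(ltW m0)// real_normK ?num_real//; have := sqr_ge0 b; lra.
have b1 : `|b| < m.
  by rewrite -ltr_sqr ?nnegrE ?(ltW m0)// real_normK ?num_real//; have := sqr_ge0 a; lra.
have a2 : 2^-1 < 1 + a by move: a1; rewrite ltr_norml => /andP[]; lra.
have := He (b / (1 + a)); rewrite /ball_ /= sub0r normrN => h.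
have := h _; rewrite sub0r normrN /argt !mul1r; apply.
rewrite normrM normfV (gtr0_norm (_ : 0 < 1 + a)); last by lra.
rewrite ltr_pdivrMr; last by lra.
nra.
Qed.

(** Write [z0 + w = z0 (1 + q)]. Up to the sign [sg], which records the half-plane of [z0], the
    argument of [1 + q] is the [y] of [trig_support], and the minorant becomes the real part of a
    constant times [(1 + q)^k], which [cpow_local] expands to second order. *)
Lemma local2_hom_fun k W z0 : trig_support k W -> z0 != 0 -> local2 (hom_fun k W) z0.
Proof.
move=> HW z00; have [t [sg [ht hsg tE ReE ImE]]] := polar_exists z00.
have [th [del [del0 Wt HWt]]] := HW t ht.
have [B B0 HB] := cpow_local k.
have [e e0 He] := small_argt del0.
set r := normc z0 in ReE ImE *.
have r0 : 0 < r by rewrite /r normc_gt0.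
have rk : 0 < r `^ k by rewrite powR_gt0.
have ssg : sg ^+ 2 = 1 by case: hsg => ->; rewrite ?sqrrN expr1n.
exists ((r `^ k * k)%:C * (cos th +i* (sg * sin th)) / z0).
exists ((r `^ k * (k * (k - 1) / 2))%:C * (cos th +i* (sg * sin th)) / z0 ^+ 2).
exists (r `^ k * B / r ^+ 3), (r * Num.min e 2^-1); split.
- by rewrite mulr_ge0 ?invr_ge0 ?exprn_ge0 ?mulr_ge0 ?(ltW r0) ?(ltW rk).
- by rewrite mulr_gt0// lt_min e0; lra.
move=> w hw; pose q := w / z0.
have wE : w = z0 * q by rewrite /q mulrC divfK.
have nq : normc w = r * normc q by rewrite wE normcM.
move: hw; rewrite nq ltr_pM2l// lt_min => /andP[q1 q2].
have [a [b qE]] : exists a b, q = a +i* b by case: (q) => a b; exists a, b.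
have q2E : normc q ^+ 2 = a ^+ 2 + b ^+ 2 by rewrite sqr_normc_Re_Im qE.
have ab : a ^+ 2 + b ^+ 2 <= 4^-1 by rewrite -q2E; have := normc_ge0 q; nra.
have abe : a ^+ 2 + b ^+ 2 < e ^+ 2.
  by rewrite -q2E ltr_sqr ?nnegrE ?normc_ge0// ltW.
have i01 : (0 : R) <= (1 : R) <= 1 by apply/andP; split.
have [h1 h2 h3] := sqmod_bounds ab i01.
have N0 := sqmod_gt0 b h1.
set y := argt a b 1.
have hy : `|y| < del by exact: He.
have hsy : `|sg * y| < del by rewrite normrM; case: hsg => ->; rewrite ?normrN normr1 mul1r.
set N := sqmod a b 1 in N0.
have s0 : 0 < Num.sqrt N by rewrite sqrtr_gt0.
have ca : 1 + a = Num.sqrt N * cos y.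
  by rewrite cos_argt// mul1r mulrC divfK// gt_eqF.
have sa : b = Num.sqrt N * sin y.
  by rewrite sin_argt// mul1r mulrC divfK// gt_eqF.
have zE : z0 + w = (r * Num.sqrt N)%:C * (cos (sg * t + y) +i* sin (sg * t + y)).
  rewrite wE -{1}[z0]mulr1 -mulrDr qE.
  apply: complex_eqP; rewrite ?Re_mul ?Im_mul ReE ImE /= !add0r ca sa ?cosD ?sinD; ring.
have nzw : normc (z0 + w) = r * Num.sqrt N.
  rewrite zE normcM normc_real gtr0_norm ?mulr_gt0//.
  by rewrite (normc_expi (sg * t + y)) mulr1.
have Rzw : complex.Re (z0 + w) / normc (z0 + w) = cos (t + sg * y).
  rewrite nzw zE Re_mul /= mul0r subr0 mulrC mulKf ?gt_eqF ?mulr_gt0//.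
  case: hsg => ->; rewrite ?mul1r//.
  by rewrite !mulN1r -cosN opprD opprK.
have -> : hom_fun k W (z0 + w) = r `^ k * (N `^ (k / 2) * W (acos (cos (t + sg * y)))).
  rewrite /hom_fun Rzw nzw powRM ?(ltW r0) ?(ltW s0)// -powR12_sqrt ?(ltW N0)//.
  by rewrite -powRrM [2^-1 * k]mulrC mulrA.
have -> : hom_fun k W z0 = r `^ k * cos th by rewrite /hom_fun -tE Wt.
have key : cpow k (sg * th) a b 1 <= N `^ (k / 2) * W (acos (cos (t + sg * y))).
  rewrite /cpow -/N -/y ler_wpM2l ?powR_ge0//.
  have -> : cos (k * y + sg * th) = cos (k * (sg * y) + th).
    by case: hsg => ->; rewrite ?mul1r// !mulN1r mulrN -cosN opprD opprK addrC.
  exact: HWt.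
have ck := HB (sg * th) a b ab.
have cs : cos (sg * th) = cos th by case: hsg => ->; rewrite ?mul1r// mulN1r cosN.
have sn : sin (sg * th) = sg * sin th by case: hsg => ->; rewrite ?mul1r// !mulN1r sinN.
rewrite cs sn in ck.
have e2 : Num.sqrt (a ^+ 2 + b ^+ 2) = normc q.
  by rewrite -q2E sqrtr_sqr ger0_norm// normc_ge0.
rewrite e2 in ck.
apply: le_trans (ler_wpM2l (ltW rk) (le_trans ck key)).
have f1 : (r `^ k * k)%:C * (cos th +i* (sg * sin th)) / z0 * w =
  (r `^ k * k)%:C * (cos th +i* (sg * sin th)) * q.
  by rewrite /q; ring.
have f2 : (r `^ k * (k * (k - 1) / 2))%:C * (cos th +i* (sg * sin th)) / z0 ^+ 2 * w ^+ 2
  = (r `^ k * (k * (k - 1) / 2))%:C * (cos th +i* (sg * sin th)) * q ^+ 2.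
  by rewrite /q expr_div_n [RHS]mulrA [LHS]mulrAC.
have f3 : q ^+ 2 = (a * a - b * b) +i* (a * b + b * a) by rewrite qE expr2.
move: (normc q) => m.
rewrite f1 f2 f3 qE /= le_eqVlt; apply/orP; left; apply/eqP.
by field; rewrite gt_eqF.
Qed.

Lemma local2_ln z0 : z0 != 0 -> local2 (fun z => ln (normc z)) z0.
Proof.
move=> z00; have [B B0 HB] := @ln_local R.
set r := normc z0; have r0 : 0 < r by rewrite /r normc_gt0.
exists z0^-1, (- (2^-1)%:C / z0 ^+ 2), (B / r ^+ 3), (r * 2^-1); split.
- by rewrite mulr_ge0// invr_ge0 exprn_ge0// ltW.
- by rewrite mulr_gt0.
move=> w hw; pose q := w / z0.
have wE : w = z0 * q by rewrite /q mulrC divfK.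
have nq : normc w = r * normc q by rewrite wE normcM.
move: hw; rewrite nq ltr_pM2l// => q2.
have [a [b qE]] : exists a b, q = a +i* b by case: (q) => a b; exists a, b.
have q2E : normc q ^+ 2 = a ^+ 2 + b ^+ 2 by rewrite sqr_normc_Re_Im qE.
have ab : a ^+ 2 + b ^+ 2 <= 4^-1 by rewrite -q2E; have := normc_ge0 q; nra.
have i01 : (0 : R) <= (1 : R) <= 1 by apply/andP; split.
have [h1 h2 h3] := sqmod_bounds ab i01.
have N0 := sqmod_gt0 b h1.
have nzw : normc (z0 + w) = r * Num.sqrt (sqmod a b 1).
  rewrite wE -{1}[z0]mulr1 -mulrDr normcM qE; congr (_ * _).
  by rewrite /= add0r /sqmod !mul1r.
have s0 : 0 < Num.sqrt (sqmod a b 1) by rewrite sqrtr_gt0.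
rewrite nzw lnM ?posrE// -/r -addrA lerD2l.
have -> : ln (Num.sqrt (sqmod a b 1)) = ln (sqmod a b 1) / 2.
  by rewrite -powR12_sqrt ?(ltW N0)// ln_powR mulrC.
apply: le_trans (HB a b ab).
have f1 : z0^-1 * w = q by rewrite /q mulrC.
have f2 : - (2^-1)%:C / z0 ^+ 2 * w ^+ 2 = - (2^-1)%:C * q ^+ 2.
  by rewrite /q expr_div_n [RHS]mulrA [LHS]mulrAC.
have -> : Num.sqrt (a ^+ 2 + b ^+ 2) = normc q.
  by rewrite -q2E sqrtr_sqr ger0_norm// normc_ge0.
have f3 : q ^+ 2 = (a * a - b * b) +i* (a * b + b * a) by rewrite qE expr2.
move: (normc q) => m.
rewrite f1 f2 f3 qE /= le_eqVlt; apply/orP; left; apply/eqP.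
by field; rewrite gt_eqF.
Qed.

Lemma local2_Re z0 : local2 (fun z => - complex.Re z) z0.
Proof.
exists (-1), 0, 0, 1; split => // w _.
by rewrite mul0r mul0r addr0 subr0 mulN1r Re_opp Re_add opprD.
Qed.

End Homogeneous.

(** * The maximum principle off the zeros of a polynomial *)

Section MaxPrinciple.
Context {R : realType}.
Implicit Types (z w : R[i]) (Q L : {poly R[i]}) (u v : R[i] -> R).

Lemma four_subD u v z : four_sub u z -> four_sub v z ->
  four_sub (fun z => u z + v z) z.
Proof.
move=> hu hv eta eta0; have e2 : 0 < eta / 2 by lra.
have [d1 d10 H1] := hu _ e2; have [d2 d20 H2] := hv _ e2.
exists (Num.min d1 d2) => [|rho]; first by rewrite lt_min d10.
rewrite lt_min => /and3P[r0 r1 r2].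
have := H1 rho; have := H2 rho; rewrite r0 r1 r2 => /(_ isT) h2 /(_ isT) h1; lra.
Qed.

Lemma four_subZ c u z : 0 <= c -> four_sub u z -> four_sub (fun z => c * u z) z.
Proof.
move=> c0 hu eta eta0; have e2 : 0 < eta / (c + 1) by rewrite divr_gt0//; lra.
have [d d0 H] := hu _ e2; exists d => // rho hr.
have h1 := ler_wpM2l c0 (H rho hr).
have h2 : c * (eta / (c + 1) * rho ^+ 2) <= eta * rho ^+ 2.
  rewrite mulrA ler_wpM2r ?sqr_ge0// mulrCA ler_piMr ?(ltW eta0)//.
  by rewrite ler_pdivrMr; lra.
lra.
Qed.

Lemma sqr_normc_four (z : R[i]) (rho : R) :
  normc (z + rho%:C) ^+ 2 + normc (z - rho%:C) ^+ 2 + normc (z + 'i * rho%:C) ^+ 2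
  + normc (z - 'i * rho%:C) ^+ 2 = 4 * normc z ^+ 2 + 4 * rho ^+ 2.
Proof.
by rewrite !sqr_normc_Re_Im; case: z => a b /=; ring.
Qed.

Lemma disc_compact : compact [set t : R * R | normc (t.1 +i* t.2) <= 1].
Proof.
have cB : compact (`[-1, 1] `*` `[-1, 1] : set (R * R)).
  by apply: compact_setX; exact: segment_compact.
have cl : closed [set t : R * R | normc (t.1 +i* t.2) <= 1].
  apply: (@preimage_closed _ _ (fun t : R * R => normc (t.1 +i* t.2)) [set y | y <= 1]).
    by move=> x _; exact: cont2_normc.
  exact: closed_le.
apply: (subclosed_compact cl cB) => -[a b] /= h; split; rewrite /= in_itv/= -ler_norml.
  exact: le_trans (abs_Re_le (a +i* b)) h.
exact: le_trans (abs_Im_le (a +i* b)) h.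
Qed.

Lemma poly_nonroot_near0 L (d : R) : L != 0 -> 0 < d ->
  exists2 t : R, 0 < t < d & L.[t%:C] != 0.
Proof.
move=> L0 d0; apply: contrapT => H.
pose s := [seq (d / (j.+2)%:R)%:C | j <- iota 0 (size L)].
suff : L = 0 by move/eqP; rewrite (negbTE L0).
apply: (@roots_geq_poly_eq0 _ L s).
- apply/allP => _ /mapP[j _ ->]; apply: contrapT => /negP h; apply: H.
  exists (d / j.+2%:R) => //; rewrite divr_gt0//= ltr_pdivrMr// ltr_pMr//.
  by rewrite ltr1n.
- rewrite map_inj_uniq ?iota_uniq// => i j /complexI /(mulfI (lt0r_neq0 d0)) /invr_inj.
  by move/eqP; rewrite eqr_nat => /eqP[].
- by rewrite size_map size_iota.
Qed.

(** The zeros of [L] are exempt from the hypothesis on [u]. If [u 0 = m > 0], then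
    [u + eps ell + (m / 8) (|z|^2 - 1)] has an interior maximum. The quadratic term adds
    [(m / 2) rho^2] to the sum over four points, more than the error [(m / 4) rho^2] granted by
    [four_sub], against maximality. *)
Theorem max_principle u L : cont2 u -> L != 0 ->
  (forall z, normc z < 1 -> L.[z] != 0 -> four_sub u z) ->
  (forall z, normc z = 1 -> u z <= 0) -> u 0 <= 0.
Proof.
move=> uc L0 hu hb; rewrite leNgt; apply/negP => u0.
have [B B0 HB] := poly_bound L 1.
set m := u 0 in u0.
have [d d0 Hd] : exists2 d : R, 0 < d & forall t : R, 0 < t < d -> m / 2 < u t%:C.
  have /cvgrPdist_lt /(_ (m / 2)) := uc (0, 0).
  have m2 : 0 < m / 2 by lra.
  move=> /(_ m2) [[/= V1 V2]] [/= /nbhs_ballP[d /= d0 hV1] hV2] hV.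
  exists d => // t /andP[t0 td].
  have h : `|m - u (t +i* 0)| < m / 2.
    apply: (hV (t, 0)); split => /=; last exact: nbhs_singleton.
    by apply: hV1; rewrite /ball/= sub0r normrN gtr0_norm.
  have -> : t%:C = t +i* 0 by [].
  by move: h; move: (u (t +i* 0)) => y; rewrite ltr_norml => /andP[? ?]; lra.
(* [L] may vanish at 0, as it does in [hom_fun_mean_ge0], so a nearby real point serves as the test
   point. *)
have [t /andP[t0 td] Lt] : exists2 t : R, 0 < t < Num.min d 1 & L.[t%:C] != 0.
  by apply: poly_nonroot_near0 => //; rewrite lt_min d0 ltr01.
move: td; rewrite lt_min => /andP[td t1].
have ut : m / 2 < u t%:C by apply: Hd; rewrite t0.
have nt : 0 < normc L.[t%:C] by rewrite normc_gt0.
have ltB : normc L.[t%:C] <= B by apply: HB; rewrite normc_real gtr0_norm// ltW.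
have Bp : 0 < B by exact: lt_le_trans ltB.
(* [ell] tends to -oo at the zeros of [L], which keeps the maximum away from them. *)
pose ell z := ln (normc L.[z]) - ln B.
have ell0 z : normc z <= 1 -> L.[z] != 0 -> ell z <= 0.
  move=> z1 Lz; rewrite /ell subr_le0 ler_ln ?posrE// ?normc_gt0//; exact: HB.
(* With this factor the term in [ell] costs less than [m / 8] at [t]. The quadratic term costs at
   most [m / 8], so [f] exceeds [m / 4] there. *)
pose eps := m / (8 * (1 - ell t%:C)).
have lt0 : ell t%:C <= 0 by apply: ell0 => //; rewrite normc_real gtr0_norm// ltW.
have eps0 : 0 < eps by rewrite divr_gt0// mulr_gt0//; lra.
have epst : - (m / 8) < eps * ell t%:C.
  have : eps * (1 - ell t%:C) = m / 8 by rewrite /eps; field; rewrite gt_eqF//; lra.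
  by lra.
pose f z := u z + eps * ell z + m / 8 * (normc z ^+ 2 - 1).
have ft : m / 4 < f t%:C.
  rewrite /f; have : - (m / 8) <= m / 8 * (normc t%:C ^+ 2 - 1).
    by rewrite -[leLHS]mulrN1 ler_pM2l ?lerDr ?sqr_ge0//; lra.
  by lra.
have [M HM] : exists M, forall z, normc z <= 1 -> u z <= M.
  have [|c _ Hc] := compact_EVT_max _ disc_compact
      (within_cont_set (fun (x : R * R) _ => uc x)).
    by exists (0, 0); rewrite /= expr0n addr0 sqrtr0.
  exists (u (c.1 +i* c.2)) => -[a b] hz; apply: (Hc (a, b)); rewrite inE//.
have M0 : 0 < M by apply: lt_le_trans u0 _; apply: HM; rewrite normc0.
(* Where [|L| <= kap], [eps ell] is at most [- (M + 1)] and [f] is negative, so the maximum may be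
   sought on the compact set where [kap <= |L|]. *)
pose kap := B * expR (- ((M + 1) / eps)).
have kap0 : 0 < kap by rewrite mulr_gt0// expR_gt0.
have small z : normc z <= 1 -> L.[z] != 0 -> normc L.[z] <= kap -> f z < 0.
  move=> z1 Lz zk; have nL : 0 < normc L.[z] by rewrite normc_gt0.
  have l1 : ell z <= - ((M + 1) / eps).
    rewrite /ell lerBlDr -(expRK (- ((M + 1) / eps))) -lnM ?posrE ?expR_gt0//.
    by rewrite ler_ln ?posrE ?mulr_gt0 ?expR_gt0// mulrC.
  have l2 : eps * ell z <= - (M + 1).
    apply: le_trans (ler_wpM2l (ltW eps0) l1) _.
    by rewrite mulrN mulrC divfK// gt_eqF.
  have l3 : m / 8 * (normc z ^+ 2 - 1) <= 0.
    rewrite mulr_ge0_le0 ?subr_le0 ?expr_le1 ?normc_ge0//; lra.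
  rewrite /f; have := HM z z1; lra.
pose K := [set x : R * R | normc (x.1 +i* x.2) <= 1 /\ kap <= normc L.[x.1 +i* x.2]].
have nc : cont2 (@normc R) by exact: cont2_normc.
have nLc : cont2 (fun z => normc L.[z]) by exact: (@cont2_comp_poly R (@normc R) L).
have cK : compact K.
  have cl : closed [set x : R * R | kap <= normc L.[x.1 +i* x.2]].
    apply: (@preimage_closed _ _ (fun x : R * R => normc L.[x.1 +i* x.2]) [set y | kap <= y]).
      by move=> x _; exact: nLc.
    exact: closed_ge.
  have cl1 : closed [set x : R * R | normc (x.1 +i* x.2) <= 1].
    by apply: compact_closed disc_compact; exact: norm_hausdorff.
  apply: (subclosed_compact (closedI cl1 cl) disc_compact) => x [] //.
have fc : {within K, continuous (fun x : R * R => f (x.1 +i* x.2))}.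
  apply: within_cont_set => x [x1 x2]; rewrite /f /ell.
  have c1 := uc x; have c2 := nLc x; have c3 := nc x.
  apply: contD; first apply: contD => //.
    apply: contM; first exact: cont_cst.
    apply: contD; last exact: cont_cst.
    by apply: cont_ln => //; exact: lt_le_trans x2.
  apply: contM; first exact: cont_cst.
  apply: contD; last exact: cont_cst.
  exact: contX.
have tK : K (t, 0).
  split; first by rewrite -[_ +i* _]/(t%:C) normc_real /= gtr0_norm// ltW.
  rewrite leNgt; apply/negP => /ltW hk.
  have := small t%:C; rewrite normc_real gtr0_norm// ltW// => /(_ isT Lt hk); lra.
have [[a b]] := compact_EVT_max (ex_intro _ _ tK) cK fc.
rewrite inE => -[ab1 ab2] maxf.
pose z0 : R[i] := a +i* b.
have {}ab1 : normc z0 <= 1 := ab1.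
have {}ab2 : kap <= normc L.[z0] := ab2.
have {}maxf (x : R * R) : x \in K -> f (x.1 +i* x.2) <= f z0 := maxf x.
have fz0 : m / 4 < f z0.
  by apply: lt_le_trans ft _; apply: (maxf (t, 0)); rewrite inE.
have Lz0 : L.[z0] != 0 by rewrite -normc_gt0; exact: lt_le_trans ab2.
have z01 : normc z0 < 1.
  rewrite lt_neqAle ab1 andbT; apply/eqP => n1.
  have : f z0 <= 0.
    rewrite /f n1 expr1n subrr mulr0 addr0.
    have := hb _ n1; have := ell0 _ ab1 Lz0.
    by move=> h1 h2; have := mulr_ge0_le0 (ltW eps0) h1; lra.
  by lra.
have maxD z : normc z <= 1 -> L.[z] != 0 -> f z <= f z0.
  move=> z1 Lz; have [hk|/ltW hk] := leP kap (normc L.[z]).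
    by case: z z1 Lz hk => x y z1 Lz hk; apply: (maxf (x, y)); rewrite inE.
  by have := small _ z1 Lz hk; lra.
have fs : four_sub (fun z => u z + eps * ell z) z0.
  apply: four_subD; first exact: hu.
  apply: four_subZ; first exact: ltW.
  apply: four_subD; first by apply: (four_sub_comp (v := fun z => ln (normc z))); exact: local2_ln.
  move=> eta eta0; exists 1 => // rho _.
  by have := mulr_ge0 (ltW eta0) (sqr_ge0 rho); lra.
have m4 : 0 < m / 4 by lra.
have [d1 d10 H1] := fs _ m4.
have [d2 d20 H2] : exists2 d2 : R, 0 < d2 & forall w, normc w < d2 -> L.[z0 + w] != 0.
  have [D DE] : exists D : {poly R[i]}, forall w, L.[z0 + w] = L.[z0] + w * D.[w].
    pose P := L \Po ('X + z0%:P) - L.[z0]%:P.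
    have PE w : L.[z0 + w] = L.[z0] + P.[w].
      rewrite /P hornerD hornerN hornerC horner_comp hornerD hornerX hornerC.
      by rewrite [w + z0]addrC; ring.
    have : root P 0 by rewrite /root; apply/eqP/(addrI L.[z0]); rewrite -PE !addr0.
    move=> /factor_theorem[D PD]; exists D => w.
    by rewrite PE PD hornerM hornerXsubC subr0 mulrC.
  have [K1 K10 HK1] := poly_bound D 1.
  have nL0 : 0 < normc L.[z0] by rewrite normc_gt0.
  exists (Num.min 1 (normc L.[z0] / (K1 + 1))).
    by rewrite lt_min ltr01 divr_gt0//; lra.
  move=> w; rewrite lt_min => /andP[w1 w2]; rewrite DE; apply/eqP => h.
  have e : L.[z0] = - (w * D.[w]) by apply/eqP; rewrite -addr_eq0 h.
  have : normc L.[z0] <= normc w * K1.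
    by rewrite e normc_opp normcM ler_wpM2l ?normc_ge0// HK1// ltW.
  move: w2; rewrite ltr_pdivlMr; last by lra.
  by have := normc_ge0 w; lra.
pose rho := Num.min (d1 / 2) (Num.min (d2 / 2) (1 - normc z0)).
have rho0 : 0 < rho by rewrite !lt_min !divr_gt0 ?subr_gt0.
have r1 : rho <= d1 / 2 by rewrite ge_min lexx.
have r2 : rho <= d2 / 2 by rewrite !ge_min lexx orbT.
have r3 : rho <= 1 - normc z0 by rewrite !ge_min lexx !orbT.
have nb w : normc w = rho -> f (z0 + w) <= f z0.
  move=> nw; apply: maxD; last by apply: H2; rewrite nw; lra.
  by apply: le_trans (normc_triangle _ _) _; rewrite nw; lra.
have nr : normc rho%:C = rho by rewrite normc_real gtr0_norm.
have ni : normc ('i * rho%:C) = rho.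
  by rewrite normcM nr /= expr0n add0r expr1n sqrtr1 mul1r.
have n1 := nb _ nr; have n3 := nb _ ni.
have n2 : f (z0 - rho%:C) <= f z0 by apply: nb; rewrite normc_opp.
have n4 : f (z0 - 'i * rho%:C) <= f z0 by apply: nb; rewrite normc_opp.
have := H1 rho; have -> : 0 < rho < d1 by apply/andP; split; lra.
move=> /(_ isT); have := sqr_normc_four z0 rho.
move: n1 n2 n3 n4; rewrite /f.
have := exprn_gt0 2 rho0.
move: (normc _ ^+ 2) (normc _ ^+ 2) (normc _ ^+ 2) (normc _ ^+ 2) (normc _ ^+ 2) => s1 s2 s3 s4 s5.
move: (u _ + _) (u _ + _) (u _ + _) (u _ + _) (u _ + _) => v1 v2 v3 v4 v5.
move=> q0 n1 n2 n3 n4 hs hv.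
clear -q0 n1 n2 n3 n4 hs hv u0; nra.
Qed.

End MaxPrinciple.

(** * Fejer means *)

Section PeriodIntegral.
Context {R : realType}.
Notation pi := (@pi R).
Notation mu := (@lebesgue_measure R).
Implicit Types (F G : R -> R) (x t : R).

Definition intg F : Prop := mu.-integrable `[0, 2 * pi]%classic (EFin \o F).
Definition per_int F : R := \int[mu]_(t in `[0, 2 * pi]) F t.

Let mD : @measurable _ (measurableTypeR R) `[0, 2 * pi]%classic.
Proof. exact: measurable_itv. Qed.

Lemma pi2_gt0 : 0 < 2 * pi.
Proof. by rewrite mulr_gt0// pi_gt0. Qed.

Lemma intgD F G : intg F -> intg G -> intg (fun t => F t + G t).
Proof. by move=> hF hG; have := integrableD mD hF hG. Qed.

Lemma intgZ c F : intg F -> intg (fun t => c * F t).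
Proof. by move=> hF; have := integrableZl mD c hF. Qed.

Lemma intgN F : intg F -> intg (fun t => - F t).
Proof. by move=> /(intgZ (-1)); congr (integrable _ _ _); apply/funext => t; rewrite /= mulN1r. Qed.

Lemma intgB F G : intg F -> intg G -> intg (fun t => F t - G t).
Proof. by move=> hF hG; apply: intgD => //; exact: intgN. Qed.

Lemma intg_norm F : intg F -> intg (fun t => `|F t|).
Proof. by move=> hF; exact: integrable_norm. Qed.

Lemma intg_cont F : continuous F -> intg F.
Proof.
move=> Fc; apply: continuous_compact_integrable; first exact: segment_compact.
exact: continuous_subspaceT.
Qed.

Lemma intg_cst c : intg (fun=> c).
Proof. by apply: intg_cont => x; exact: cst_continuous. Qed.

Lemma intg_sum (I : Type) (s : seq I) (P : pred I) (h : I -> R -> R) :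
  (forall i, P i -> intg (h i)) -> intg (fun t => \sum_(i <- s | P i) h i t).
Proof.
move=> hi; elim: s => [|i s ih].
  rewrite (_ : (fun t => _) = fun=> 0); first exact: intg_cst.
  by apply/funext => t; rewrite big_nil.
have [Pi|Pi] := boolP (P i).
  rewrite (_ : (fun t => _) = fun t => h i t + \sum_(j <- s | P j) h j t).
    by apply: intgD => //; exact: hi.
  by apply/funext => t; rewrite big_cons Pi.
rewrite (_ : (fun t => _) = fun t => \sum_(j <- s | P j) h j t)//.
by apply/funext => t; rewrite big_cons (negbTE Pi).
Qed.

Lemma intg_mul_cont F G : intg F -> continuous G -> intg (fun t => F t * G t).
Proof.
move=> hF Gc.
have mG : measurable_fun `[0, 2 * pi]%classic G.
  by apply: measurable_funTS; exact: continuous_measurable_fun.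
have bG : [bounded G x | x in `[0, 2 * pi]%classic].
  have := @continuous_compact R R G `[0, 2 * pi]%classic (continuous_subspaceT Gc) (@segment_compact _ _ _).
  by move=> /compact_bounded[M [Mr H]]; exists M; split => // y My x Dx; apply: H => //; exists x.
by have := integrableMl mD hF mG bG.
Qed.

Lemma per_intD F G : intg F -> intg G ->
  per_int (fun t => F t + G t) = per_int F + per_int G.
Proof. by move=> hF hG; exact: RintegralD. Qed.

Lemma per_intZ c F : intg F -> per_int (fun t => c * F t) = c * per_int F.
Proof. by move=> hF; exact: RintegralZl. Qed.

Lemma per_intN F : intg F -> per_int (fun t => - F t) = - per_int F.
Proof.
move=> hF; rewrite -mulN1r -per_intZ//; congr per_int.
by apply/funext => t; rewrite mulN1r.
Qed.

Lemma per_intB F G : intg F -> intg G ->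
  per_int (fun t => F t - G t) = per_int F - per_int G.
Proof. by move=> hF hG; rewrite per_intD ?per_intN//; exact: intgN. Qed.

Lemma per_int_cst c : per_int (fun=> c) = 2 * pi * c.
Proof. by rewrite /per_int Rintegral_cst//= lebesgue_measure_itv/= lte_fin pi2_gt0 /= subr0 mulrC. Qed.

Lemma per_int_sum (I : Type) (s : seq I) (P : pred I) (h : I -> R -> R) :
  (forall i, P i -> intg (h i)) ->
  per_int (fun t => \sum_(i <- s | P i) h i t) = \sum_(i <- s | P i) per_int (h i).
Proof.
move=> hi; elim: s => [|i s ih].
  rewrite big_nil (_ : (fun t => _) = fun=> 0) ?per_int_cst ?mulr0//.
  by apply/funext => t; rewrite big_nil.
rewrite big_cons; have [Pi|Pi] := boolP (P i).
  rewrite (_ : (fun t => _) = fun t => h i t + \sum_(j <- s | P j) h j t).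
    by rewrite per_intD ?ih//; [exact: hi|exact: intg_sum].
  by apply/funext => t; rewrite big_cons Pi.
rewrite (_ : (fun t => _) = fun t => \sum_(j <- s | P j) h j t)//.
by apply/funext => t; rewrite big_cons (negbTE Pi).
Qed.

Lemma per_int_le F G : intg F -> intg G ->
  (forall t, 0 <= t <= 2 * pi -> F t <= G t) -> per_int F <= per_int G.
Proof.
move=> hF hG FG; apply: le_Rintegral => // t /=; rewrite in_itv/=; exact: FG.
Qed.

Lemma per_int_ge0 F : (forall t, 0 <= t <= 2 * pi -> 0 <= F t) -> 0 <= per_int F.
Proof.
by move=> F0; apply: Rintegral_ge0 => t /=; rewrite in_itv/=; exact: F0.
Qed.

Lemma per_int_norm F : intg F -> `|per_int F| <= per_int (fun t => `|F t|).
Proof. by move=> hF; exact: le_normr_Rintegral. Qed.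

Lemma per_int_ftc F G : continuous G -> (forall x, der x F (G x)) ->
  per_int G = F (2 * pi) - F 0.
Proof.
move=> Gc dF; rewrite /per_int /Rintegral.
rewrite (@continuous_FTC2 _ G F 0 (2 * pi))//; first exact: pi2_gt0.
- exact: continuous_subspaceT.
- split.
  + by move=> x _; have := dF x; case.
  + by apply: cvg_at_right_filter; apply: (der_cont (dF 0)).
  + by apply: cvg_at_left_filter; apply: (der_cont (dF _)).
- by move=> x _; rewrite derive1E; have := dF x => ?; rewrite derive_val.
Qed.

Lemma sin_nat_2pi (m : nat) : sin (m%:R * (2 * pi)) = 0 /\ cos (m%:R * (2 * pi)) = 1.
Proof.
elim: m => [|m [ihs ihc]]; first by rewrite mul0r sin0 cos0.
have s2 : sin (2 * pi) = 0 by rewrite mulr_natl sin2pi.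
have c2 : cos (2 * pi) = 1 by rewrite mulr_natl cos2pi.
rewrite -natr1 mulrDl mul1r sinD cosD ihs ihc s2 c2; split; ring.
Qed.

Lemma continuous_cosM (m : R) : continuous (fun t : R => cos (m * t)).
Proof. by move=> x; apply: (der_cont (a := - sin (m * x) * m)); der_auto; ring. Qed.

Lemma continuous_sinM (m : R) : continuous (fun t : R => sin (m * t)).
Proof. by move=> x; apply: (der_cont (a := cos (m * x) * m)); der_auto; ring. Qed.

Lemma per_int_cos (m : nat) : per_int (fun t => cos (m%:R * t)) = (m == 0)%:R * (2 * pi).
Proof.
case: m => [|m].
  rewrite eqxx mul1r (_ : (fun t => _) = fun=> 1) ?per_int_cst ?mulr1//.
  by apply/funext => t; rewrite mul0r cos0.
have m0 : m.+1%:R != 0 :> R by rewrite pnatr_eq0.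
have dF x : der x (fun t => sin (m.+1%:R * t) / m.+1%:R) (cos (m.+1%:R * x)).
  by der_auto; field; rewrite nat1r.
rewrite /= mul0r (per_int_ftc (@continuous_cosM m.+1%:R) dF).
by rewrite (sin_nat_2pi m.+1).1 mulr0 sin0 !mul0r subr0.
Qed.

Lemma per_int_sin (m : nat) : per_int (fun t => sin (m%:R * t)) = 0.
Proof.
case: m => [|m].
  rewrite (_ : (fun t => _) = fun=> 0) ?per_int_cst ?mulr0//.
  by apply/funext => t; rewrite mul0r sin0.
have m0 : m.+1%:R != 0 :> R by rewrite pnatr_eq0.
have dF x : der x (fun t => - cos (m.+1%:R * t) / m.+1%:R) (sin (m.+1%:R * x)).
  by der_auto; field; rewrite nat1r.
rewrite (per_int_ftc (@continuous_sinM m.+1%:R) dF).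
by rewrite (sin_nat_2pi m.+1).2 mulr0 cos0 subrr.
Qed.

End PeriodIntegral.

(** * The Fejer kernel *)

Section Fejer.
Context {R : realType}.
Notation pi := (@pi R).
Implicit Types (F G : R -> R) (x t y : R) (M : nat).

(** This is [|i - j|] in [nat]: cosines are even, so natural frequencies suffice for the real
    kernel. *)
Definition ndist (i j : nat) : nat := (i - j + (j - i))%N.

Lemma cos_ndist i j y : cos ((ndist i j)%:R * y) = cos (i%:R * y) * cos (j%:R * y) + sin (i%:R * y) * sin (j%:R * y).
Proof.
rewrite -cosB -mulrBl /ndist; have [ij|/ltnW ij] := leqP i j.
  rewrite (_ : i - j = 0)%N ?add0n ?natrB//; last by apply/eqP; rewrite subn_eq0.
  by rewrite -cosN -mulNr opprB.
rewrite (_ : j - i = 0)%N ?addn0 ?natrB//; by apply/eqP; rewrite subn_eq0.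
Qed.

(** The Fejer kernel [|1 + e^{iy} + ... + e^{i(M-1)y}|^2 / M], expanded without collecting equal
    frequencies. *)
Definition fker M y : R :=
  M%:R^-1 * \sum_(i < M) \sum_(j < M) cos ((ndist i j)%:R * y).

Definition fejer M F x : R := (2 * pi)^-1 * per_int (fun t => F t * fker M (x - t)).

Lemma fkerE M y : fker M y = M%:R^-1 *
  ((\sum_(i < M) cos (i%:R * y)) ^+ 2 + (\sum_(i < M) sin (i%:R * y)) ^+ 2).
Proof.
rewrite /fker; congr (_ * _); rewrite !expr2 !big_distrlr -big_split /=.
apply: eq_bigr => i _; rewrite -big_split; apply: eq_bigr => j _.
exact: cos_ndist.
Qed.

Lemma fker_ge0 M y : 0 <= fker M y.
Proof. by rewrite fkerE mulr_ge0 ?invr_ge0 ?addr_ge0 ?sqr_ge0. Qed.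

(** Real and imaginary parts of [(1 - e^{iy}) (1 + e^{iy} + ... + e^{i(M-1)y}) = 1 - e^{iMy}]. *)
Lemma dirichlet_telescope M y :
  (1 - cos y) * \sum_(i < M) cos (i%:R * y) + sin y * \sum_(i < M) sin (i%:R * y)
    = 1 - cos (M%:R * y) /\
  (1 - cos y) * \sum_(i < M) sin (i%:R * y) - sin y * \sum_(i < M) cos (i%:R * y)
    = - sin (M%:R * y).
Proof.
elim: M => [|M [ihc ihs]].
  by rewrite !big_ord0 !mul0r !mulr0 cos0 sin0 !subrr addr0 oppr0.
have -> : M.+1%:R * y = M%:R * y + y by rewrite -natr1 mulrDl mul1r.
rewrite !big_ord_recr/= cosD sinD.
move: ihc ihs; set C := \sum_(i < M) _; set S := \sum_(i < M) _ => ihc ihs.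
set c := cos (M%:R * y) in ihc *; set s := sin (M%:R * y) in ihs *.
split.
  have -> : (1 - cos y) * (C + c) + sin y * (S + s) =
    ((1 - cos y) * C + sin y * S) + (1 - cos y) * c + sin y * s by ring.
  by rewrite ihc; ring.
have -> : (1 - cos y) * (S + s) - sin y * (C + c) =
    ((1 - cos y) * S - sin y * C) + (1 - cos y) * s - sin y * c by ring.
by rewrite ihs; ring.
Qed.

(** The product is [(1 - cos (M y)) / M]. This single estimate expresses the concentration of the
    kernel: in the manner of Korovkin, approximation follows for functions whose increments are
    controlled by [1 - cos]. *)
Lemma fker_korovkin M y : fker M y * (1 - cos y) <= 2 / M%:R.
Proof.
rewrite fkerE; have [] := dirichlet_telescope M y.
set C := \sum_(i < M) _; set S := \sum_(i < M) _ => e1 e2.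
have [M0|M0] := leqP M 0.
  by rewrite (_ : M = 0%N) ?invr0 ?mul0r ?mulr0//; case: M M0 {e1 e2 C S}.
rewrite -mulrA mulrC ler_pM2r ?invr_gt0 ?ltr0n//.
have e3 : ((C ^+ 2 + S ^+ 2) * (1 - cos y)) * 2 = 2 * (1 - cos (M%:R * y)).
  transitivity (((1 - cos y) * C + sin y * S) ^+ 2 + ((1 - cos y) * S - sin y * C) ^+ 2).
    have -> : ((1 - cos y) * C + sin y * S) ^+ 2 + ((1 - cos y) * S - sin y * C) ^+ 2 =
      (C ^+ 2 + S ^+ 2) * (1 - 2 * cos y + (cos y ^+ 2 + sin y ^+ 2)) by ring.
    by rewrite cos2Dsin2; ring.
  rewrite e1 e2 sqrrN sin2cos2; ring.
have := cos_geN1 (M%:R * y); lra.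
Qed.

Lemma cont_sum (I : Type) (s : seq I) (P : pred I) (h : I -> R -> R) :
  (forall i, continuous (h i)) -> continuous (fun t => \sum_(i <- s | P i) h i t).
Proof.
move=> hc; elim: s => [|i s ih] x.
  by apply: (contE (f := fun=> 0)); [apply/funext => t; rewrite big_nil|exact: cont_cst].
have [Pi|Pi] := boolP (P i).
  apply: (contE (f := fun t => h i t + \sum_(j <- s | P j) h j t)).
    by apply/funext => t; rewrite big_cons Pi.
  by apply: contD; [exact: hc|exact: ih].
apply: (contE (f := fun t => \sum_(j <- s | P j) h j t)); last exact: ih.
by apply/funext => t; rewrite big_cons (negbTE Pi).
Qed.

Lemma continuous_fker M x : continuous (fun t => fker M (x - t)).
Proof.
have H : continuous (fun t => \sum_(i < M) \sum_(j < M) cos ((ndist i j)%:R * (x - t))).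
  apply: cont_sum => i; apply: cont_sum => j t.
  apply: (der_cont (a := sin ((ndist i j)%:R * (x - t)) * (ndist i j)%:R)).
  by der_auto; ring.
by move=> t; exact: (contM (@cont_cst _ _ M%:R^-1 t) (H t)).
Qed.

Lemma intg_fker M F x : intg F -> intg (fun t => F t * fker M (x - t)).
Proof. by move=> hF; apply: intg_mul_cont => //; exact: continuous_fker. Qed.

Lemma fejerE M F x : intg F -> fejer M F x = (2 * pi * M%:R)^-1 *
  \sum_(i < M) \sum_(j < M)
   (cos ((ndist i j)%:R * x) * per_int (fun t => F t * cos ((ndist i j)%:R * t)) +
    sin ((ndist i j)%:R * x) * per_int (fun t => F t * sin ((ndist i j)%:R * t))).
Proof.
move=> hF; have hc n := intg_mul_cont hF (@continuous_cosM R n).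
have hs n := intg_mul_cont hF (@continuous_sinM R n).
have hcs n : intg (fun t => cos (n * x) * (F t * cos (n * t)) + sin (n * x) * (F t * sin (n * t))).
  by apply: intgD; apply: intgZ; [exact: hc|exact: hs].
rewrite /fejer (invfM (2 * pi)) -[RHS]mulrA; congr (_ * _).
rewrite (_ : (fun t => _) = fun t => M%:R^-1 * \sum_(i < M) \sum_(j < M)
  (cos ((ndist i j)%:R * x) * (F t * cos ((ndist i j)%:R * t)) +
    sin ((ndist i j)%:R * x) * (F t * sin ((ndist i j)%:R * t)))); last first.
  apply/funext => t; rewrite /fker mulrCA; congr (_ * _).
  rewrite big_distrr /=; apply: eq_bigr => i _; rewrite big_distrr /=.
  by apply: eq_bigr => j _; rewrite mulrBr cosB; ring.
rewrite per_intZ; last by apply: intg_sum => i _; apply: intg_sum => j _; exact: hcs.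
congr (_ * _); rewrite per_int_sum; last by move=> i _; apply: intg_sum => j _; exact: hcs.
apply: eq_bigr => i _; rewrite per_int_sum; last by move=> j _; exact: hcs.
apply: eq_bigr => j _; rewrite per_intD ?per_intZ//.
all: first [exact: hs|exact: hc|apply: intgZ; exact: hc|apply: intgZ; exact: hs].
Qed.

Lemma fejerD M F G x : intg F -> intg G ->
  fejer M (fun t => F t + G t) x = fejer M F x + fejer M G x.
Proof.
move=> hF hG; have h1 := intg_fker M x hF; have h2 := intg_fker M x hG.
rewrite /fejer -mulrDr -(per_intD h1 h2).
by congr (_ * per_int _); apply/funext => t; rewrite mulrDl.
Qed.

Lemma fejerZ M c F x : intg F -> fejer M (fun t => c * F t) x = c * fejer M F x.
Proof.
move=> hF; rewrite /fejer mulrCA -(per_intZ c (intg_fker M x hF)).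
by congr (_ * per_int _); apply/funext => t; rewrite mulrA.
Qed.

Lemma fejer_le M F G x : intg F -> intg G ->
  (forall t, 0 <= t <= 2 * pi -> F t <= G t) -> fejer M F x <= fejer M G x.
Proof.
move=> hF hG FG; rewrite /fejer ler_wpM2l ?invr_ge0 ?(ltW (@pi2_gt0 R))//.
apply: per_int_le; [exact: intg_fker|exact: intg_fker|move=> t ht].
by rewrite ler_wpM2r ?fker_ge0// FG.
Qed.

Lemma ndist_eq0 i j : (ndist i j == 0%N) = (i == j).
Proof. by rewrite /ndist addn_eq0 !subn_eq0 -eqn_leq. Qed.

Lemma diag_sum M (c : R) : \sum_(i < M) \sum_(j < M) (ndist i j == 0%N)%:R * c = M%:R * c.
Proof.
rewrite (eq_bigr (fun=> c)) ?sumr_const ?card_ord ?mulr_natl// => i _.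
rewrite (bigD1 i)//= ndist_eq0 eqxx mul1r big1 ?addr0// => j ji.
by rewrite ndist_eq0 eq_sym -val_eqE /= in ji *; rewrite (negbTE ji) mul0r.
Qed.

Lemma fejer_cst M c x : (0 < M)%N -> fejer M (fun=> c) x = c.
Proof.
move=> M0; have p0 := @pi2_gt0 R; rewrite fejerE; last exact: intg_cst.
rewrite (eq_bigr (fun i : 'I_M => \sum_(j < M) (ndist i j == 0%N)%:R * (2 * pi * c))).
  by rewrite diag_sum; field; rewrite gt_eqF ?ltr0n// gt_eqF//; lra.
move=> i _; apply: eq_bigr => j _; set n := ndist i j.
rewrite !per_intZ; [|apply: intg_cont; exact: continuous_sinM|apply: intg_cont; exact: continuous_cosM].
rewrite per_int_cos per_int_sin; have tE : true%:R = 1 :> R by [].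
have fE : false%:R = 0 :> R by [].
by case: eqVneq => [->|_]; rewrite ?tE ?fE ?[0 * x]mul0r ?cos0; ring.
Qed.

Lemma intg_fejer M F : intg F -> intg (fejer M F).
Proof.
move=> hF; rewrite (_ : fejer M F = fun x => (2 * pi * M%:R)^-1 * \sum_(i < M) \sum_(j < M)
   (cos ((ndist i j)%:R * x) * per_int (fun t => F t * cos ((ndist i j)%:R * t)) +
    sin ((ndist i j)%:R * x) * per_int (fun t => F t * sin ((ndist i j)%:R * t)))); last first.
  by apply/funext => x; rewrite fejerE.
apply: intgZ; apply: intg_sum => i _; apply: intg_sum => j _; apply: intgD.
  apply: intg_cont => x; exact: (contM (@continuous_cosM R _ x) (@cont_cst _ _ _ x)).
apply: intg_cont => x; exact: (contM (@continuous_sinM R _ x) (@cont_cst _ _ _ x)).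
Qed.

Lemma per_int_fejer M F : (0 < M)%N -> intg F -> per_int (fejer M F) = per_int F.
Proof.
move=> M0 hF; have p0 := @pi2_gt0 R.
rewrite (_ : fejer M F = fun x => (2 * pi * M%:R)^-1 * \sum_(i < M) \sum_(j < M)
   (per_int (fun t => F t * cos ((ndist i j)%:R * t)) * cos ((ndist i j)%:R * x) +
    per_int (fun t => F t * sin ((ndist i j)%:R * t)) * sin ((ndist i j)%:R * x))); last first.
  apply/funext => x; rewrite fejerE//; congr (_ * _).
  by apply: eq_bigr => i _; apply: eq_bigr => j _; congr (_ + _); rewrite mulrC.
have hc n (c : R) : intg (fun x => c * cos (n * x)).
  by apply: intgZ; apply: intg_cont; exact: continuous_cosM.
have hs n (c : R) : intg (fun x => c * sin (n * x)).
  by apply: intgZ; apply: intg_cont; exact: continuous_sinM.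
rewrite per_intZ; last by apply: intg_sum => i _; apply: intg_sum => j _; exact: intgD.
rewrite per_int_sum; last by move=> i _; apply: intg_sum => j _; exact: intgD.
rewrite (eq_bigr (fun i : 'I_M => \sum_(j < M) (ndist i j == 0%N)%:R * (2 * pi * per_int F))).
  by rewrite diag_sum; field; rewrite gt_eqF ?ltr0n// gt_eqF//; lra.
move=> i _; rewrite per_int_sum; last by move=> j _; exact: intgD.
apply: eq_bigr => j _; set n := ndist i j.
rewrite per_intD ?hc ?hs// !per_intZ; [|apply: intg_cont; exact: continuous_sinM|apply: intg_cont; exact: continuous_cosM].
rewrite per_int_cos per_int_sin; have tE : true%:R = 1 :> R by [].
have fE : false%:R = 0 :> R by [].
case: eqVneq => [->|_]; rewrite ?tE ?fE; last by ring.
rewrite (_ : (fun t => F t * cos _) = F); first by ring.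
by apply/funext => t; rewrite mul0r cos0 mulr1.
Qed.

Lemma fejer_korovkin M F x (c e C : R) : (0 < M)%N -> intg F -> 0 <= C ->
  (forall t, 0 <= t <= 2 * pi -> `|F t - c| <= e + C * (1 - cos (x - t))) ->
  `|fejer M F x - c| <= e + 2 * C / M%:R.
Proof.
move=> M0 hF C0 H; have p0 := @pi2_gt0 R.
have Mp : (0 : R) < M%:R by rewrite ltr0n.
have hc : intg (fun=> c) by exact: intg_cst.
have -> : fejer M F x - c = fejer M (fun t => F t - c) x.
  by rewrite (fejerD M x hF (intg_cst (- c))) fejer_cst.
have hFc : intg (fun t => F t - c) by exact: intgB.
rewrite /fejer normrM gtr0_norm ?invr_gt0//.
rewrite mulrC ler_pdivrMr//; apply: le_trans (per_int_norm (intg_fker _ _ hFc)) _.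
have -> : (e + 2 * C / M%:R) * (2 * pi) =
  per_int (fun t => e * fker M (x - t) + 2 * C / M%:R).
  rewrite per_intD ?per_int_cst; [|by apply: intgZ; apply: intg_cont; exact: continuous_fker|exact: intg_cst].
  have := fejer_cst 1 x M0; rewrite /fejer => h1.
  rewrite per_intZ; last by apply: intg_cont; exact: continuous_fker.
  have -> : per_int (fun t => fker M (x - t)) = 2 * pi.
    have h2 : per_int (fun t => 1 * fker M (x - t)) = 2 * pi.
      by apply: (mulfI (_ : (2 * pi)^-1 != 0)); rewrite ?invr_eq0 ?gt_eqF// h1 mulVf// gt_eqF.
    by rewrite -[RHS]h2; congr per_int; apply/funext => t; rewrite mul1r.
  by ring.
apply: per_int_le.
- by apply: intg_norm; exact: intg_fker.
- by apply: intgD; [apply: intgZ; apply: intg_cont; exact: continuous_fker|exact: intg_cst].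
- move=> t ht; rewrite normrM (ger0_norm (fker_ge0 _ _)).
  apply: le_trans (ler_wpM2r (fker_ge0 _ _) (H t ht)) _.
  have := ler_wpM2l C0 (fker_korovkin M (x - t)).
  by move: (fker M (x - t)) (cos (x - t)) (M%:R^-1) => u v w; lra.
Qed.

End Fejer.

(** * Means of subharmonic functions of polynomials *)

Section SubharmonicMean.
Context {R : realType}.
Notation pi := (@pi R).
Implicit Types (F : R -> R) (x t : R) (z : R[i]) (Q H : {poly R[i]}) (u : R[i] -> R).

Lemma expiD x t : expi (x + t) = expi x * expi t.
Proof. by apply: complex_eqP; rewrite ?Re_mul ?Im_mul /= ?cosD ?sinD; ring. Qed.

Lemma expiX x n : expi x ^+ n = expi (n%:R * x).
Proof.
elim: n => [|n ih]; first by rewrite mul0r /expi cos0 sin0.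
by rewrite exprS ih -expiD -natr1 mulrDl mul1r addrC.
Qed.

Lemma circle_param z : normc z = 1 -> exists2 x, 0 <= x <= 2 * pi & z = expi x.
Proof.
move=> z1; have pi0 := pi_gt0 R.
have z0 : z != 0 by rewrite -normc_gt0 z1.
have [t [sg [/andP[t0 t1] [->|->] _]]] := polar_exists z0; rewrite z1 !mul1r => h1 h2.
  by exists t; [apply/andP; split; lra|apply: complex_eqP].
have e2 : 2 * pi = pi *+ 2 by rewrite mulr_natl.
exists (2 * pi - t); first by apply/andP; split; lra.
move: h1 h2; rewrite !mulN1r => h1 h2; apply: complex_eqP => /=.
  by rewrite h1 addrC e2 cosD2pi.
by rewrite h2 addrC e2 sinD2pi.
Qed.

Lemma cos_eq1 y : `|y| < 2 * pi -> cos y = 1 -> y = 0.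
Proof.
have pi0 := pi_gt0 R.
wlog y0 : y / 0 <= y => [W|].
  have [y0|y0] := leP 0 y; first exact: W.
  move=> h c; apply/eqP; rewrite -oppr_eq0; apply/eqP; apply: W; rewrite ?normrN ?cosN//; lra.
rewrite ger0_norm// => y2 c.
have [yp|yp] := leP y pi.
  by apply: cos_inj; rewrite ?in_itv/= ?cos0//; apply/andP; split; lra.
exfalso; have : 2 * pi - y = 0.
  apply: cos_inj; rewrite ?in_itv/= ?cos0//; try (apply/andP; split; lra).
  have e2 : 2 * pi = pi *+ 2 by rewrite mulr_natl.
  by rewrite addrC e2 cosD2pi cosN.
lra.
Qed.

(** Where [|F t - F x| >= e], compactness keeps [1 - cos (x - t)] away from 0. The hypothesis on
    points with [cos (x - t) = 1] concerns the ends of the period: it holds for functions coming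
    from the circle, and for any [F] when [[a, b]] lies strictly inside the period. *)
Lemma korovkin_const F (a b e : R) : continuous F -> 0 < e ->
  (forall x t, a <= x <= b -> 0 <= t <= 2 * pi -> cos (x - t) = 1 -> F t = F x) ->
  exists2 C : R, 0 <= C & forall x t, a <= x <= b -> 0 <= t <= 2 * pi ->
    `|F t - F x| <= e + C * (1 - cos (x - t)).
Proof.
move=> Fc e0 Hper.
pose Dx : set (R * R) := `[a, b]%classic `*` `[0, 2 * pi]%classic.
have cD : compact Dx by apply: compact_setX; exact: segment_compact.
have cF1 (y : R * R) : {for y, continuous (fun y : R * R => F y.1)}.
  by apply: cont_comp; [exact: Fc|exact: cont_fst].
have cF2 (y : R * R) : {for y, continuous (fun y : R * R => F y.2)}.
  by apply: cont_comp; [exact: Fc|exact: cont_snd].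
have cdiff (y : R * R) : {for y, continuous (fun y : R * R => `|F y.2 - F y.1|)}.
  by apply: cont_norm; apply: contD => //; exact: contN.
pose S := Dx `&` [set y : R * R | e <= `|F y.2 - F y.1|].
have cS : compact S.
  have cl : closed [set y : R * R | e <= `|F y.2 - F y.1|].
    apply: (@preimage_closed _ _ (fun y : R * R => `|F y.2 - F y.1|) [set r | e <= r]).
      by move=> y _; exact: cdiff.
    exact: closed_ge.
  have cl1 : closed Dx by apply: compact_closed => //; exact: norm_hausdorff.
  by apply: (subclosed_compact (closedI cl1 cl) cD) => y [].
have ccos (y : R * R) : {for y, continuous (fun y : R * R => 1 - cos (y.1 - y.2))}.
  by cont_auto.
have [[y0 Sy0]|S0] := pselect (S !=set0); last first.
  exists 0 => // x t hx ht; rewrite mul0r addr0 leNgt; apply/negP => h; apply: S0.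
  by exists (x, t); split; [split; rewrite /= in_itv|exact: ltW].
have [|m mS Hm] := compact_EVT_min _ cS (within_cont_set (fun y _ => ccos y)).
  by exists y0.
have [|M MS HM] := compact_EVT_max _ cS (within_cont_set (fun y _ => cdiff y)).
  by exists y0.
move: mS; rewrite inE => -[[/=]]; rewrite !in_itv/= => m1 m2 m3.
have mu0 : 0 < 1 - cos (m.1 - m.2).
  rewrite lt_neqAle subr_ge0 cos_le1 andbT eq_sym subr_eq0 eq_sym.
  apply/eqP => h; move: m3; rewrite (Hper _ _ m1 m2 h) subrr normr0; lra.
exists (`|F M.2 - F M.1| / (1 - cos (m.1 - m.2))); first by rewrite divr_ge0// ltW.
move=> x t hx ht; have [h|/ltW h] := leP e `|F t - F x|; last first.
  by apply: le_trans h _; rewrite lerDl mulr_ge0 ?divr_ge0 ?subr_ge0 ?cos_le1 ?(ltW mu0).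
have Sxt : (x, t) \in S by rewrite inE; split; [split; rewrite /= in_itv|].
apply: le_trans (HM _ Sxt) _; rewrite -mulrA.
have := Hm _ Sxt => /= h1.
apply: (@le_trans _ _ (`|F M.2 - F M.1| * 1)); first by rewrite mulr1.
apply: le_trans (_ : `|F M.2 - F M.1| * ((1 - cos (m.1 - m.2))^-1 * (1 - cos (x - t))) <= _).
  by apply: ler_wpM2l => //; rewrite mulrC ler_pdivlMr// mul1r.
by rewrite lerDr ltW.
Qed.

(** The real part on the circle is the Fejer mean of [F], so the real part on the disc is a harmonic
    function with nearly the boundary values [F]; at 0 it is the mean of [F]. *)
Definition fejer_poly M F : {poly R[i]} := \sum_(i < M) \sum_(j < M)
  (((2 * pi * M%:R)^-1 * per_int (fun t => F t * cos ((ndist i j)%:R * t))) +i*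
   (- ((2 * pi * M%:R)^-1 * per_int (fun t => F t * sin ((ndist i j)%:R * t))))) *: 'X^(ndist i j).

Lemma Re_sum (I : Type) (s : seq I) (P : pred I) (h : I -> R[i]) :
  complex.Re (\sum_(i <- s | P i) h i) = \sum_(i <- s | P i) complex.Re (h i).
Proof.
elim: s => [|i s ih]; first by rewrite !big_nil.
by rewrite !big_cons; case: (P i); rewrite ?Re_add ih.
Qed.

Lemma fejer_polyE M F x : intg F -> complex.Re (fejer_poly M F).[expi x] = fejer M F x.
Proof.
move=> hF; rewrite fejerE// /fejer_poly horner_sum Re_sum big_distrr /=.
apply: eq_bigr => i _; rewrite horner_sum Re_sum big_distrr /=.
apply: eq_bigr => j _; rewrite hornerZ hornerXn expiX Re_mul /=.
by ring.
Qed.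

Lemma fejer_poly0 M F : (0 < M)%N -> complex.Re (fejer_poly M F).[0] = (2 * pi)^-1 * per_int F.
Proof.
move=> M0; rewrite /fejer_poly horner_sum Re_sum.
rewrite (eq_bigr (fun i : 'I_M => \sum_(j < M) (ndist i j == 0%N)%:R * ((2 * pi * M%:R)^-1 * per_int F))).
  have E (q m i : R) : 0 < q -> 0 < m -> m * ((2 * q * m)^-1 * i) = (2 * q)^-1 * i.
    by move=> q0 m0; field; rewrite !gt_eqF.
  by rewrite diag_sum E ?pi_gt0 ?ltr0n.
move=> i _; rewrite horner_sum Re_sum; apply: eq_bigr => j _.
rewrite hornerZ hornerXn Re_mul; case: eqVneq => [->|n0].
  rewrite expr0 /= mulr1 mulr0 subr0 mul1r; congr (_ * per_int _).
  by apply/funext => t; rewrite mul0r cos0 mulr1.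
by rewrite expr0n (negbTE n0) /= !mulr0 subr0 mul0r.
Qed.

Lemma cont2_circle u : cont2 u -> continuous (fun t => u (expi t)).
Proof.
move=> uc t.
apply: (@continuous_comp _ _ _ (fun t : R => (cos t, sin t)) (fun y : R * R => u (y.1 +i* y.2))).
  exact: (cvg_pair (@continuous_cos R t) (@continuous_sin R t)).
exact: uc.
Qed.

Lemma expi_period t : cos t = 1 -> expi t = 1.
Proof. by move=> c; rewrite /expi c cos1sin0// c normr1. Qed.

(** [max_principle], with [Q] itself as the exceptional polynomial, is applied to [hom_fun k W] of
    [Q] minus the real part of [fejer_poly] minus [e / (4 pi)]. This is nonpositive on the circle
    once the Fejer mean is within [e / (4 pi)] of [F], and at 0 it is minus the mean of [F] minus
    [e / (4 pi)]. *)
Theorem hom_fun_mean_ge0 k W Q : 0 < k -> continuous W -> (forall t, `|W t| <= 1) ->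
  trig_support k W -> Q.[0] = 0 ->
  0 <= per_int (fun t => hom_fun k W Q.[expi t]).
Proof.
move=> k0 Wc W1 WS Q0; have pi0 := pi_gt0 R.
have uc : cont2 (fun z => hom_fun k W Q.[z]).
  by apply: (@cont2_comp_poly R (hom_fun k W) Q); exact: cont2_hom_fun.
pose F t := hom_fun k W Q.[expi t].
have Fc : continuous F by exact: (cont2_circle uc).
have hF : intg F by exact: intg_cont.
have [Qz|Qn0] := eqVneq Q 0.
  apply: per_int_ge0 => t _; rewrite Qz horner0 hom_fun0//.
have Hper x t : 0 <= x <= 2 * pi -> 0 <= t <= 2 * pi -> cos (x - t) = 1 -> F t = F x.
  move=> _ _ c; rewrite /F; congr (hom_fun k W Q.[_]).
  by rewrite -[x in RHS](subrK t) expiD (expi_period c) mul1r.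
apply/ler_addgt0Pl => e e0.
have e4 : 0 < e / (8 * pi) by rewrite divr_gt0// mulr_gt0.
have [C C0 HC] := korovkin_const Fc e4 Hper.
have [M M0 HM] : exists2 M, (0 < M)%N & 2 * C / M%:R <= e / (8 * pi).
  have x0 : 0 <= 2 * C / (e / (8 * pi)) by apply: divr_ge0; [exact: mulr_ge0|exact: ltW].
  exists (Num.truncn (2 * C / (e / (8 * pi)))).+1 => //.
  rewrite ler_pdivrMr ?ltr0n// [leRHS]mulrC -ler_pdivrMr//.
  exact: ltW (truncnS_gt _).
pose u z := hom_fun k W Q.[z] + - complex.Re (fejer_poly M F).[z] + - (e / (4 * pi)).
have := @max_principle R u Q.
have -> : u 0 = - ((2 * pi)^-1 * per_int F) - e / (4 * pi).
  by rewrite /u Q0 hom_fun0// add0r fejer_poly0.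
move=> H; have : - ((2 * pi)^-1 * per_int F) - e / (4 * pi) <= 0.
  apply: H => //.
  - move=> x; rewrite /u; apply: contD; last exact: cont_cst.
    apply: contD; first exact: uc.
    by apply: contN; have [] := cont2_poly (fejer_poly M F); move=> h _; exact: h.
  - move=> z z1 Qz; apply: four_subD.
      apply: four_subD.
        by apply: (four_sub_comp (v := hom_fun k W)); exact: local2_hom_fun.
      by apply: (four_sub_comp (v := fun z => - complex.Re z)); exact: local2_Re.
    move=> eta eta0; exists 1 => // rho _.
    have := mulr_ge0 (ltW eta0) (sqr_ge0 rho); move: (eta * rho ^+ 2) (e / (4 * pi)).
    by clear => a b a0; lra.
  - move=> z /circle_param[x hx ->]; rewrite /u fejer_polyE//.
    have := fejer_korovkin M0 hF C0 (fun t ht => HC x t hx ht).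
    rewrite ler_norml => /andP[h _].
    have e8 (q : R) : 0 < q -> e / (4 * q) = e / (8 * q) + e / (8 * q).
      by move=> q0; field; rewrite gt_eqF.
    rewrite -/(F x) (e8 _ pi0); move: h HM.
    move: (F x) (fejer M F x) (e / (8 * pi)) (2 * C / M%:R); clear => a b c d; lra.
have -> : - ((2 * pi)^-1 * per_int F) - e / (4 * pi) = - ((2 * pi)^-1 * (e / 2 + per_int F)).
  have E (q i : R) : 0 < q -> - ((2 * q)^-1 * i) - e / (4 * q) = - ((2 * q)^-1 * (e / 2 + i)).
    by move=> q0; field; rewrite gt_eqF.
  exact: E.
rewrite oppr_le0 pmulr_rge0 ?invr_gt0 ?mulr_gt0//; rewrite -/F; lra.
Qed.

End SubharmonicMean.

(** * The pointwise majorants in both ranges of [p] *)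

Section Majorant.
Context {R : realType}.
Notation pi := (@pi R).
Implicit Types (k p s t : R) (z w : R[i]).

Lemma acos_cos_fold t :
  (- pi <= t <= 0 -> acos (cos t) = - t) /\
  (0 <= t <= pi -> acos (cos t) = t) /\
  (pi <= t <= 2 * pi -> acos (cos t) = 2 * pi - t).
Proof.
have e2 : 2 * pi = pi *+ 2 by rewrite mulr_natl.
split=> [/andP[h1 h2]|]; last split=> /andP[h1 h2].
- by rewrite -cosN cosK// in_itv/=; apply/andP; split; lra.
- by rewrite cosK// in_itv/=; apply/andP; split; lra.
- have -> : cos t = cos (2 * pi - t) by rewrite addrC e2 cosD2pi cosN.
  by rewrite cosK// in_itv/=; apply/andP; split; lra.
Qed.

Lemma cos_gap k t : cos (k * (2 * pi - t)) - cos (k * t) = 2 * (sin (k * pi) * sin (k * (t - pi))).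
Proof.
have -> : k * (2 * pi - t) = k * pi - k * (t - pi) by ring.
have -> : k * t = k * pi + k * (t - pi) by ring.
by rewrite cosB cosD; ring.
Qed.

(** The cosine is its own minorant until the angle passes [pi]. Beyond, folding yields the angle
    [2 pi - t], and [cos_gap] shows the folded value to be the larger one, because [sin (k pi) >= 0]
    for [k <= 1]. *)
Lemma trig_support_cos k : 0 <= k <= 1 -> trig_support k (fun t => cos (k * t)).
Proof.
move=> /andP[k0 k1] t0 /andP[h0 h1]; have pi0 := pi_gt0 R.
exists (k * t0), pi; split => // y; rewrite ltr_norml => /andP[y1 y2].
rewrite -mulrDr [y + _]addrC; have [f1 [f2 f3]] := acos_cos_fold (t0 + y).
have [c1|c1] := leP (t0 + y) 0.
  by rewrite f1 ?mulrN ?cosN//; apply/andP; split; lra.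
have [c2|c2] := leP (t0 + y) pi.
  by rewrite f2//; apply/andP; split; lra.
rewrite f3; last by apply/andP; split; lra.
rewrite -subr_ge0 cos_gap mulr_ge0// mulr_ge0//.
  apply: sin_ge0_pi; rewrite mulr_ge0 ?(ltW pi0)//=.
  by rewrite -[leRHS]mul1r ler_wpM2r// ltW.
apply: sin_ge0_pi; rewrite mulr_ge0//=; last by lra.
apply: (@le_trans _ _ (1 * (t0 + y - pi))); last by lra.
by rewrite ler_wpM2r//; lra.
Qed.

Lemma trig_support_Ncos_min k : 1 <= k -> trig_support k (fun t => - cos (Num.min (k * t) pi)).
Proof.
move=> k1 t0 /andP[h0 h1]; have pi0 := pi_gt0 R.
have k0 : 0 < k by lra.
have minE a : a <= pi -> Num.min a pi = a by move=> h; apply/min_idPl.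
have minE' a : pi <= a -> Num.min a pi = pi by move=> h; apply/min_idPr.
have cpi a : cos (a + pi) = - cos a by rewrite cosDpi.
have [c|c] := boolP (k * t0 <= pi); last first.
  rewrite -ltNge in c; have c' : pi / k < t0 by rewrite ltr_pdivrMr// mulrC.
  exists 0, (t0 - pi / k); split; first by lra.
    by rewrite minE' ?cospi ?opprK ?cos0// ltW.
  move=> y; rewrite ltr_norml => /andP[y1 y2].
  rewrite minE' ?cospi ?opprK ?cos_le1//.
  rewrite -ler_pdivrMl// mulrC; have [f1 [f2 f3]] := acos_cos_fold (t0 + y).
  have pk0 : 0 < pi / k by rewrite divr_gt0.
  have [c2|c2] := leP (t0 + y) pi.
    by rewrite f2; [lra|apply/andP; split; lra].
  by rewrite f3; [lra|apply/andP; split; lra].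
have [e1|n1] := eqVneq k 1.
  exists (k * t0 + pi), pi; split => //; first by rewrite minE// cpi.
  move=> y _; rewrite addrA cpi e1 !mul1r minE ?acos_lepi ?cos_geN1 ?cos_le1//.
  by rewrite acosK ?in_itv/= ?cos_geN1 ?cos_le1// addrC.
have k1' : 1 < k by rewrite lt_neqAle eq_sym n1.
have c' : t0 <= pi / k by rewrite ler_pdivlMr// mulrC.
have d0 : pi / k < pi by rewrite ltr_pdivrMr// ltr_pMr.
exists (k * t0 + pi), (pi - pi / k); split; [lra|by rewrite minE// cpi|].
have pk0 : 0 < pi / k by rewrite divr_gt0.
move=> y; rewrite ltr_norml => /andP[y1 y2].
rewrite addrA cpi lerN2 -mulrDr [y + _]addrC; have [f1 [f2 f3]] := acos_cos_fold (t0 + y).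
have -> : cos (k * (t0 + y)) = cos (k * acos (cos (t0 + y))).
  have [c1|c1] := leP (t0 + y) 0.
    by rewrite f1 ?mulrN ?cosN//; apply/andP; split; lra.
  by rewrite f2//; apply/andP; split; lra.
have [hk|hk] := boolP (k * acos (cos (t0 + y)) <= pi); first by rewrite minE.
by rewrite minE' ?cospi ?cos_geN1// ltW// ltNge.
Qed.

Lemma normc_conj z : normc z^* = normc z.
Proof. by case: z => a b /=; rewrite sqrrN. Qed.

Lemma sqr_normc_add_conj z w :
  normc (z + w^*) ^+ 2 = normc z ^+ 2 + normc w ^+ 2 + 2 * complex.Re (z * w).
Proof. by rewrite !sqr_normc_Re_Im; case: z => a b; case: w => c d /=; ring. Qed.

(** All that the passage to L^p takes from the two ranges of [p]: a pointwise inequality with a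
    correction whose mean over the circle is nonnegative. The constant [e] will be the sign in front
    of the product. *)
Definition riesz_majorant p s C := exists (k : R) W T (e : R[i]),
  [/\ 0 < k, continuous W, forall t, `|W t| <= 1, trig_support k W &
   0 <= T /\ forall z w,
   ((normc z `^ s + normc w `^ s) `^ s^-1) `^ p + T * hom_fun k W (e * (z * w))
     <= (C * normc (z + w^*)) `^ p].

(** Here [C] stands for the cosine or sine of [pi / (2 p)]. The pointwise inequalities bound means
    of order [s0]; [power_mean_exp_le] lowers the order to [s], and the factor [2 ^ (p / s)] turns
    the mean into the sum. *)
Lemma powR_sum_root p s s0 C (r q N X Y : R) : 1 < p -> 0 < s -> s <= s0 -> 0 < C ->
  0 <= r -> 0 <= q -> 0 <= N ->
  ((r `^ s0 + q `^ s0) / 2) `^ (p / s0) + X <= (N ^+ 2 / (4 * C ^+ 2)) `^ (p / 2) ->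
  ((r `^ s + q `^ s) `^ s^-1) `^ p + 2 `^ (p / s) * X <= (2 `^ s^-1 / (2 * C) * N) `^ p.
Proof.
move=> p1 s0' ss C0 r0 q0 N0 H; have p0 : 0 < p by lra.
have h := power_mean_exp_le p0 s0' ss r0 q0.
have S0 : 0 <= r `^ s + q `^ s by rewrite addr_ge0// powR_ge0.
have e1 : ((r `^ s + q `^ s) `^ s^-1) `^ p = 2 `^ (p / s) * ((r `^ s + q `^ s) / 2) `^ (p / s).
  rewrite -powRrM -powRM//; last by rewrite divr_ge0.
  by rewrite mulrCA divff ?mulr1 1?mulrC// pnatr_eq0.
have e2 : (2 `^ s^-1 / (2 * C) * N) `^ p = 2 `^ (p / s) * (N ^+ 2 / (4 * C ^+ 2)) `^ (p / 2).
  have -> : N ^+ 2 / (4 * C ^+ 2) = (N / (2 * C)) ^+ 2 by field; rewrite gt_eqF.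
  have NC : 0 <= N / (2 * C) by rewrite divr_ge0// mulr_ge0// ltW.
  rewrite (sqr_powR_half _ NC) -mulrA [_^-1 * N]mulrC powRM ?powR_ge0//.
  by rewrite -powRrM [s^-1 * p]mulrC.
rewrite e1 e2 -mulrDr; apply: (ler_wpM2l (powR_ge0 _ _)).
by apply: le_trans H; rewrite lerD2r.
Qed.

Lemma half_angle z : exists2 u, 0 <= u <= pi / 2 &
  acos (complex.Re z / normc z) = 2 * u /\ normc z * cos (2 * u) = complex.Re z.
Proof.
have /andP[h1 h2] := cos_direction_itv z.
exists (acos (complex.Re z / normc z) / 2).
  have h3 := acos_ge0 (introT andP (conj h1 h2)).
  have h4 := acos_lepi (introT andP (conj h1 h2)).
  by apply/andP; split; lra.
rewrite [2 * _]mulrC divfK ?pnatr_eq0//; split => //.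
rewrite acosK ?in_itv/= ?h1//.
have [->|z0] := eqVneq z 0; first by rewrite normc0 mul0r.
by rewrite mulrC divfK// gt_eqF// normc_gt0.
Qed.

Lemma riesz_majorant_lt2 p s s0 : 1 < p -> p < 2 -> 0 < s -> s <= s0 -> two_or_four p s0 ->
  riesz_majorant p s (2 `^ s^-1 / (2 * cos (pi / (2 * p)))).
Proof.
move=> p1 p2 s1 ss hs0; have pi0 := pi_gt0 R; have p0 : 0 < p by lra.
set g := pi / (2 * p).
have pg : p * g = pi / 2 by rewrite /g; field; rewrite gt_eqF.
have g0 : 0 < g by rewrite /g divr_gt0// mulr_gt0.
have g1 : g < pi / 2 by rewrite -pg ltr_pMl.
have cg : 0 < cos g by apply: cos_gt0_pihalf; apply/andP; split; lra.
have tg : 0 <= tan g.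
  rewrite /tan divr_ge0 ?(ltW cg)//; apply: sin_ge0_pi; apply/andP; split; lra.
exists (p / 2), (fun t => cos (p / 2 * t)), (2 `^ (p / s) * tan g), 1; split.
- lra.
- exact: continuous_cosM.
- by move=> t; rewrite ler_norml cos_geN1 cos_le1.
- by apply: trig_support_cos; apply/andP; split; lra.
split; first by rewrite mulr_ge0 ?powR_ge0.
move=> z w; rewrite -mulrA.
apply: powR_sum_root ss cg _ _ _ _ => //; rewrite ?normc_ge0//.
have [u hu [uE uR]] := half_angle (z * w).
have := ptw_lt2 p1 p2 pg hs0 (normc_ge0 z) (normc_ge0 w) hu.
rewrite /hom_fun mul1r uE sqr_normc_add_conj -uR !normcM.
rewrite (_ : p / 2 * (2 * u) = p * u); last by field.
by rewrite -[2 * (normc z * normc w) * cos _]mulrA.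
Qed.

(** The angle [2 u] is that of [- z w], hence [e = -1]: then [|z + conj w|^2] contains
    [- 2 r q cos (2 u)], as in [ptw_ge2]. *)
Lemma riesz_majorant_ge2 p s : 2 <= p -> 0 < s -> s <= p ->
  riesz_majorant p s (2 `^ s^-1 / (2 * sin (pi / (2 * p)))).
Proof.
move=> p2 s1 ss; have pi0 := pi_gt0 R; have p0 : 0 < p by lra.
set g := pi / (2 * p).
have pg : p * g = pi / 2 by rewrite /g; field; rewrite gt_eqF.
have g0 : 0 < g by rewrite /g divr_gt0// mulr_gt0.
have g1 : g < pi / 2 by rewrite -pg ltr_pMl//; lra.
have cg : 0 < cos g by apply: cos_gt0_pihalf; apply/andP; split; lra.
have sg : 0 < sin g by apply: sin_gt0_pi; apply/andP; split; lra.
exists (p / 2), (fun t => - cos (Num.min (p / 2 * t) pi)), (2 `^ (p / s) * (cos g / sin g)), (-1); split.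
- lra.
- move=> t; apply: contN; apply: cont_cos; apply: cont_min; last exact: cont_cst.
  by apply: contM; [exact: cont_cst|exact: cont_id].
- by move=> t; rewrite normrN ler_norml cos_geN1 cos_le1.
- by apply: trig_support_Ncos_min; lra.
split; first by rewrite mulr_ge0 ?powR_ge0// divr_ge0// ltW.
move=> z w; rewrite -mulrA.
apply: powR_sum_root ss sg _ _ _ _ => //; rewrite ?normc_ge0//; first lra.
have [u hu [uE uR]] := half_angle (-1 * (z * w)).
have := ptw_ge2 p2 pg (normc_ge0 z) (normc_ge0 w) hu.
have e1 : complex.Re (z * w) = - (normc z * normc w * cos (2 * u)).
  by move: uR; rewrite mulN1r normc_opp Re_opp -normcM => ->; rewrite opprK.
rewrite /hom_fun uE sqr_normc_add_conj e1 mulN1r normc_opp !normcM.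
rewrite (_ : p / 2 * (2 * u) = p * u); last by field.
rewrite divff ?gt_eqF// powRr1; last by rewrite divr_ge0// addr_ge0// powR_ge0.
by rewrite !mulrN -[2 * (normc z * normc w) * cos _]mulrA.
Qed.

(** The pair [z = 1], [w = 0] makes the correction vanish. The bound serves the case of
    [riesz_upper] in which [riesz_plus] takes its default value. *)
Lemma riesz_majorant_ge1 p s C : 1 < p -> 0 < s -> 0 <= C -> riesz_majorant p s C -> 1 <= C.
Proof.
move=> p1 s0 C0 [k [W [T [e [k0 _ _ _ [_ /(_ 1 0)]]]]]].
rewrite !mulr0 hom_fun0// mulr0 addr0 normc0 normc1 powR0 ?gt_eqF// addr0 !powR1.
have -> : normc (1 + (0 : R[i])^*) = 1 by rewrite /= oppr0 !addr0 expr1n expr0n addr0 sqrtr1.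
rewrite mulr1 => h; rewrite leNgt; apply/negP => C1.
have h1 : C `^ p < 1 `^ p by apply: gt0_ltr_powR; rewrite ?nnegrE//; lra.
by move: h1; rewrite powR1 ltNge h.
Qed.

End Majorant.

(** * Trigonometric polynomials *)

Section PolynomialInequality.
Context {R : realType}.
Notation pi := (@pi R).
Implicit Types (p s t x y C : R) (z w : R[i]) (F G H : R -> R[i]) (P Q : {poly R[i]}) (M : nat).

Definition mixed_norm p s z w := ((normc z `^ s + normc w `^ s) `^ s^-1) `^ p.

Lemma mixed_norm_ge0 p s z w : 0 <= mixed_norm p s z w.
Proof. exact: powR_ge0. Qed.

Lemma cont_normc_powR (T : topologicalType) (u : T -> R[i]) p (x : T) : 0 < p ->
  {for x, continuous (fun a => normc (u a))} ->
  {for x, continuous (fun a => normc (u a) `^ p)}.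
Proof.
move=> p0 uc; apply: (contE (f := fun a => `|normc (u a)| `^ p)).
  by apply/funext => t; rewrite ger0_norm ?normc_ge0.
exact: cont_norm_powR.
Qed.

Lemma cont_mixed_norm (T : topologicalType) (u v : T -> R[i]) p s (x : T) : 0 < p -> 0 < s ->
  {for x, continuous (fun a => normc (u a))} -> {for x, continuous (fun a => normc (v a))} ->
  {for x, continuous (fun a => mixed_norm p s (u a) (v a))}.
Proof.
move=> p0 s0 uc vc.
apply: (contE (f := fun a => `| `|normc (u a) `^ s + normc (v a) `^ s| `^ s^-1| `^ p)).
  apply/funext => a.
  have S0 := addr_ge0 (powR_ge0 (normc (u a)) s) (powR_ge0 (normc (v a)) s).
  by rewrite /mixed_norm (ger0_norm S0) (ger0_norm (powR_ge0 _ _)).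
apply: cont_norm_powR => //; apply: cont_norm_powR; first by rewrite invr_gt0.
by apply: contD; exact: cont_normc_powR.
Qed.

Lemma continuous_normc_poly P : continuous (fun t : R => normc P.[expi t]).
Proof.
apply: (@cont2_circle R (fun z => normc P.[z])).
by apply: (@cont2_comp_poly R (@normc R)); exact: cont2_normc.
Qed.

Lemma continuous_normc_add_conj P Q :
  continuous (fun t : R => normc (P.[expi t] + Q.[expi t]^*)).
Proof.
move=> t; apply: (contE (f := fun t => Num.sqrt (normc P.[expi t] ^+ 2 + normc Q.[expi t] ^+ 2
    + 2 * complex.Re (P * Q).[expi t]))).
  apply/funext => x; rewrite hornerM -sqr_normc_add_conj sqrtr_sqr ger0_norm//; exact: normc_ge0.
apply: cont_sqrt; apply: contD; first by apply: contD; apply: contX; exact: continuous_normc_poly.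
apply: contM; first exact: cont_cst.
by apply: (@cont2_circle R (fun z => complex.Re (P * Q).[z])); have [] := cont2_poly (P * Q).
Qed.

Theorem riesz_poly p s C P Q : 1 < p -> 0 < s -> 0 <= C -> riesz_majorant p s C -> Q.[0] = 0 ->
  per_int (fun t => mixed_norm p s P.[expi t] Q.[expi t])
    <= C `^ p * per_int (fun t => normc (P.[expi t] + Q.[expi t]^*) `^ p).
Proof.
move=> p1 s0 C0 [k [W [T [e [k0 Wc W1 WS [T0 H]]]]]] Q0; have p0 : 0 < p by lra.
pose L := e%:P * (P * Q).
have LE z : L.[z] = e * (P.[z] * Q.[z]) by rewrite /L !hornerM hornerC.
have L0 : L.[0] = 0 by rewrite LE Q0 !mulr0.
have h1 := hom_fun_mean_ge0 k0 Wc W1 WS L0.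
have i1 : intg (fun t => mixed_norm p s P.[expi t] Q.[expi t]).
  by apply: intg_cont => t; apply: cont_mixed_norm => //; exact: continuous_normc_poly.
have i2 : intg (fun t => hom_fun k W L.[expi t]).
  apply: intg_cont; apply: (@cont2_circle R (fun z => hom_fun k W L.[z])).
  by apply: (@cont2_comp_poly R (hom_fun k W)); exact: cont2_hom_fun.
have i3 : intg (fun t => normc (P.[expi t] + Q.[expi t]^*) `^ p).
  apply: intg_cont => t.
  exact: (@cont_normc_powR _ (fun t : R => P.[expi t] + Q.[expi t]^*) p t p0 (@continuous_normc_add_conj P Q t)).
rewrite -(per_intZ _ i3).
apply: (@le_trans _ _ (per_int (fun t => mixed_norm p s P.[expi t] Q.[expi t] + T * hom_fun k W L.[expi t]))).
  by rewrite (per_intD i1 (intgZ T i2)) (per_intZ _ i2) lerDl mulr_ge0.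
apply: per_int_le; [by apply: intgD => //; exact: intgZ|exact: intgZ|move=> t _].
by rewrite -powRM// ?normc_ge0// LE; exact: H.
Qed.

End PolynomialInequality.

(** * Fejer means of analytic and coanalytic functions *)

Section ComplexFejer.
Context {R : realType}.
Notation pi := (@pi R).
Implicit Types (p s t x y C : R) (z w : R[i]) (F G H : R -> R[i]) (P Q : {poly R[i]}) (M : nat).

Definition cintg F := intg (fun t => complex.Re (F t)) /\ intg (fun t => complex.Im (F t)).

Lemma period_integralE F : period_integral F =
  per_int (fun t => complex.Re (F t)) +i* per_int (fun t => complex.Im (F t)).
Proof. by []. Qed.

Lemma cintgD F G : cintg F -> cintg G -> cintg (fun t => F t + G t).
Proof.
move=> [h1 h2] [h3 h4]; split.
  rewrite (_ : (fun t => _) = fun t => complex.Re (F t) + complex.Re (G t)); first exact: intgD.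
  by apply/funext => t; rewrite Re_add.
rewrite (_ : (fun t => _) = fun t => complex.Im (F t) + complex.Im (G t)); first exact: intgD.
by apply/funext => t; rewrite Im_add.
Qed.

Lemma cintgN F : cintg F -> cintg (fun t => - F t).
Proof.
move=> [h1 h2]; split.
  rewrite (_ : (fun t => _) = fun t => - complex.Re (F t)); first exact: intgN.
  by apply/funext => t; rewrite Re_opp.
rewrite (_ : (fun t => _) = fun t => - complex.Im (F t)); first exact: intgN.
by apply/funext => t; rewrite Im_opp.
Qed.

Lemma cintg_mul F G : cintg F -> continuous (fun t => complex.Re (G t)) ->
  continuous (fun t => complex.Im (G t)) -> cintg (fun t => F t * G t).
Proof.
move=> [h1 h2] cR cI; split.
  rewrite (_ : (fun t => _) = fun t => complex.Re (F t) * complex.Re (G t) -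
     complex.Im (F t) * complex.Im (G t)).
    by apply: intgB; exact: intg_mul_cont.
  by apply/funext => t; rewrite Re_mul.
rewrite (_ : (fun t => _) = fun t => complex.Re (F t) * complex.Im (G t) +
     complex.Im (F t) * complex.Re (G t)).
  by apply: intgD; exact: intg_mul_cont.
by apply/funext => t; rewrite Im_mul.
Qed.

Lemma cintg_mulc F z : cintg F -> cintg (fun t => F t * z).
Proof. by move=> hF; apply: cintg_mul => // t; exact: cst_continuous. Qed.

Lemma cintg_expi F (m : R) : cintg F -> cintg (fun t => F t * expi (- (m * t))).
Proof.
move=> hF; apply: cintg_mul => //=.
  move=> t; apply: (contE (f := fun t => cos (m * t))); last exact: continuous_cosM.
  by apply/funext => x; rewrite cosN.
move=> t; apply: (contE (f := fun t => - sin (m * t))).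
  by apply/funext => x; rewrite sinN.
by apply: contN; exact: continuous_sinM.
Qed.

Lemma period_integralD F G : cintg F -> cintg G ->
  period_integral (fun t => F t + G t) = period_integral F + period_integral G.
Proof.
move=> [h1 h2] [h3 h4]; rewrite !period_integralE; apply: complex_eqP => /=.
  by rewrite -(per_intD h1 h3); congr per_int; apply/funext => t; rewrite Re_add.
by rewrite -(per_intD h2 h4); congr per_int; apply/funext => t; rewrite Im_add.
Qed.

Lemma period_integralZ F z : cintg F ->
  period_integral (fun t => F t * z) = period_integral F * z.
Proof.
case: z => a b [h1 h2]; rewrite !period_integralE; apply: complex_eqP => /=.
  rewrite [RHS]/= mulrC [_ * b]mulrC -(per_intZ a h1) -(per_intZ b h2).
  rewrite -(per_intB (intgZ a h1) (intgZ b h2)).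
  by congr per_int; apply/funext => t; rewrite Re_mul /= mulrC [_ * b]mulrC.
rewrite mulrC [_ * a]mulrC -(per_intZ b h1) -(per_intZ a h2).
rewrite -(per_intD (intgZ b h1) (intgZ a h2)).
by congr per_int; apply/funext => t; rewrite Im_mul /= mulrC [_ * a]mulrC.
Qed.

Lemma cintg0 : cintg (fun=> 0).
Proof. by split; exact: intg_cst. Qed.

Lemma period_integral_sum (I : Type) (r : seq I) (h : I -> R -> R[i]) :
  (forall i, cintg (h i)) ->
  cintg (fun t => \sum_(i <- r) h i t) /\
  period_integral (fun t => \sum_(i <- r) h i t) = \sum_(i <- r) period_integral (h i).
Proof.
move=> hi; elim: r => [|i r [ih1 ih2]].
  rewrite big_nil (_ : (fun t => _) = fun=> 0); last by apply/funext => t; rewrite big_nil.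
  split; first exact: cintg0.
  by rewrite period_integralE /= per_int_cst mulr0.
rewrite (_ : (fun t => _) = fun t => h i t + \sum_(j <- r) h j t); last first.
  by apply/funext => t; rewrite big_cons.
by split; [exact: cintgD|rewrite period_integralD// ih2 big_cons].
Qed.

Definition fourier F (n : int) : R[i] :=
  ((2 * pi)^-1)%:C * period_integral (fun t => F t * expi (- (n%:~R * t))).

Lemma fourierD F G n : cintg F -> cintg G ->
  fourier (fun t => F t + G t) n = fourier F n + fourier G n.
Proof.
move=> hF hG; rewrite /fourier -mulrDr -period_integralD; try exact: cintg_expi.
by congr (_ * period_integral _); apply/funext => t; rewrite mulrDl.
Qed.

Definition cfejer M F x : R[i] :=
  fejer M (fun t => complex.Re (F t)) x +i* fejer M (fun t => complex.Im (F t)) x.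

Lemma fker_expi M y : (fker M y)%:C =
  (M%:R^-1)%:C * \sum_(i < M) \sum_(j < M) expi ((i%:Z - j%:Z)%:~R * y).
Proof.
rewrite fkerE.
have -> : \sum_(i < M) \sum_(j < M) expi ((i%:Z - j%:Z)%:~R * y) =
    (\sum_(i < M) expi (i%:R * y)) * (\sum_(i < M) expi (- (i%:R * y))).
  rewrite big_distrlr; apply: eq_bigr => i _; apply: eq_bigr => j _ /=.
  by rewrite -expiD rmorphB /= mulrBl.
have -> : \sum_(i < M) expi (i%:R * y) =
   (\sum_(i < M) cos (i%:R * y)) +i* (\sum_(i < M) sin (i%:R * y)).
  elim/big_rec3: _ => // i a b c _ ->; exact: complex_eqP.
have -> : \sum_(i < M) expi (- (i%:R * y)) =
   (\sum_(i < M) cos (i%:R * y)) -i* (\sum_(i < M) sin (i%:R * y)).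
  elim/big_rec3: _ => [|i a b c _ ->]; first by apply: complex_eqP; rewrite /= ?oppr0.
  by apply: complex_eqP; rewrite /= ?cosN ?sinN// opprD.
by apply: complex_eqP => /=; ring.
Qed.

Lemma cfejerE M F x : cintg F -> cfejer M F x =
  (M%:R^-1)%:C * \sum_(i < M) \sum_(j < M)
     fourier F (i%:Z - j%:Z) * expi ((i%:Z - j%:Z)%:~R * x).
Proof.
move=> hF; have -> : cfejer M F x =
    ((2 * pi)^-1)%:C * period_integral (fun t => F t * (fker M (x - t))%:C).
  rewrite /cfejer /fejer period_integralE; apply: complex_eqP => /=.
    by rewrite mul0r subr0; congr (_ * per_int _); apply/funext => t; rewrite Re_mul /= mulr0 subr0.
  by rewrite mul0r addr0; congr (_ * per_int _); apply/funext => t; rewrite Im_mul /= mulr0 add0r.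
pose h (i j : nat) t := F t * expi (- ((i%:Z - j%:Z)%:~R * t)) * (expi ((i%:Z - j%:Z)%:~R * x) * (M%:R^-1)%:C).
have hi i j : cintg (h i j) by apply: cintg_mulc; exact: cintg_expi.
have -> : (fun t => F t * (fker M (x - t))%:C) = fun t => \sum_(i < M) \sum_(j < M) h i j t.
  apply/funext => t; rewrite fker_expi big_distrr big_distrr /=; apply: eq_bigr => i _.
  rewrite !big_distrr /=; apply: eq_bigr => j _; rewrite /h mulrBr expiD; ring.
have [_ ->] := period_integral_sum (index_enum 'I_M)
  (fun i : 'I_M => (period_integral_sum (index_enum 'I_M) (fun j : 'I_M => hi i j)).1).
rewrite !big_distrr; apply: eq_bigr => i _ /=.
have [_ ->] := period_integral_sum (index_enum 'I_M) (fun j : 'I_M => hi i j).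
rewrite !big_distrr; apply: eq_bigr => j _ /=.
rewrite period_integralZ; last exact: cintg_expi.
by rewrite /fourier; ring.
Qed.

Definition analytic F := cintg F /\ forall n : nat, fourier F (- n.+1%:Z) = 0.
Definition coanalytic F := cintg F /\ forall n : nat, fourier F n%:Z = 0.

Definition fejer_analytic_poly M F : {poly R[i]} := \sum_(i < M) \sum_(j < M)
  if (j <= i)%N then ((M%:R^-1)%:C * fourier F (i - j)%N%:Z) *: 'X^(i - j) else 0.

(** The coefficients are conjugated because the mean of a coanalytic function is written as the
    conjugate of a polynomial. Only frequencies [j - i >= 1] occur, so the polynomial vanishes at 0,
    as [riesz_poly] requires. *)
Definition fejer_coanalytic_poly M F : {poly R[i]} := \sum_(i < M) \sum_(j < M)
  if (j <= i)%N then 0 else ((M%:R^-1)%:C * fourier F (- (j - i)%N%:Z))^* *: 'X^(j - i).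

Lemma fejer_analytic_polyE M F x : analytic F ->
  cfejer M F x = (fejer_analytic_poly M F).[expi x].
Proof.
move=> [hF F0]; rewrite cfejerE// /fejer_analytic_poly horner_sum big_distrr /=.
apply: eq_bigr => i _; rewrite horner_sum big_distrr /=; apply: eq_bigr => j _.
have [ij|ij] := leqP j i.
  by rewrite hornerZ hornerXn expiX mulrA subzn.
rewrite horner0 (_ : i%:Z - j%:Z = - (j - i).-1.+1%:Z) ?F0 ?mul0r ?mulr0//.
by rewrite prednK ?subn_gt0// -subzn ?(ltnW ij)// opprB.
Qed.

Lemma conj_expi x : (expi x)^* = expi (- x).
Proof. by rewrite /expi cosN sinN. Qed.

Lemma fejer_coanalytic_polyE M F x : coanalytic F ->
  cfejer M F x = (fejer_coanalytic_poly M F).[expi x]^*.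
Proof.
move=> [hF F0]; rewrite cfejerE// /fejer_coanalytic_poly horner_sum big_distrr /=.
rewrite rmorph_sum; apply: eq_bigr => i _; rewrite horner_sum big_distrr /=.
rewrite rmorph_sum; apply: eq_bigr => j _ /=.
have [ij|ij] := leqP j i.
  by rewrite horner0 rmorph0 subzn// F0 mul0r mulr0.
have cM (a b : R[i]) : (a * b)^* = a^* * b^*.
  by apply: complex_eqP; case: a => ? ?; case: b => ? ? /=; ring.
have cK (a : R[i]) : (a^*)^* = a by case: a => ? ? /=; rewrite opprK.
rewrite hornerZ hornerXn expiX cM.
set a := _%:C * fourier F (- _).
rewrite -[X in _ = X]/(conjc (conjc a) * conjc (expi _)) cK conj_expi /a mulrA.
by rewrite (_ : i%:Z - j%:Z = - (j - i)%N%:Z) ?mulrNz ?mulNr// -subzn ?(ltnW ij)// opprB.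
Qed.

Lemma fejer_coanalytic_poly0 M F : (fejer_coanalytic_poly M F).[0] = 0.
Proof.
rewrite /fejer_coanalytic_poly horner_sum big1// => i _; rewrite horner_sum big1// => j _.
have [ij|ij] := leqP j i; first by rewrite horner0.
by rewrite hornerZ hornerXn expr0n subn_eq0 leqNgt ij mulr0.
Qed.

Lemma cfejerD M F G x : cintg F -> cintg G ->
  cfejer M (fun t => F t + G t) x = cfejer M F x + cfejer M G x.
Proof.
move=> [h1 h2] [h3 h4]; apply: complex_eqP; rewrite ?Re_add ?Im_add /= -fejerD//.
  by congr (fejer M _ x); apply/funext => t; rewrite Re_add.
by congr (fejer M _ x); apply/funext => t; rewrite Im_add.
Qed.

End ComplexFejer.

(** * Passage to L^p *)

Section FejerConvergence.
Context {R : realType}.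
Notation pi := (@pi R).
Notation mu := (@lebesgue_measure R).
Implicit Types (p s t x y C : R) (z w : R[i]) (f G : R -> R) (F : R -> R[i]) (M : nat).

Lemma intg_le f G : measurable_fun `[0, 2 * pi]%classic f ->
  (forall t, 0 <= t <= 2 * pi -> `|f t| <= G t) -> intg G -> intg f.
Proof.
move=> mf fG; apply: le_integrable; first exact: measurable_itv.
  exact/measurable_EFinP.
move=> t /=; rewrite in_itv /= => ht; rewrite lee_fin; apply: le_trans (fG t ht) _.
exact: ler_norm.
Qed.

Lemma intg_measurable f : intg f -> measurable_fun `[0, 2 * pi]%classic f.
Proof. by move=> /measurable_int /measurable_EFinP. Qed.

Lemma measurable_normc F : cintg F -> measurable_fun `[0, 2 * pi]%classic (fun t => normc (F t)).
Proof.
move=> [/intg_measurable h1 /intg_measurable h2].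
have ms : measurable_fun [set: R] (@Num.sqrt R).
  by apply: continuous_measurable_fun; exact: sqrt_continuous.
rewrite (_ : (fun t => _) = fun t => Num.sqrt (complex.Re (F t) ^+ 2 + complex.Im (F t) ^+ 2)).
  by apply: measurableT_comp => //; apply: measurable_funD; exact: measurable_funX.
by apply/funext => t; case: (F t).
Qed.

Lemma intg_normc F : cintg F -> intg (fun t => normc (F t)).
Proof.
move=> hF; apply: intg_le (measurable_normc hF) _ (intgD (intg_norm hF.1) (intg_norm hF.2)).
by move=> t _; rewrite ger0_norm ?normc_ge0// normc_le_ReIm.
Qed.

Lemma continuous_fejer M f : intg f -> continuous (fejer M f).
Proof.
move=> hf; rewrite (_ : fejer M f = fun x => (2 * pi * M%:R)^-1 * \sum_(i < M) \sum_(j < M)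
   (cos ((ndist i j)%:R * x) * per_int (fun t => f t * cos ((ndist i j)%:R * t)) +
    sin ((ndist i j)%:R * x) * per_int (fun t => f t * sin ((ndist i j)%:R * t)))); last first.
  by apply/funext => x; exact: fejerE.
set S := (fun x => _); move=> x; refine (contM (@cont_cst _ _ _ x) _).
apply: cont_sum => i; apply: cont_sum => j y.
exact: (contD (contM (@continuous_cosM R _ y) (@cont_cst _ _ _ y))
  (contM (@continuous_sinM R _ y) (@cont_cst _ _ _ y))).
Qed.

Lemma normc_cfejer_le M F x : cintg F ->
  normc (cfejer M F x) <= fejer M (fun t => normc (F t)) x.
Proof.
move=> hF; have hn := intg_normc hF; have [h1 h2] := hF.
set z := cfejer M F x; set n := normc z.
have n0 : 0 <= n by exact: normc_ge0.
have f0 : 0 <= fejer M (fun t => normc (F t)) x.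
  rewrite /fejer mulr_ge0 ?invr_ge0 ?(ltW (@pi2_gt0 R))//.
  by apply: per_int_ge0 => t _; rewrite mulr_ge0 ?normc_ge0 ?fker_ge0.
have [n0'|np] := eqVneq n 0; first by rewrite n0'.
have np' : 0 < n by rewrite lt_neqAle eq_sym np.
rewrite -(ler_pM2l np') -(fejerZ M n x hn).
(* The value [z] is tested against itself: [|z|^2] is the Fejer mean of [Re (conj z F)], which is at
   most [|z| |F|]. *)
have -> : n * n = fejer M (fun t => complex.Re z * complex.Re (F t) + complex.Im z * complex.Im (F t)) x.
  rewrite (fejerD M x (intgZ _ h1) (intgZ _ h2)) (fejerZ M _ x h1) (fejerZ M _ x h2).
  by rewrite -[n * n]expr2 sqr_normc_Re_Im !expr2.
apply: fejer_le; [by apply: intgD; exact: intgZ|exact: intgZ|move=> t _].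
have := le_trans (ler_norm _) (abs_Re_le (z^* * F t)).
have cE (w : R[i]) : complex.Re w^* = complex.Re w /\ complex.Im w^* = - complex.Im w by case: w.
by rewrite normcM normc_conj Re_mul (cE z).1 (cE z).2 mulNr opprK.
Qed.

(** Jensen's inequality for averaging with a positive kernel: the tangent of the power at [m], the
    mean of [|F|], is affine in [|F|], and the average reproduces affine expressions. *)
Lemma fejer_jensen M p F x : 1 <= p -> (0 < M)%N -> cintg F -> intg (fun t => normc (F t) `^ p) ->
  normc (cfejer M F x) `^ p <= fejer M (fun t => normc (F t) `^ p) x.
Proof.
move=> p1 M0 hF hp; have hn := intg_normc hF.
set m := fejer M (fun t => normc (F t)) x.
have zm : normc (cfejer M F x) <= m by exact: normc_cfejer_le.
have m0 : 0 <= m by apply: le_trans zm; exact: normc_ge0.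
apply: (@le_trans _ _ (m `^ p)).
  by apply: ge0_ler_powR; rewrite ?nnegrE ?normc_ge0//; lra.
have [m0'|mn] := eqVneq m 0.
  rewrite m0' powR0; last by rewrite gt_eqF//; lra.
  rewrite /fejer mulr_ge0 ?invr_ge0 ?(ltW (@pi2_gt0 R))//.
  by apply: per_int_ge0 => t _; rewrite mulr_ge0 ?powR_ge0 ?fker_ge0.
have mp : 0 < m by rewrite lt_neqAle eq_sym mn.
set a := p * m `^ (p - 1).
have i1 : intg (fun t => a * normc (F t)) by exact: intgZ.
have i2 : intg (fun=> m `^ p - a * m) by exact: intg_cst.
have -> : m `^ p = fejer M (fun t => (m `^ p - a * m) + a * normc (F t)) x.
  rewrite (fejerD M x i2 i1) fejer_cst// (fejerZ M a x hn) -/m; ring.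
apply: fejer_le => //; first exact: intgD.
move=> t _; have := powR_tangent p1 mp (normc_ge0 (F t)); rewrite -/a; lra.
Qed.

Lemma per_int_cfejer_le M p F : 1 <= p -> (0 < M)%N -> cintg F -> intg (fun t => normc (F t) `^ p) ->
  per_int (fun t => normc (cfejer M F t) `^ p) <= per_int (fun t => normc (F t) `^ p).
Proof.
move=> p1 M0 hF hp; rewrite -[leRHS](per_int_fejer M0 hp).
apply: per_int_le; [|exact: intg_fejer|by move=> t _; exact: fejer_jensen].
apply: intg_cont => t.
apply: (@cont_normc_powR _ _ (fun t => cfejer M F t)); first by lra.
apply: cont_sqrt; apply: contD; apply: contX; apply: continuous_fejer; by case: hF.
Qed.

Lemma approx_continuous f e : intg f -> 0 < e ->
  exists2 G, continuous G & per_int (fun t => `|f t - G t|) <= e.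
Proof.
move=> hf e0; have mD : @measurable _ (measurableTypeR R) `[0, 2 * pi]%classic by exact: measurable_itv.
have [|G [Gc _]] := @approximation_continuous_integrable R _ f mD _ hf.
  by rewrite /= lebesgue_measure_itv /= lte_fin pi2_gt0 -EFinB ltry.
move=> /fine_cvgP[_ /cvgr0_norm_le /(_ _ e0)] [N _ HN].
exists (G N); first exact: Gc.
by apply: le_trans (ler_norm _) _; exact: (HN N (leqnn N)).
Qed.

Lemma per_int_ends d : 0 < d <= 1 ->
  exists2 chi : R -> R, intg chi & [/\ per_int chi = 2 * d, forall t, 0 <= chi t &
    forall t, 0 <= t <= 2 * pi -> ~~ (d <= t <= 2 * pi - d) -> chi t = 1].
Proof.
move=> /andP[d0 d1]; have pi2 := pi_ge2 R.
pose A : set R := `[d, 2 * pi - d]%classic.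
have mA : @measurable _ (measurableTypeR R) A by exact: measurable_itv.
have mD : @measurable _ (measurableTypeR R) `[0, 2 * pi]%classic by exact: measurable_itv.
have i1 : intg (\1_A : R -> R).
  apply: (@intg_le _ (fun=> 1)); [exact: measurable_indic|move=> t _|exact: intg_cst].
  by rewrite indicE ger0_norm ?ler0n// lern1 leq_b1.
exists (fun t => 1 - \1_A t); first by apply: intgB => //; exact: intg_cst.
split.
- rewrite (per_intB (intg_cst 1) i1) per_int_cst mulr1.
  have -> : per_int (\1_A : R -> R) = 2 * pi - d - d.
    rewrite /per_int /Rintegral integral_indic// setIidl; last first.
      by move=> t; rewrite /A /= !in_itv/= => /andP[h1 h2]; apply/andP; split; lra.
    have E : mu `[d, 2 * pi - d]%classic = (2 * pi - d - d)%:E.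
      by rewrite lebesgue_measure_itv/= lte_fin ifT//=; lra.
    exact: (congr1 fine E).
  lra.
- by move=> t; rewrite subr_ge0 indicE lern1 leq_b1.
- move=> t ht h; rewrite indicE memNset ?subr0// /A /= in_itv/=; exact/negP.
Qed.

Lemma continuous_bounded_period f : continuous f ->
  exists2 B, 0 <= B & forall t, 0 <= t <= 2 * pi -> `|f t| <= B.
Proof.
move=> fc; have pi0 := pi_gt0 R.
have cn (y : R) : {for y, continuous (fun y => `|f y|)} by apply: cont_norm; exact: fc.
have [|c _ Hc] := compact_EVT_max _ (@segment_compact R 0 (2 * pi)) (within_cont_set (fun y _ => cn y)).
  by exists 0; rewrite /= in_itv/= lexx; lra.
exists `|f c| => // t ht; apply: Hc; by rewrite inE/= in_itv/=.
Qed.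

(** [G] need not agree at 0 and [2 pi], so uniform closeness is claimed only on [[d, 2 pi - d]]. On
    the two ends, of total length [2 d], the error is at most [2 B]. The choices of [d], of
    [e / (6 pi)] and of [M] account for [e / 3] each. *)
Lemma fejer_L1_continuous G e : continuous G -> 0 < e ->
  exists N, forall M, (N <= M)%N -> (0 < M)%N -> per_int (fun t => `|fejer M G t - G t|) <= e.
Proof.
move=> Gc e0; have pi0 := pi_gt0 R; have pi2 := pi_ge2 R.
have hG := intg_cont Gc.
have [B B0 HB] := continuous_bounded_period Gc.
pose d := Num.min 1 (e / (12 * (B + 1))).
have d0 : 0 < d by rewrite lt_min ltr01 divr_gt0// mulr_gt0//; lra.
have d1 : d <= 1 by rewrite ge_min lexx.
have dB : 4 * B * d <= e / 3.
  have : d * (12 * (B + 1)) <= e.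
    by rewrite -ler_pdivlMr; [rewrite ge_min lexx orbT|lra].
  by clearbody d; nra.
have [chi ichi [chiE chi0 chi1]] := @per_int_ends d (introT andP (conj d0 d1)).
have e1 : 0 < e / (6 * pi) by rewrite divr_gt0// mulr_gt0.
have Hper x t : d <= x <= 2 * pi - d -> 0 <= t <= 2 * pi -> cos (x - t) = 1 -> G t = G x.
  move=> /andP[h1 h2] /andP[h3 h4] c.
  have : x - t = 0 by apply: cos_eq1 => //; rewrite ltr_norml; apply/andP; split; lra.
  by move/eqP; rewrite subr_eq0 => /eqP->.
have [C C0 HC] := korovkin_const Gc e1 Hper.
have [N HN] : exists N, forall M, (N <= M)%N -> (0 < M)%N -> 4 * pi * C / M%:R <= e / 3.
  exists (Num.truncn (4 * pi * C / (e / 3))).+1 => M NM M0.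
  rewrite ler_pdivrMr ?ltr0n// [leRHS]mulrC -ler_pdivrMr; last by lra.
  by apply: le_trans (ltW (truncnS_gt _)) _; rewrite ler_nat.
exists N => M NM M0; have := HN M NM M0 => HM.
have hf := intg_fejer M hG.
have i1 : intg (fun=> e / (6 * pi) + 2 * C / M%:R) by exact: intg_cst.
apply: (@le_trans _ _ (per_int (fun t => (e / (6 * pi) + 2 * C / M%:R) + 2 * B * chi t))).
  apply: per_int_le; [by apply: intg_norm; exact: intgB|by apply: intgD => //; exact: intgZ|].
  move=> t ht; have [hd|hd] := boolP (d <= t <= 2 * pi - d).
    apply: (@le_trans _ _ (e / (6 * pi) + 2 * C / M%:R)).
      by apply: fejer_korovkin => // u hu; exact: HC.
    by rewrite lerDl; apply: mulr_ge0 => //; lra.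
  rewrite (chi1 _ ht hd) mulr1; apply: (@le_trans _ _ (2 * B)); last first.
    by rewrite lerDr; apply: addr_ge0; [exact: ltW|rewrite divr_ge0//; lra].
  apply: le_trans (ler_normB _ _) _.
  have h1 : `|fejer M G t| <= B.
    rewrite ler_norml; apply/andP; split.
      rewrite -(fejer_cst (- B) t M0); apply: fejer_le => //; first exact: intg_cst.
      by move=> u hu; have := HB u hu; rewrite ler_norml => /andP[].
    rewrite -(fejer_cst B t M0); apply: fejer_le => //; first exact: intg_cst.
    by move=> u hu; have := HB u hu; rewrite ler_norml => /andP[].
  have := HB t ht; lra.
rewrite (per_intD i1 (intgZ _ ichi)) (per_intZ _ ichi) chiE per_int_cst.
have E (q m : R) : 0 < q -> 0 < m ->
    2 * q * (e / (6 * q) + 2 * C / m) = e / 3 + 4 * q * C / m.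
  by move=> q0 m0; field; rewrite !gt_eqF.
rewrite (E _ _ pi0) ?ltr0n//.
move: (4 * pi * C / M%:R) HM => q HM.
have -> : 2 * B * (2 * d) = 4 * B * d by ring.
move: (4 * B * d) dB => r; lra.
Qed.

(** Fejer means are positive and preserve the integral, hence do not increase L^1 distances, and
    continuous functions are dense. *)
Lemma fejer_L1 f e : intg f -> 0 < e ->
  exists N, forall M, (N <= M)%N -> (0 < M)%N -> per_int (fun t => `|fejer M f t - f t|) <= e.
Proof.
move=> hf e0; have e4 : 0 < e / 4 by lra. have e2 : 0 < e / 2 by lra.
have [G Gc HG] := approx_continuous hf e4.
have hG := intg_cont Gc.
have [N HN] := fejer_L1_continuous Gc e2.
exists N => M NM M0; have := HN M NM M0 => HM.
pose D t := `|f t - G t|.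
have hD : intg D by apply: intg_norm; exact: intgB.
have hfD := intg_fejer M hD.
have hGG : intg (fun t => `|fejer M G t - G t|).
  by apply: intg_norm; apply: intgB => //; exact: intg_fejer.
apply: (@le_trans _ _ (per_int (fun t => (fejer M D t + `|fejer M G t - G t|) + D t))).
  apply: per_int_le.
  - by apply: intg_norm; apply: intgB => //; exact: intg_fejer.
  - by apply: intgD => //; exact: intgD.
  move=> t _.
  have h1 : `|fejer M f t - fejer M G t| <= fejer M D t.
    have i1 : intg (fun u => f u - G u) by exact: intgB.
    have i2 : intg (fun u => -1 * G u) by exact: intgZ.
    have -> : fejer M f t - fejer M G t = fejer M (fun u => f u - G u) t.
      rewrite -mulN1r -(fejerZ M (-1) t hG) -(fejerD M t hf i2).
      by congr (fejer M _ t); apply/funext => u; rewrite mulN1r.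
    rewrite ler_norml; apply/andP; split.
      rewrite -mulN1r -(fejerZ M (-1) t hD); apply: fejer_le => //; first exact: intgZ.
      by move=> u _; rewrite mulN1r /D lerNl; have := ler_norm (- (f u - G u)); rewrite normrN.
    by apply: fejer_le => // u _; exact: ler_norm.
  rewrite /D; have -> : fejer M f t - f t =
    (fejer M f t - fejer M G t) + (fejer M G t - G t) + (G t - f t) by ring.
  apply: le_trans (ler_normD _ _) _; rewrite distrC lerD2r.
  by apply: le_trans (ler_normD _ _) _; rewrite lerD2r.
rewrite (per_intD (intgD hfD hGG) hD) (per_intD hfD hGG) (per_int_fejer M0 hD).
by move: HG HM; rewrite -/D; lra.
Qed.

End FejerConvergence.

(** * Almost everywhere convergence and Fatou's lemma *)

Section FejerFatou.
Context {R : realType}.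
Notation pi := (@pi R).
Notation mu := (@lebesgue_measure R).
Notation period := `[0, 2 * pi]%classic.
Implicit Types (p s t x y C : R) (z w : R[i]) (f : R -> R) (g h F : R -> R[i]) (M k : nat).

Let mD : @measurable _ (measurableTypeR R) period.
Proof. exact: measurable_itv. Qed.

Lemma intgE f : intg f -> (\int[mu]_(t in period) (f t)%:E = (per_int f)%:E)%E.
Proof. by move=> hf; rewrite /per_int /Rintegral fineK//; exact: integrable_fin_num. Qed.

Lemma cvg_dominated (a b : nat -> R) (l : R) : (forall k, `|a k - l| <= b k) ->
  b @ \oo --> 0 -> a @ \oo --> l.
Proof.
move=> ab /cvgr0_norm_le b0; apply/cvgrPdist_le => e e0.
have := b0 _ e0; apply: filterS => k; rewrite distrC; apply: le_trans.
by apply: le_trans (ab k) _; exact: ler_norm.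
Qed.

Lemma nneseries_term_cvg0 (a : nat -> R) : (forall k, 0 <= a k) ->
  (\sum_(0 <= k <oo) (a k)%:E < +oo)%E -> a @ \oo --> 0.
Proof.
move=> a0 ha; have a0' k : true -> (0 <= (a k)%:E)%E by rewrite lee_fin.
have := nneseries_tail_cvg ha a0'.
move=> /fine_cvgP[fin /cvgr0_norm_le tl]; apply/cvgr0Pnorm_le => e e0.
apply: filterS (filterI fin (tl _ e0)) => k [fk]; apply: le_trans.
rewrite ger0_norm// -lee_fin; apply: (@le_trans _ _ (\sum_(k <= i <oo) (a i)%:E)%E).
  rewrite (nneseries_split k 1) => [|i _]; last by rewrite lee_fin.
  rewrite addn1 big_nat1 leeDl//; apply: nneseries_ge0 => i _ _; by rewrite lee_fin.
by rewrite -[leLHS]fineK// lee_fin /= ler_norm.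
Qed.

Definition fejer_err M g h t :=
  `|fejer M (fun u => complex.Re (g u)) t - complex.Re (g t)| +
  `|fejer M (fun u => complex.Im (g u)) t - complex.Im (g t)| +
  (`|fejer M (fun u => complex.Re (h u)) t - complex.Re (h t)| +
   `|fejer M (fun u => complex.Im (h u)) t - complex.Im (h t)|).

Lemma fejer_err_ge0 M g h t : 0 <= fejer_err M g h t.
Proof. by rewrite !addr_ge0. Qed.

Lemma fejer_err_bounds M g h t :
  [/\ `|fejer M (fun u => complex.Re (g u)) t - complex.Re (g t)| <= fejer_err M g h t,
      `|fejer M (fun u => complex.Im (g u)) t - complex.Im (g t)| <= fejer_err M g h t,
      `|fejer M (fun u => complex.Re (h u)) t - complex.Re (h t)| <= fejer_err M g h t &
      `|fejer M (fun u => complex.Im (h u)) t - complex.Im (h t)| <= fejer_err M g h t].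
Proof.
rewrite /fejer_err; move: (normr_ge0 (fejer M (fun u => complex.Re (g u)) t - complex.Re (g t)))
  (normr_ge0 (fejer M (fun u => complex.Im (g u)) t - complex.Im (g t)))
  (normr_ge0 (fejer M (fun u => complex.Re (h u)) t - complex.Re (h t)))
  (normr_ge0 (fejer M (fun u => complex.Im (h u)) t - complex.Im (h t))).
by move: `|_| `|_| `|_| `|_| => a b c d; split; lra.
Qed.

Lemma intg_fejer_err M g h : cintg g -> cintg h -> intg (fejer_err M g h).
Proof.
move=> [h1 h2] [h3 h4]; apply: intgD; apply: intgD; apply: intg_norm; apply: intgB => //;
 exact: intg_fejer.
Qed.

Lemma fejer_err_small g h (e : R) : cintg g -> cintg h -> 0 < e ->
  exists2 M, (0 < M)%N & per_int (fejer_err M g h) <= e.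
Proof.
move=> [h1 h2] [h3 h4] e0; have e4 : 0 < e / 4 by lra.
have [N1 H1] := fejer_L1 h1 e4; have [N2 H2] := fejer_L1 h2 e4.
have [N3 H3] := fejer_L1 h3 e4; have [N4 H4] := fejer_L1 h4 e4.
pose M := (maxn (maxn N1 N2) (maxn N3 N4)).+1.
have [l1 l2 l3 l4] : [/\ (N1 <= M)%N, (N2 <= M)%N, (N3 <= M)%N & (N4 <= M)%N].
  by rewrite /M; split; rewrite leqW// !leq_max leqnn ?orbT.
exists M => //.
have i (f : R -> R) : intg f -> intg (fun t => `|fejer M f t - f t|).
  by move=> hf; apply: intg_norm; apply: intgB => //; exact: intg_fejer.
rewrite /fejer_err (per_intD (intgD (i _ h1) (i _ h2)) (intgD (i _ h3) (i _ h4))).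
rewrite (per_intD (i _ h1) (i _ h2)) (per_intD (i _ h3) (i _ h4)).
have := H1 M l1 isT; have := H2 M l2 isT; have := H3 M l3 isT; have := H4 M l4 isT.
lra.
Qed.

(* The subsequence [m] is fast enough for the errors to be summable, hence to
   converge to 0 almost everywhere. *)
Lemma fejer_ae g h : cintg g -> cintg h -> exists (m : nat -> nat) (N : set R),
  [/\ forall k, (0 < m k)%N, @measurable _ (measurableTypeR R) N, mu N = 0%E &
   forall t, 0 <= t <= 2 * pi -> ~ N t -> fejer_err (m k) g h t @[k --> \oo] --> 0].
Proof.
move=> hg hh.
have Hm k : exists M, (0 < M)%N /\ per_int (fejer_err M g h) <= 1 / (2 ^ k.+1)%:R.
  have k0 : 0 < 1 / (2 ^ k.+1)%:R :> R by rewrite divr_gt0// ltr0n expn_gt0.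
  have [M M0 HM] := fejer_err_small hg hh k0.
  by exists M.
have [m Hmk] := choice Hm.
pose a k t := (fejer_err (m k) g h t)%:E.
have a0 k t : (0 <= a k t)%E by rewrite lee_fin fejer_err_ge0.
have ia k := intg_fejer_err (m k) hg hh.
have ma k : measurable_fun period (a k).
  by apply/measurable_EFinP; exact: intg_measurable.
pose S t := (\sum_(0 <= k <oo) a k t)%E.
have mS : measurable_fun period S by exact: ge0_emeasurable_sum.
have S0 t : (0 <= S t)%E by apply: nneseries_ge0 => k _ _; exact: a0.
have iS : mu.-integrable period S.
  apply/integrableP; split => //.
  under eq_integral => t _ do rewrite gee0_abs//.
  rewrite integral_nneseries//; apply: le_lt_trans (ltry 1).
  apply: le_trans (epsilon_trick0 xpredT (@ler01 R)).
  apply: lee_nneseries => [k _ _|k _]; first exact: integral_ge0.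
  by rewrite /a intgE// lee_fin; exact: (Hmk k).2.
have [N [mN N0 HN]] := integrable_ae mD iS.
exists m, N; split => // [k|t ht Nt]; first exact: (Hmk k).1.
apply: nneseries_term_cvg0 => [k|]; first exact: fejer_err_ge0.
have : S t \is a fin_num.
  apply: contrapT => h'; apply: Nt; apply: HN => /= h''; apply: h'; apply: h''.
  by rewrite in_itv/=.
by rewrite ge0_fin_numE.
Qed.

Lemma mixed_norm_continuous p s : 0 < p -> 0 < s -> forall y : (R * R) * (R * R),
  {for y, continuous (fun y : (R * R) * (R * R) => mixed_norm p s (y.1.1 +i* y.1.2) (y.2.1 +i* y.2.2))}.
Proof.
move=> p0 s0 y.
have c11 : {for y, continuous (fun y : (R * R) * (R * R) => y.1.1)}.
  exact: (@continuous_comp _ _ _ fst fst y (@cont_fst _ _ _) (@cont_fst _ _ _)).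
have c12 : {for y, continuous (fun y : (R * R) * (R * R) => y.1.2)}.
  exact: (@continuous_comp _ _ _ fst snd y (@cont_fst _ _ _) (@cont_snd _ _ _)).
have c21 : {for y, continuous (fun y : (R * R) * (R * R) => y.2.1)}.
  exact: (@continuous_comp _ _ _ snd fst y (@cont_snd _ _ _) (@cont_fst _ _ _)).
have c22 : {for y, continuous (fun y : (R * R) * (R * R) => y.2.2)}.
  exact: (@continuous_comp _ _ _ snd snd y (@cont_snd _ _ _) (@cont_snd _ _ _)).
by apply: cont_mixed_norm => //; apply: cont_sqrt; apply: contD; exact: contX.
Qed.

Lemma limn_einf_le (u : nat -> \bar R) (K : \bar R) : (forall k, (u k <= K)%E) ->
  (limn_einf u <= K)%E.
Proof.
move=> uK; rewrite limn_einf_lim; apply: lime_le; first exact: is_cvg_einfs.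
apply: nearW => k; apply: le_trans (uK k); apply: ereal_inf_lbound; exists k => //=.
Qed.

Lemma measurable_mixed_norm p s g h : 0 < p -> 0 < s -> cintg g -> cintg h ->
  measurable_fun period (fun t => mixed_norm p s (g t) (h t)).
Proof.
move=> p0 s0 hg hh.
have mP (q : R) : 0 < q -> measurable_fun [set: R] (fun x : R => `|x| `^ q).
  by move=> q0; apply: continuous_measurable_fun => x; apply: cont_norm_powR => //; exact: cont_id.
have mN (F : R -> R[i]) : cintg F -> measurable_fun period (fun t => normc (F t) `^ s).
  move=> hF; rewrite (_ : (fun t => _) = fun t => `|normc (F t)| `^ s).
    by apply: measurableT_comp (mP _ s0) _; exact: measurable_normc.
  by apply/funext => t; rewrite ger0_norm ?normc_ge0.
rewrite (_ : (fun t => _) = fun t => `| `|normc (g t) `^ s + normc (h t) `^ s| `^ s^-1| `^ p).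
  apply: measurableT_comp (mP _ p0) _; apply: (measurableT_comp (mP s^-1 _)); first by rewrite invr_gt0.
  by apply: measurable_funD; exact: mN.
apply/funext => t; have S0 := addr_ge0 (powR_ge0 (normc (g t)) s) (powR_ge0 (normc (h t)) s).
by rewrite /mixed_norm (ger0_norm S0) (ger0_norm (powR_ge0 _ _)).
Qed.

Theorem fejer_fatou p s g h K : 0 < p -> 0 < s -> cintg g -> cintg h ->
  (forall M, (0 < M)%N -> per_int (fun t => mixed_norm p s (cfejer M g t) (cfejer M h t)) <= K) ->
  (\int[mu]_(t in period) (mixed_norm p s (g t) (h t))%:E <= K%:E)%E.
Proof.
move=> p0 s0 hg hh HK; have [m [N [m0 mN N0 HN]]] := fejer_ae hg hh.
have mDN : @measurable _ (measurableTypeR R) (period `\` N) by exact: measurableD.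
pose Phi k t := (mixed_norm p s (cfejer (m k) g t) (cfejer (m k) h t))%:E.
have iP k : intg (fun t => mixed_norm p s (cfejer (m k) g t) (cfejer (m k) h t)).
  apply: intg_cont => t.
  apply: (@cont_mixed_norm _ _ (fun t => cfejer (m k) g t) (fun t => cfejer (m k) h t)) => //.
    by apply: cont_sqrt; apply: contD; apply: contX; apply: continuous_fejer; case: hg.
  by apply: cont_sqrt; apply: contD; apply: contX; apply: continuous_fejer; case: hh.
have mP k : measurable_fun period (Phi k).
  by apply/measurable_EFinP; exact: intg_measurable.
have P0 k t : (0 <= Phi k t)%E by rewrite lee_fin mixed_norm_ge0.
have lim t : (period `\` N) t -> limn_einf (Phi ^~ t) = (mixed_norm p s (g t) (h t))%:E.
  move=> [/=]; rewrite in_itv/= => ht Nt.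
  have er := HN t ht Nt.
  have dom (u : nat -> R) l : (forall k, `|u k - l| <= fejer_err (m k) g h t) -> u @ \oo --> l.
    by move=> hu; exact: cvg_dominated hu er.
  have c1 : (fejer (m k) (fun u => complex.Re (g u)) t) @[k --> \oo] --> complex.Re (g t).
    apply: dom => k; have [h0 _ _ _] := fejer_err_bounds (m k) g h t; exact: h0.
  have c2 : (fejer (m k) (fun u => complex.Im (g u)) t) @[k --> \oo] --> complex.Im (g t).
    apply: dom => k; have [_ h0 _ _] := fejer_err_bounds (m k) g h t; exact: h0.
  have c3 : (fejer (m k) (fun u => complex.Re (h u)) t) @[k --> \oo] --> complex.Re (h t).
    apply: dom => k; have [_ _ h0 _] := fejer_err_bounds (m k) g h t; exact: h0.
  have c4 : (fejer (m k) (fun u => complex.Im (h u)) t) @[k --> \oo] --> complex.Im (h t).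
    apply: dom => k; have [_ _ _ h0] := fejer_err_bounds (m k) g h t; exact: h0.
  have L : Phi k t @[k --> \oo] --> (mixed_norm p s (g t) (h t))%:E.
    apply: cvg_EFin; first exact: nearW.
    have := @continuous_cvg _ _ _ _ _ _ _ _ (@mixed_norm_continuous p s p0 s0
      ((complex.Re (g t), complex.Im (g t)), (complex.Re (h t), complex.Im (h t))))
      (cvg_pair (cvg_pair c1 c2) (cvg_pair c3 c4)).
    have eta (z : R[i]) : complex.Re z +i* complex.Im z = z by case: z.
    by move=> H; rewrite -[g t in X in _ --> X]eta -[h t in X in _ --> X]eta; exact: H.
  by rewrite is_cvg_limn_einfE; [exact/cvg_lim|apply/cvg_ex; eexists; exact: L].
have mg : measurable_fun period (fun t => (mixed_norm p s (g t) (h t))%:E).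
  by apply/measurable_EFinP; exact: measurable_mixed_norm.
rewrite (ge0_negligible_integral mN mD mg _ N0); last first.
  by move=> t _; rewrite lee_fin mixed_norm_ge0.
have -> : (\int[mu]_(t in period `\` N) (mixed_norm p s (g t) (h t))%:E =
    \int[mu]_(t in period `\` N) limn_einf (Phi ^~ t))%E.
  by apply: eq_integral => t; rewrite inE => /lim.
have mPN k : measurable_fun (period `\` N) (Phi k).
  by apply: measurable_funS (mP k); [exact: mD|exact: subDsetl].
apply: le_trans (fatou mu mDN mPN (fun k t _ => P0 k t)) _.
apply: limn_einf_le => k; apply: (@le_trans _ _ (\int[mu]_(t in period) Phi k t)%E).
  exact: (ge0_subset_integral mu mDN mD (mP k) (fun t _ => P0 k t) (@subDsetl _ _ _)).
by rewrite /Phi intgE// lee_fin; exact: HK.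
Qed.

End FejerFatou.

(** * Integrals and norms on the circle *)

Section CircleIntegral.
Context {R : realType}.
Notation pi := (@pi R).
Notation mu := (@lebesgue_measure R).
Notation period := `[0, 2 * pi]%classic.
Implicit Types (p s t x y C : R) (z w : R[i]) (f g : circle R -> R[i]).

Lemma integral_arclength (F : circle R -> \bar R) : measurable_fun setT F ->
  (forall a, 0 <= F a)%E ->
  (\int[@arclength R]_a F a = \int[mu]_(t in period) F (circle_expi t))%E.
Proof.
move=> mF F0; have mD := @measurable_period R.
pose nu : {measure set (measurableTypeR R) -> \bar R} := mrestr mu mD.
have mFe : measurable_fun [set: measurableTypeR R] (F \o circle_expi) by exact: measurableT_comp mF (@measurable_circle_expi R).
pose pm : {measure set (circle R) -> \bar R} :=
  @measure_function_pushforward__canonical__measure_function_Measure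
    _ _ _ _ _ nu circle_expi (@measurable_circle_expi R).
transitivity (\int[pm]_a F a)%E; first exact: eq_measure_integral.
have -> := @ge0_integral_pushforward _ _ (measurableTypeR R) (circle R) R circle_expi
  (@measurable_circle_expi R) nu setT F measurableT mF (fun a _ => F0 a).
have mC : @measurable _ (measurableTypeR R) (~` period) by exact: measurableC.
have nu0 : nu (~` period) = 0%E by rewrite /nu /= /mrestr setICl measure0.
rewrite preimage_setT (@ge0_negligible_integral _ (measurableTypeR R) R nu setT (~` period) _
  mC measurableT mFe (fun t _ => F0 _) nu0).
rewrite setTD setCK; apply: eq_measure_integral => A mA AD.
by rewrite /nu /= /mrestr setIidl.
Qed.

Lemma Lnorm_arclength p (F : circle R -> R) : 0 < p -> measurable_fun setT F ->
  Lnorm (@arclength R) p%:E (fun a => (F a)%:E) =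
  ((\int[mu]_(t in period) (`|F (circle_expi t)| `^ p)%:E) `^ p^-1)%E.
Proof.
move=> p0 mF; rewrite unlock integral_arclength.
- by congr (_ `^ _)%E; apply: eq_integral => t _; rewrite poweR_EFin.
- rewrite (_ : (fun a => _) = fun a => (`|F a| `^ p)%:E); last by apply/funext => z; rewrite poweR_EFin.
  apply/measurable_EFinP.
  apply: (@measurableT_comp _ _ _ _ _ _ (fun x : R => `|x| `^ p) _ F) => //.
  by apply: continuous_measurable_fun => x; apply: cont_norm_powR => //; exact: cont_id.
- by move=> z; exact: poweR_ge0.
Qed.

Lemma measurable_circle_normc f : measurable_fun setT (fun a => complex.Re (f a)) ->
  measurable_fun setT (fun a => complex.Im (f a)) -> measurable_fun setT (fun a => normc (f a)).
Proof.
move=> h1 h2.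
have ms : measurable_fun [set: R] (@Num.sqrt R).
  by apply: continuous_measurable_fun; exact: sqrt_continuous.
rewrite (_ : (fun a => _) = fun a => Num.sqrt (complex.Re (f a) ^+ 2 + complex.Im (f a) ^+ 2)).
  by apply: measurableT_comp => //; apply: measurable_funD; exact: measurable_funX.
by apply/funext => a; case: (f a).
Qed.

Lemma Lp_norm_integral p f : 0 < p -> measurable_fun setT (fun a => complex.Re (f a)) ->
  measurable_fun setT (fun a => complex.Im (f a)) ->
  (Lp_norm p f = (\int[mu]_(t in period) (normc (f (circle_expi t)) `^ p)%:E) `^ p^-1)%E.
Proof.
move=> p0 h1 h2; rewrite /Lp_norm Lnorm_arclength//; last exact: measurable_circle_normc.
by congr (_ `^ _)%E; apply: eq_integral => t _; rewrite ger0_norm ?normc_ge0.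
Qed.

(** For [|z| > e] the factor [(|z| / e)^(p - 1)] is at least 1. Integrated, this takes the place of
    Holder's inequality: an L^p norm at most [e] gives an L^1 norm of order [e]. *)
Lemma normc_le_powR p e z : 1 < p -> 0 < e -> normc z <= e + e `^ (1 - p) * normc z `^ p.
Proof.
move=> p1 e0; have n0 := normc_ge0 z.
have [h|h] := leP (normc z) e.
  by apply: le_trans h _; rewrite lerDl mulr_ge0 ?powR_ge0.
apply: (@le_trans _ _ (e `^ (1 - p) * normc z `^ p)); last by rewrite lerDr ltW.
have z0 : 0 < normc z by apply: lt_trans h.
have pE : 1 + (p - 1) = p by ring.
have -> : normc z `^ p = normc z * normc z `^ (p - 1).
  rewrite -{2}(powRr1 n0) -powRD ?pE// (gt_eqF z0) implybT//.
rewrite mulrCA ler_peMr//.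
have E : e `^ (1 - p) * e `^ (p - 1) = 1.
  rewrite -powRD ?(gt_eqF e0) ?implybT//.
  by rewrite (_ : 1 - p + (p - 1) = 0) ?powRr0//; ring.
rewrite -[leLHS]E ler_wpM2l ?powR_ge0//; apply: ge0_ler_powR; rewrite ?nnegrE//; lra.
Qed.

Definition pull f t := f (circle_expi t).

Lemma Lp_intg p f : 1 < p -> Lp p f -> cintg (pull f) /\ intg (fun t => normc (pull f t) `^ p).
Proof.
move=> p1 [h1 h2 h3]; have p0 : 0 < p by lra.
have mD : @measurable _ (measurableTypeR R) period by exact: measurable_itv.
have m1 : measurable_fun [set: R] (fun t => complex.Re (pull f t)).
  exact: measurableT_comp h1 (@measurable_circle_expi R).
have m2 : measurable_fun [set: R] (fun t => complex.Im (pull f t)).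
  exact: measurableT_comp h2 (@measurable_circle_expi R).
have mn : measurable_fun [set: R] (fun t => normc (pull f t)).
  exact: measurableT_comp (measurable_circle_normc h1 h2) (@measurable_circle_expi R).
have mp : measurable_fun [set: R] (fun t => normc (pull f t) `^ p).
  rewrite (_ : (fun t => _) = fun t => `|normc (pull f t)| `^ p).
    apply: (@measurableT_comp _ _ _ _ _ _ (fun x : R => `|x| `^ p)) => //.
    by apply: continuous_measurable_fun => x; apply: cont_norm_powR => //; exact: cont_id.
  by apply/funext => t; rewrite ger0_norm ?normc_ge0.
have ip : intg (fun t => normc (pull f t) `^ p).
  apply/integrableP; split; first by apply/measurable_EFinP; exact: measurable_funTS.
  move: h3; rewrite (Lp_norm_integral p0 h1 h2).
  move=> /lty_poweRy; rewrite invr_neq0 ?gt_eqF// => /(_ isT).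
  by congr (_ < _)%E; apply: eq_integral => t _; rewrite gee0_abs// lee_fin powR_ge0.
have i1 : intg (fun t => 1 + normc (pull f t) `^ p) by apply: intgD => //; exact: intg_cst.
have bnd t : normc (pull f t) <= 1 + normc (pull f t) `^ p.
  by have := normc_le_powR (pull f t) p1 ltr01; rewrite powR1 mul1r.
split => //; split.
- apply: intg_le i1; first exact: measurable_funTS.
  by move=> t _; apply: le_trans (bnd t); exact: abs_Re_le.
- apply: intg_le i1; first exact: measurable_funTS.
  by move=> t _; apply: le_trans (bnd t); exact: abs_Im_le.
Qed.

(** The constant is [1 / pi] rather than [1 / (2 pi)] because real and imaginary parts are estimated
    separately; the use made of it is continuity of the coefficients. *)
Lemma normc_fourier_le (F : R -> R[i]) n : cintg F ->
  normc (fourier F n) <= pi^-1 * per_int (fun t => normc (F t)).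
Proof.
move=> hF; have pi0 := pi_gt0 R; have hn := intg_normc hF.
have [h1 h2] := cintg_expi n%:~R hF.
have hle (G : R -> R) : intg G -> (forall t, `|G t| <= normc (F t)) ->
    `|per_int G| <= per_int (fun t => normc (F t)).
  move=> hG GF; apply: le_trans (per_int_norm hG) _.
  by apply: per_int_le => //; exact: intg_norm.
have ne t : normc (F t * expi (- (n%:~R * t))) = normc (F t) by rewrite normcM normc_expi mulr1.
rewrite /fourier normcM normc_real ger0_norm; last by rewrite invr_ge0 mulr_ge0// ltW.
have -> : pi^-1 * per_int (fun t => normc (F t)) =
    (2 * pi)^-1 * (per_int (fun t => normc (F t)) + per_int (fun t => normc (F t))).
  by have E (q a : R) : 0 < q -> q^-1 * a = (2 * q)^-1 * (a + a);
    [move=> q0; field; rewrite gt_eqF|exact: E].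
rewrite ler_wpM2l ?invr_ge0 ?mulr_ge0 ?(ltW pi0)//.
apply: le_trans (normc_le_ReIm _) _; rewrite period_integralE /=; apply: lerD.
- by apply: hle => // t; rewrite -[leRHS]ne abs_Re_le.
- by apply: hle => // t; rewrite -[leRHS]ne abs_Im_le.
Qed.

Lemma cintg_trig_poly (P : {poly R[i]}) : cintg (fun t => P.[expi t]).
Proof.
have [h1 h2] := cont2_poly P.
by split; apply: intg_cont; [exact: (@cont2_circle R (fun a => complex.Re P.[a]))
  |exact: (@cont2_circle R (fun a => complex.Im P.[a]))].
Qed.

End CircleIntegral.

(** * Fourier coefficients of the analytic sum *)

Section AnalyticSum.
Context {R : realType}.
Notation pi := (@pi R).
Notation mu := (@lebesgue_measure R).
Notation period := `[0, 2 * pi]%classic.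
Implicit Types (p s t x y C e : R) (f g : circle R -> R[i]) (F G : R -> R[i]) (P Q : {poly R[i]}).

Lemma period_integral_expi (k : int) :
  period_integral (fun t => expi (k%:~R * t)) = if k == 0 then (2 * pi)%:C else 0 :> R[i].
Proof.
rewrite period_integralE /=.
case: k => m.
  have -> : per_int (fun t => cos (m%:~R * t)) = (m == 0)%:R * (2 * pi) by exact: per_int_cos.
  have -> : per_int (fun t => sin (m%:~R * t)) = 0 :> R by exact: per_int_sin.
  by rewrite eqz_nat; case: eqVneq => _; rewrite ?mul1r ?mul0r.
rewrite NegzE /=.
have -> : per_int (fun t => cos ((- m.+1%:Z)%:~R * t)) = 0 :> R.
  transitivity (per_int (fun t => cos (m.+1%:R * t))); last by rewrite per_int_cos mul0r.
  by congr per_int; apply/funext => t; rewrite mulrNz mulNr cosN.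
have -> : per_int (fun t => sin ((- m.+1%:Z)%:~R * t)) = 0 :> R.
  transitivity (- per_int (fun t => sin (m.+1%:R * t))); last by rewrite per_int_sin oppr0.
  rewrite -per_intN; last by apply: intg_cont; exact: continuous_sinM.
  by congr per_int; apply/funext => t; rewrite mulrNz mulNr sinN.
by [].
Qed.

Lemma cintg_cst c : cintg (fun=> c : R[i]).
Proof. by split; exact: intg_cst. Qed.

Lemma fourier_monomial (c : R[i]) (m : nat) (n : int) :
  fourier (fun t => c * expi t ^+ m) n = if m%:Z == n then c else 0.
Proof.
have pi0 := @pi2_gt0 R; rewrite /fourier.
have -> : (fun t => c * expi t ^+ m * expi (- (n%:~R * t))) =
    fun t => 1 * expi (- ((n - m%:Z)%:~R * t)) * c.
  apply/funext => t; rewrite mul1r [RHS]mulrC -mulrA expiX -expiD; congr (_ * expi _).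
  by rewrite rmorphB /= mulrBl opprB addrC.
rewrite period_integralZ; last by apply: cintg_expi; exact: cintg_cst.
have -> : (fun t => 1 * expi (- ((n - m%:Z)%:~R * t))) = fun t => expi ((m%:Z - n)%:~R * t).
  by apply/funext => t; rewrite mul1r -mulNr -rmorphN /= opprB.
rewrite period_integral_expi subr_eq0; case: eqP => _; last by rewrite mul0r mulr0.
rewrite mulrA; apply: complex_eqP; rewrite ?Re_mul ?Im_mul /=; field; rewrite gt_eqF//; lra.
Qed.

Lemma fourier_sum (I : Type) (r : seq I) (h : I -> R -> R[i]) n : (forall i, cintg (h i)) ->
  fourier (fun t => \sum_(i <- r) h i t) n = \sum_(i <- r) fourier (h i) n.
Proof.
move=> hi; rewrite /fourier -big_distrr /=; congr (_ * _).
have hi' i : cintg (fun t => h i t * expi (- (n%:~R * t))) by exact: cintg_expi.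
rewrite -(period_integral_sum r hi').2; congr period_integral.
by apply/funext => t; rewrite big_distrl.
Qed.

Lemma cintg_monomial (c : R[i]) m : cintg (fun t => c * expi t ^+ m).
Proof.
rewrite (_ : (fun t => _) = fun t => (c *: 'X^m).[expi t]); first exact: cintg_trig_poly.
by apply/funext => t; rewrite hornerZ hornerXn.
Qed.

Lemma fourier_poly P n : fourier (fun t => P.[expi t]) n =
  if n is Posz m then P`_m else 0.
Proof.
rewrite (_ : (fun t => _) = fun t => \sum_(i < size P) P`_i * expi t ^+ i); last first.
  by apply/funext => t; rewrite horner_coef.
rewrite fourier_sum => [|i]; last exact: cintg_monomial.
under eq_bigr do rewrite fourier_monomial.
case: n => m; last by rewrite big1.
have [mP|Pm] := ltnP m (size P).
  rewrite (bigD1 (Ordinal mP))//= eqxx big1 ?addr0// => i; rewrite -val_eqE /= => /negbTE im.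
  by rewrite eqz_nat im.
rewrite nth_default// big1// => i _; rewrite eqz_nat; case: eqP => // im.
by move: (ltn_ord i); rewrite im ltnNge Pm.
Qed.

Lemma measurable_circle_Re_Im :
  measurable_fun setT (fun z : circle R => complex.Re (z : R[i])) /\
  measurable_fun setT (fun z : circle R => complex.Im (z : R[i])).
Proof.
have mc : measurable_fun setT (@circle_coord R).
  by move=> _ A mA; exists A.
split.
  exact: (measurableT_comp (@measurable_fst _ _ _ _) mc).
exact: (measurableT_comp (@measurable_snd _ _ _ _) mc).
Qed.

Lemma measurable_circle_poly P :
  measurable_fun setT (fun z : circle R => complex.Re P.[z : R[i]]) /\
  measurable_fun setT (fun z : circle R => complex.Im P.[z : R[i]]).
Proof.
have [mR mI] := measurable_circle_Re_Im.
elim/poly_ind: P => [|P c [hR hI]].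
  split; (rewrite (_ : (fun z : circle R => _) = fun=> 0); first exact: measurable_cst);
    by apply/funext => z; rewrite horner0.
split.
- rewrite (_ : (fun z : circle R => _) = fun z : circle R => complex.Re P.[z : R[i]] * complex.Re (z : R[i])
    - complex.Im P.[z : R[i]] * complex.Im (z : R[i]) + complex.Re c); last first.
    by apply/funext => z; rewrite hornerMXaddC Re_add Re_mul.
  apply: measurable_funD; last exact: measurable_cst.
  by apply: measurable_funB; exact: measurable_funM.
- rewrite (_ : (fun z : circle R => _) = fun z : circle R => complex.Re P.[z : R[i]] * complex.Im (z : R[i])
    + complex.Im P.[z : R[i]] * complex.Re (z : R[i]) + complex.Im c); last first.
    by apply/funext => z; rewrite hornerMXaddC Im_add Im_mul.
  apply: measurable_funD; last exact: measurable_cst.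
  by apply: measurable_funD; exact: measurable_funM.
Qed.

Lemma analytic_partial_sumE f N (z : circle R) :
  analytic_partial_sum f N z = (\poly_(n < N) fourier (pull f) n%:Z).[z : R[i]].
Proof. by rewrite horner_poly /analytic_partial_sum big_mkord. Qed.

Lemma measurable_sub f g : measurable_fun setT (fun z => complex.Re (f z)) ->
  measurable_fun setT (fun z => complex.Im (f z)) ->
  measurable_fun setT (fun z => complex.Re (g z)) ->
  measurable_fun setT (fun z => complex.Im (g z)) ->
  measurable_fun setT (fun z => complex.Re (f z - g z)) /\
  measurable_fun setT (fun z => complex.Im (f z - g z)).
Proof.
move=> h1 h2 h3 h4; split.
- rewrite (_ : (fun z => _) = fun z => complex.Re (f z) - complex.Re (g z)); first exact: measurable_funB.
  by apply/funext => z; rewrite Re_add Re_opp.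
- rewrite (_ : (fun z => _) = fun z => complex.Im (f z) - complex.Im (g z)); first exact: measurable_funB.
  by apply/funext => z; rewrite Im_add Im_opp.
Qed.

Lemma Lp_norm_per_int p f : 1 < p -> Lp p f ->
  Lp_norm p f = (per_int (fun t => normc (pull f t) `^ p) `^ p^-1)%:E.
Proof.
move=> p1 Lf; have [_ ip] := Lp_intg p1 Lf; case: Lf => h1 h2 _.
rewrite Lp_norm_integral//; last by lra.
rewrite -poweR_EFin -intgE//.
Qed.

Lemma per_int_normc_le p f e : 1 < p -> Lp p f -> 0 < e -> (Lp_norm p f <= e%:E)%E ->
  per_int (fun t => normc (pull f t)) <= (2 * pi + 1) * e.
Proof.
move=> p1 Lf e0; rewrite Lp_norm_per_int// lee_fin => h; have [hf ip] := Lp_intg p1 Lf.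
set I := per_int (fun t => normc (pull f t) `^ p) in h *.
have I0 : 0 <= I by apply: per_int_ge0 => t _; exact: powR_ge0.
have Ie : I <= e `^ p.
  have -> : I = (I `^ p^-1) `^ p by rewrite -powRrM mulVf ?powRr1// gt_eqF//; lra.
  by apply: ge0_ler_powR; rewrite ?nnegrE ?powR_ge0//; lra.
have i1 : intg (fun t => e + e `^ (1 - p) * normc (pull f t) `^ p).
  by apply: intgD; [exact: intg_cst|exact: intgZ].
apply: (@le_trans _ _ (per_int (fun t => e + e `^ (1 - p) * normc (pull f t) `^ p))).
  apply: per_int_le => //; first exact: intg_normc.
  by move=> t _; exact: normc_le_powR.
rewrite (per_intD (intg_cst e) (intgZ _ ip)) (per_intZ _ ip) per_int_cst.
rewrite (_ : (2 * pi + 1) * e = 2 * pi * e + e) ?lerD2l; last by ring.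
have E : e `^ (1 - p) * e `^ p = e.
  rewrite -powRD ?(gt_eqF e0) ?implybT//.
  by rewrite (_ : 1 - p + p = 1) ?powRr1// ?(ltW e0)//; ring.
by rewrite -[leRHS]E ler_wpM2l ?powR_ge0.
Qed.

(** Fourier coefficients are continuous in the L^p norm, and those of the partial sums with
    [N > |n|] already have the stated value. *)
Lemma analytic_sum_fourier p f g n : 1 < p -> Lp p f -> is_analytic_sum p f g ->
  fourier (pull g) n = if n is Posz m then fourier (pull f) m else 0.
Proof.
move=> p1 Lf [Lg Hg]; have [hf ipf] := Lp_intg p1 Lf; have [hg ipg] := Lp_intg p1 Lg.
set c := (if n is Posz m then _ else _).
apply/eqP; rewrite eq_sym -subr_eq0; apply: contraT; rewrite -normc_gt0 => d0.
have pi0 := pi_gt0 R.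
set d := normc (c - fourier (pull g) n) in d0.
(* Chosen so that the two norm estimates turn an L^p distance [e] into [d <= d / 2]. *)
pose e := d / (pi^-1 * (2 * pi + 1)) / 2.
have k0 : 0 < pi^-1 * (2 * pi + 1) by rewrite mulr_gt0 ?invr_gt0//; lra.
have e0 : 0 < e by rewrite /e divr_gt0// divr_gt0.
have [N [Nn HN]] : exists N, (`|n| < N)%N /\
    (Lp_norm p (fun z => (analytic_partial_sum f N z - g z)%R) <= e%:E)%E.
  move/fine_cvgP: Hg => [fin /cvgr0_norm_le /(_ _ e0) le_e].
  have [N0 _ HN0] := filterI fin le_e.
  exists (maxn N0 `|n|.+1); split; first by rewrite leq_max ltnSn orbT.
  have [/= h1 h2] := HN0 (maxn N0 `|n|.+1) (leq_maxl _ _).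
  by rewrite -(fineK h1) lee_fin; apply: le_trans h2; exact: ler_norm.
pose P := \poly_(m < N) fourier (pull f) m%:Z.
pose D (z : circle R) := P.[z : R[i]] - g z.
have DE : D = fun z => analytic_partial_sum f N z - g z.
  by apply/funext => z; rewrite /D analytic_partial_sumE.
rewrite -DE in HN.
have LD : Lp p D.
  have [m1 m2] := measurable_circle_poly P; have [m3 m4 _] := Lg.
  have [m5 m6] := measurable_sub m1 m2 m3 m4.
  by split => //; apply: le_lt_trans HN (ltry _).
have hP : cintg (fun t => P.[expi t]) by exact: cintg_trig_poly.
have fD : fourier (pull D) n = c - fourier (pull g) n.
  have -> : pull D = fun t => P.[expi t] + pull g t * (-1).
    by apply/funext => t; rewrite mulrN1.
  rewrite fourierD//; last exact: cintg_mulc.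
  have -> : fourier (fun t => pull g t * (-1)) n = - fourier (pull g) n.
    rewrite /fourier -mulrN; congr (_ * _); rewrite -(mulrN1 (period_integral _)) -period_integralZ; last exact: cintg_expi.
    by congr period_integral; apply/funext => t; rewrite mulrAC.
  rewrite fourier_poly /c; congr (_ - _); case: (n) Nn => // m mN.
  by rewrite coef_poly mN.
have := normc_fourier_le n (Lp_intg p1 LD).1.
rewrite fD -/d; have := per_int_normc_le p1 LD e0 HN.
move=> h1 h2; have : d <= d / 2.
  apply: le_trans h2 _; apply: le_trans (_ : pi^-1 * ((2 * pi + 1) * e) <= _).
    by rewrite ler_wpM2l// invr_ge0 ltW.
  have -> : d / 2 = (pi^-1 * (2 * pi + 1)) * e.
    rewrite /e; move: (pi^-1 * (2 * pi + 1)) k0; clear => k k0.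
    by field; rewrite gt_eqF.
  by rewrite mulrA.
lra.
Qed.

End AnalyticSum.

(** * The upper bound on all of L^p *)

Section UpperBound.
Context {R : realType}.
Notation pi := (@pi R).
Notation mu := (@lebesgue_measure R).
Notation period := `[0, 2 * pi]%classic.
Implicit Types (p s t x y C e : R) (f g : circle R -> R[i]) (F G H : R -> R[i]) (P Q : {poly R[i]}).

Lemma mixed_norm_conj p s (z w : R[i]) : mixed_norm p s z w^* = mixed_norm p s z w.
Proof. by rewrite /mixed_norm normc_conj. Qed.

Lemma riesz_fejer p s C F G H : 1 < p -> 0 < s -> 0 <= C -> riesz_majorant p s C ->
  analytic G -> coanalytic H -> F = (fun t => G t + H t) -> intg (fun t => normc (F t) `^ p) ->
  (\int[mu]_(t in period) (mixed_norm p s (G t) (H t))%:E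
    <= (C `^ p * per_int (fun t => normc (F t) `^ p))%:E)%E.
Proof.
move=> p1 s0 C0 HC aG cH FE iF; have p0 : 0 < p by lra.
have hG := aG.1; have hH := cH.1.
have hF : cintg F by rewrite FE; exact: cintgD.
apply: fejer_fatou => // M M0.
apply: le_trans (_ : C `^ p * per_int (fun t => normc (cfejer M F t) `^ p) <= _); last first.
  by rewrite ler_wpM2l ?powR_ge0//; apply: per_int_cfejer_le => //; exact: ltW.
have h := riesz_poly (fejer_analytic_poly M G) p1 s0 C0 HC (fejer_coanalytic_poly0 M H).
have E1 : (fun t => mixed_norm p s (cfejer M G t) (cfejer M H t)) = fun t =>
    mixed_norm p s (fejer_analytic_poly M G).[expi t] (fejer_coanalytic_poly M H).[expi t].
  apply/funext => t.
  by rewrite (fejer_analytic_polyE M t aG) (fejer_coanalytic_polyE M t cH) mixed_norm_conj.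
have E2 : (fun t => normc (cfejer M F t) `^ p) = fun t =>
    normc ((fejer_analytic_poly M G).[expi t] + (fejer_coanalytic_poly M H).[expi t]^*) `^ p.
  apply/funext => t; rewrite FE (cfejerD M t hG hH).
  by rewrite (fejer_analytic_polyE M t aG) (fejer_coanalytic_polyE M t cH).
by rewrite E1 E2.
Qed.

Lemma measurable_mixed s f g : 0 < s -> measurable_fun setT (fun z => normc (f z)) ->
  measurable_fun setT (fun z => normc (g z)) ->
  measurable_fun setT (fun z => (normc (f z) `^ s + normc (g z) `^ s) `^ s^-1).
Proof.
move=> s0 mf mg.
have mP (q : R) : 0 < q -> measurable_fun [set: R] (fun x : R => `|x| `^ q).
  by move=> q0; apply: continuous_measurable_fun => x; apply: cont_norm_powR => //; exact: cont_id.
have mN (h : circle R -> R[i]) : measurable_fun setT (fun z => normc (h z)) ->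
    measurable_fun setT (fun z => normc (h z) `^ s).
  move=> hh; rewrite (_ : (fun z => _) = fun z => `|normc (h z)| `^ s).
    exact: measurableT_comp (mP _ s0) hh.
  by apply/funext => z; rewrite (ger0_norm (normc_ge0 _)).
rewrite (_ : (fun z => _) = fun z => `|normc (f z) `^ s + normc (g z) `^ s| `^ s^-1).
  have s0' : 0 < s^-1 by rewrite invr_gt0.
  apply: (measurableT_comp (mP _ s0')).
  by apply: measurable_funD; exact: mN.
apply/funext => z.
by rewrite (ger0_norm (addr_ge0 (powR_ge0 (normc (f z)) s) (powR_ge0 (normc (g z)) s))).
Qed.

Lemma Lnorm_mixed p s f g : 0 < p -> 0 < s ->
  measurable_fun setT (fun z => normc (f z)) -> measurable_fun setT (fun z => normc (g z)) ->
  Lnorm (@arclength R) p%:E (fun z => ((normc (f z) `^ s + normc (g z) `^ s) `^ s^-1)%:E) =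
  ((\int[mu]_(t in period) (mixed_norm p s (pull f t) (pull g t))%:E) `^ p^-1)%E.
Proof.
move=> p0 s0 mf mg; rewrite (Lnorm_arclength p0 (measurable_mixed s0 mf mg)).
congr (_ `^ _)%E; congr (integral _ _ _); apply/funext => t.
by congr ((_ `^ p)%:E); exact: (ger0_norm (powR_ge0 _ _)).
Qed.

Theorem riesz_upper p s C : 1 < p -> 0 < s -> 0 <= C -> riesz_majorant p s C ->
  @riesz_bound R s p C.
Proof.
move=> p1 s0 C0 HC f Lf; have p0 : 0 < p by lra.
have C1 := riesz_majorant_ge1 p1 s0 C0 HC.
have [hf ipf] := Lp_intg p1 Lf; have [mf1 mf2 _] := Lf.
have mf := measurable_circle_normc mf1 mf2.
set I := per_int (fun t => normc (pull f t) `^ p).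
have I0 : 0 <= I by apply: per_int_ge0 => t _; exact: powR_ge0.
suff [mg [mh H]] : measurable_fun setT (fun z => normc (riesz_plus p f z)) /\
    measurable_fun setT (fun z => normc (riesz_minus p f z)) /\
   (\int[mu]_(t in period) (mixed_norm p s (pull (riesz_plus p f) t) (pull (riesz_minus p f) t))%:E
    <= (C `^ p * I)%:E)%E.
  rewrite (Lnorm_mixed p0 s0 mg mh) (Lp_norm_per_int p1 Lf) -/I -EFinM.
  have -> : C * I `^ p^-1 = (C `^ p * I) `^ p^-1.
    by rewrite (powRM _ (powR_ge0 C p) I0) -powRrM divff ?gt_eqF// (powRr1 C0).
  apply: (@le_trans _ _ ((C `^ p * I)%:E `^ p^-1)%E); last by rewrite poweR_EFin.
  apply: gt0_ler_poweR.
  - by rewrite invr_ge0 ltW.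
  - rewrite in_itv/= leey andbT; apply: integral_ge0 => t _.
    by rewrite lee_fin mixed_norm_ge0.
  - by rewrite in_itv/= leey andbT lee_fin mulr_ge0 ?powR_ge0.
  - exact: H.
(* If there is no analytic sum, [riesz_plus] is the default 0 and [riesz_minus] is [f], and the
   bound reduces to [1 <= C]. *)
have [[g Hg]|nog] := pselect (exists g, is_analytic_sum p f g); last first.
  have r0 : riesz_plus p f = fun=> 0.
    by apply: xgetPN => g Hg; apply: nog; exists g.
  have rm : riesz_minus p f = f by apply/funext => z; rewrite /riesz_minus r0 subr0.
  rewrite r0 rm; split; last split => //.
    by rewrite (_ : (fun z => _) = fun=> 0) ?normc0//; apply/funext => z; rewrite normc0.
  rewrite (_ : C `^ p * I = per_int (fun t => C `^ p * normc (pull f t) `^ p)); last by rewrite per_intZ.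
  rewrite -(intgE (intgZ _ ipf)); apply: ge0_le_integral.
  - exact: measurable_itv.
  - by move=> t _; rewrite lee_fin mixed_norm_ge0.
  - apply/measurable_EFinP; apply: measurable_mixed_norm => //; exact: cintg_cst.
  - by apply/measurable_EFinP; apply: intg_measurable; exact: intgZ.
  - move=> t _; rewrite lee_fin /mixed_norm normc0 powR0 ?gt_eqF// add0r -(powRrM _ s s^-1) (divff (lt0r_neq0 s0)).
    rewrite (powRr1 (normc_ge0 _)) -[leLHS]mul1r ler_wpM2r ?powR_ge0//.
    by rewrite -(powRr0 C) ler_powR//; exact: ltW.
have {}Hg : is_analytic_sum p f (riesz_plus p f) by apply: (@xgetPex _ _ [set g | is_analytic_sum p f g]); exists g.
set r := riesz_plus p f in Hg *; have Hr := Hg.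
have Lr := Hr.1; have [mr1 mr2 _] := Lr; have [hr ipr] := Lp_intg p1 Lr.
have mE : riesz_minus p f = fun z => f z - r z by [].
rewrite mE; split; first exact: measurable_circle_normc.
have [m3 m4] := measurable_sub mf1 mf2 mr1 mr2.
split; first exact: measurable_circle_normc.
have coef := analytic_sum_fourier _ p1 Lf Hr.
have hr' : cintg (fun t => pull r t * (-1)) by exact: cintg_mulc.
have pE : pull (fun z => f z - r z) = fun t => pull f t + pull r t * (-1).
  by apply/funext => t; rewrite mulrN1.
have ar : analytic (pull r) by split; [exact: hr|move=> n; exact: (coef (- n.+1%:Z))].
have ch : coanalytic (pull (fun z => f z - r z)).
  rewrite pE; split; [exact: cintgD|move=> n]; rewrite fourierD//.
  have -> : fourier (fun t => pull r t * (-1)) n = - fourier (pull r) n.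
    rewrite /fourier -mulrN; congr (_ * _).
    rewrite -(mulrN1 (period_integral _)) -period_integralZ; last exact: cintg_expi.
    by congr period_integral; apply/funext => t; rewrite mulrAC.
  by rewrite (coef n%:Z) subrr.
have fE : pull f = fun t => pull r t + pull (fun z => f z - r z) t.
  by apply/funext => t; rewrite /pull addrC subrK.
exact: riesz_fejer p1 s0 C0 HC ar ch fE ipf.
Qed.

End UpperBound.

(** * The extremal functions *)

Section LowerPolynomial.
Context {R : realType}.
Notation pi := (@pi R).
Notation mu := (@lebesgue_measure R).
Notation period := `[0, 2 * pi]%classic.
Implicit Types (p s t x y C e : R) (f g : circle R -> R[i]) (F G : R -> R[i]) (P H : {poly R[i]}).

Lemma fourier_conj F n : cintg F -> fourier (fun t => (F t)^*) n = (fourier F (- n))^*.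
Proof.
move=> hF; have [h1 h2] := cintg_expi (- n)%:~R hF; rewrite /fourier.
set J := period_integral (fun t => F t * expi (- ((- n)%:~R * t))).
have -> : period_integral (fun t => (F t)^* * expi (- (n%:~R * t))) = J^*.
  have E t : (F t)^* * expi (- (n%:~R * t)) = (F t * expi (- ((- n)%:~R * t)))^*.
    rewrite mulrNz mulNr opprK /expi cosN sinN.
    by case: (F t) => a b; apply: complex_eqP => /=; ring.
  rewrite /J !period_integralE; apply: complex_eqP => /=.
    by congr per_int; apply/funext => t; rewrite E; case: (_ * _).
  rewrite -(per_intN h2); congr per_int; apply/funext => t; rewrite E.
  by case: (_ * _).
by case: J => a b; apply: complex_eqP => /=; ring.
Qed.

Lemma continuous_intg_Lp p f : 1 < p ->
  measurable_fun setT (fun z => complex.Re (f z)) ->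
  measurable_fun setT (fun z => complex.Im (f z)) ->
  intg (fun t => normc (pull f t) `^ p) -> Lp p f.
Proof.
move=> p1 h1 h2 h; split => //; rewrite Lp_norm_integral//; last by lra.
by apply: poweR_lty; rewrite (intgE h) ltry.
Qed.

Definition re2 H : circle R -> R[i] := fun z => H.[z : R[i]] + (H.[z : R[i]])^*.

Lemma measurable_re2 H : measurable_fun setT (fun z => complex.Re (re2 H z)) /\
  measurable_fun setT (fun z => complex.Im (re2 H z)).
Proof.
have [h1 h2] := measurable_circle_poly H; split.
- rewrite (_ : (fun z => _) = fun z : circle R => complex.Re H.[z : R[i]] + complex.Re H.[z : R[i]]).
    exact: measurable_funD.
  by apply/funext => z; rewrite /re2 Re_add; case: (H.[_]).
- rewrite (_ : (fun z => _) = fun z : circle R => 0); first exact: measurable_cst.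
  by apply/funext => z; rewrite /re2 Im_add; case: (H.[_]) => a b /=; rewrite subrr.
Qed.

Lemma intg_poly_powR p H : 0 < p -> intg (fun t => normc H.[expi t] `^ p) /\
  intg (fun t => normc (H.[expi t] + H.[expi t]^*) `^ p).
Proof.
move=> p0; split; apply: intg_cont => t.
  exact: (@cont_normc_powR _ _ (fun t => H.[expi t]) p t p0 (@continuous_normc_poly _ H t)).
exact: (@cont_normc_powR _ _ (fun t => H.[expi t] + H.[expi t]^*) p t p0
  (@continuous_normc_add_conj _ H H t)).
Qed.

Lemma fourier_re2 H (n : nat) : H.[0] = 0 -> fourier (pull (re2 H)) n = H`_n.
Proof.
move=> H0; have hH := cintg_trig_poly H.
have H00 : H`_0 = 0 by rewrite -horner_coef0.
have hc : cintg (fun t => H.[expi t]^*).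
  split; last by rewrite (_ : (fun t => _) = fun t => - complex.Im H.[expi t]);
    [apply: intgN; exact: hH.2|apply/funext => t; case: (H.[_])].
  by rewrite (_ : (fun t => _) = fun t => complex.Re H.[expi t]);
    [exact: hH.1|apply/funext => t; case: (H.[_])].
rewrite (_ : pull (re2 H) = fun t => H.[expi t] + H.[expi t]^*)// fourierD// fourier_conj//.
rewrite !fourier_poly; case: n => [|n]; last by rewrite -NegzE /= oppr0 addr0.
by rewrite [X in X^*](_ : _ = H`_0)// H00; apply: complex_eqP; rewrite /= ?oppr0 ?addr0.
Qed.

(** The partial sums of [f] equal [H] from [N = size H] on, so [H - g] has norm 0. Equality holds
    only almost everywhere because [riesz_plus] is an arbitrary representative. *)
Lemma is_analytic_sum_ae p H f g : 1 < p -> (forall n : nat, fourier (pull f) n = H`_n) ->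
  is_analytic_sum p f g ->
  exists N : set R, [/\ @measurable _ (measurableTypeR R) N, mu N = 0%E &
    forall t, 0 <= t <= 2 * pi -> ~ N t -> pull g t = H.[expi t]].
Proof.
move=> p1 fH [Lg Hg]; have p0 : 0 < p by lra.
pose D (z : circle R) := H.[z : R[i]] - g z.
have DE n : (size H <= n)%N -> (fun z => analytic_partial_sum f n z - g z) = D.
  move=> Hn; apply/funext => z; rewrite analytic_partial_sumE /D; congr (_.[_] - _).
  apply/polyP => i; rewrite coef_poly fH; case: ltnP => // ni.
  by rewrite nth_default// (leq_trans Hn).
have D0 : Lp_norm p D = 0%E.
  have L : Lp_norm p (fun z => analytic_partial_sum f N z - g z) @[N --> \oo] --> Lp_norm p D.
    apply: cvg_near_cst; exists (size H) => // n /= Hn; by rewrite DE.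
  exact: (cvg_unique _ L Hg).
have [m1 m2] := measurable_circle_poly H; have [m3 m4 _] := Lg.
have [m5 m6] := measurable_sub m1 m2 m3 m4.
have LD : Lp p D by split => //; rewrite D0 ltry.
have [_ iD] := Lp_intg p1 LD.
have z0 : (\int[mu]_(t in period) (normc (pull D t) `^ p)%:E = 0)%E.
  by move: D0; rewrite Lp_norm_integral// => /poweR_eq0_eq0; apply;
    apply: integral_ge0 => t _; rewrite lee_fin powR_ge0.
have mD : @measurable _ (measurableTypeR R) period by exact: measurable_itv.
have mf : measurable_fun period (fun t => (normc (pull D t) `^ p)%:E).
  by apply/measurable_EFinP; exact: intg_measurable.
have /(ae_eq_integral_abs mu mD mf).1 [N [mN N0 HN]] :
    (\int[mu]_(t in period) `|(normc (pull D t) `^ p)%:E| = 0)%E.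
  by rewrite -[RHS]z0; apply: eq_integral => t _; rewrite gee0_abs// lee_fin powR_ge0.
exists N; split => // t ht Nt; apply: contrapT => ne; apply: Nt; apply: HN => /= h.
have /h/eqP : period t by rewrite /= in_itv/=.
rewrite /cst eqe powR_eq0 => /andP[/eqP/eq0_normc/eqP]; rewrite subr_eq0 => /eqP E _.
by apply: ne; rewrite /pull -E.
Qed.

(** For [f = H + conj H] with [H(0) = 0] the projections are [H] and [conj H] almost everywhere.
    Their moduli agree, which produces the factor [2 ^ (1/s)]. *)
Theorem riesz_lower_poly p s C H : 1 < p -> 0 < s -> riesz_bound s p C -> H.[0] = 0 ->
  2 `^ s^-1 * per_int (fun t => normc H.[expi t] `^ p) `^ p^-1 <=
  C * per_int (fun t => normc (H.[expi t] + H.[expi t]^*) `^ p) `^ p^-1.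
Proof.
move=> p1 s0 HC H0; have p0 : 0 < p by lra.
have [i1 i2] := intg_poly_powR H p0.
have [m1 m2] := measurable_re2 H; have [m3 m4] := measurable_circle_poly H.
have Lf : Lp p (re2 H) by exact: continuous_intg_Lp.
have LH : Lp p (fun z : circle R => H.[z : R[i]]) by exact: continuous_intg_Lp.
have fH n : fourier (pull (re2 H)) n%:Z = H`_n by exact: fourier_re2.
have ex : is_analytic_sum p (re2 H) (fun z : circle R => H.[z : R[i]]).
  split => //; have L0 : Lp_norm p (fun z : circle R => H.[z : R[i]] - H.[z : R[i]]) = 0%E.
    rewrite /Lp_norm (_ : (fun z => _) = cst 0%E); last first.
      by apply/funext => z; rewrite subrr normc0.
    by rewrite Lnorm0// eqe gt_eqF.
  rewrite -L0; apply: cvg_near_cst; exists (size H) => // n /= Hn; congr (Lp_norm p _).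
  apply/funext => z; rewrite analytic_partial_sumE; congr (_.[_] - _).
  apply/polyP => i; rewrite coef_poly fH; case: ltnP => // ni.
  by rewrite nth_default// (leq_trans Hn).
have Hg : is_analytic_sum p (re2 H) (riesz_plus p (re2 H)).
  by apply: (@xgetPex _ _ [set g | is_analytic_sum p (re2 H) g]); eexists; exact: ex.
have := HC _ Lf; set g := riesz_plus p (re2 H) in Hg *.
have Lg := Hg.1; have [m5 m6 _] := Lg; have [hg _] := Lp_intg p1 Lg.
have mg := measurable_circle_normc m5 m6.
have [m7 m8] := measurable_sub m1 m2 m5 m6.
have mh : measurable_fun setT (fun z => normc (riesz_minus p (re2 H) z)).
  exact: (measurable_circle_normc m7 m8).
rewrite (Lnorm_mixed p0 s0 mg mh) (Lp_norm_per_int p1 Lf).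
have hh : cintg (pull (riesz_minus p (re2 H))).
  rewrite (_ : pull _ = fun t => pull (re2 H) t + - pull g t)//.
  by apply: cintgD; [exact: (Lp_intg p1 Lf).1|exact: cintgN].
have [N [mN N0 HN]] := is_analytic_sum_ae p1 fH Hg.
have mD : @measurable _ (measurableTypeR R) period by exact: measurable_itv.
have E : (\int[mu]_(t in period) (mixed_norm p s (pull g t) (pull (riesz_minus p (re2 H)) t))%:E
   = (2 `^ (p / s) * per_int (fun t => normc H.[expi t] `^ p))%:E)%E.
  rewrite -(per_intZ _ i1) -(intgE (intgZ _ i1)).
  apply: ge0_ae_eq_integral => //.
  - by apply/measurable_EFinP; exact: measurable_mixed_norm.
  - by apply/measurable_EFinP; apply: intg_measurable; exact: intgZ.
  - by move=> t _; rewrite lee_fin mixed_norm_ge0.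
  - by move=> t _; rewrite lee_fin mulr_ge0 ?powR_ge0.
  exists N; split => // t /= /not_implyP[ht ne]; apply: contrapT => Nt; apply: ne.
  rewrite in_itv/= in ht; have gE := HN t ht Nt; congr (_%:E).
  have -> : pull (riesz_minus p (re2 H)) t = H.[expi t]^*.
    by rewrite /pull /riesz_minus -/g -[g _]/(pull g t) gE /re2 addrC addKr.
  rewrite gE mixed_norm_conj /mixed_norm.
  have dbl (a : R) : a + a = 2 * a by ring.
  rewrite dbl (powRM _ (ler0n R 2) (powR_ge0 _ _)) -(powRrM _ s s^-1) (divff (lt0r_neq0 s0)).
  by rewrite (powRr1 (normc_ge0 _)) (powRM _ (powR_ge0 _ _) (normc_ge0 _)) -powRrM [s^-1 * p]mulrC.
rewrite E -EFinM; have J0 : 0 <= per_int (fun t => normc H.[expi t] `^ p).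
  by apply: per_int_ge0 => t _; exact: powR_ge0.
rewrite poweR_EFin lee_fin (powRM _ (powR_ge0 _ _) J0) -powRrM.
by rewrite (_ : p / s / p = s^-1)//; field; rewrite !gt_eqF.
Qed.

End LowerPolynomial.

(** * Partial sums of a binomial series *)

Section Binomial.
Context {R : realType}.
Notation pi := (@pi R).
Implicit Types (b k th t s r x y M m del : R).

(* The coefficients of [(1 - z) ^ (- b)]. *)
Fixpoint bcoef b (n : nat) : R :=
  if n is n'.+1 then bcoef b n' * ((n'%:R + b) / n'.+1%:R) else 1.

Lemma bcoefS b n : n.+1%:R * bcoef b n.+1 = (n%:R + b) * bcoef b n.
Proof. by rewrite /= mulrCA [_ * (_ / _)]mulrC divfK ?pnatr_eq0// mulrC. Qed.

Lemma bcoef_bounds b n : 0 <= b <= 1 -> 0 <= bcoef b n <= 1.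
Proof.
move=> /andP[b0 b1]; elim: n => [|n /andP[h0 h1]] /=; first by rewrite ler01 lexx.
have q0 : 0 <= (n%:R + b) / n.+1%:R by rewrite divr_ge0// addr_ge0.
have q1 : (n%:R + b) / n.+1%:R <= 1 by rewrite ler_pdivrMr ?ltr0n// mul1r -natr1 lerD2l.
by rewrite mulr_ge0//= mulr_ile1.
Qed.

(** With [a + i b = - e^{it}], these are the powers (with a phase, in real part), the squared
    modulus and the argument of [1 - s e^{it}]. *)
Notation bpow k th t s := (cpow k th (- cos t) (- sin t) s).
Notation bmod t s := (sqmod (- cos t) (- sin t) s).
Notation barg t s := (argt (- cos t) (- sin t) s).

Lemma bmodE t s : bmod t s = (1 - s) ^+ 2 + 2 * s * (1 - cos t).
Proof.
rewrite /sqmod; have -> : (1 + s * - cos t) ^+ 2 + (s * - sin t) ^+ 2 =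
   1 - 2 * s * cos t + s ^+ 2 * (cos t ^+ 2 + sin t ^+ 2) by ring.
rewrite cos2Dsin2; ring.
Qed.

Lemma bpow_base_gt0 t s : 0 <= s < 1 -> 0 < 1 + s * - cos t.
Proof.
move=> /andP[s0 s1]; rewrite mulrN subr_gt0; apply: le_lt_trans s1.
by rewrite -[leRHS]mulr1 ler_wpM2l// cos_le1.
Qed.

Lemma bmod_ge t s : 0 <= s -> (1 - s) ^+ 2 <= bmod t s.
Proof. by move=> s0; rewrite bmodE lerDl !mulr_ge0// subr_ge0 cos_le1. Qed.

Lemma bpow_rot k th t s :
  - cos t * bpow k th t s + - sin t * bpow k (th + pi / 2) t s = - bpow k (th + t) t s.
Proof.
rewrite /cpow !addrA; move: (k * _ + th) (_ `^ _) => x q.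
by rewrite [cos (x + pi / 2)]cosD cos_pihalf sin_pihalf cosD; ring.
Qed.

Lemma bpow_mul b th t s : 0 <= s < 1 ->
  bpow b th t s = bpow (b - 1) th t s - s * bpow (b - 1) (th + t) t s.
Proof.
move=> hs; have h := bpow_base_gt0 t hs; have m0 := sqmod_gt0 (- sin t) h.
have C := cos_argt (- sin t) h; have S := sin_argt (- sin t) h.
rewrite /cpow; set A := barg t s in C S *; set q := bmod t s in m0 C S *.
have r0 : 0 < Num.sqrt q by rewrite sqrtr_gt0.
have -> : b * A + th = ((b - 1) * A + th) + A by ring.
have -> : (b - 1) * A + (th + t) = ((b - 1) * A + th) + t by ring.
have -> : q `^ (b / 2) = q `^ ((b - 1) / 2) * Num.sqrt q.
  rewrite -(powR12_sqrt (ltW m0)) -powRD ?(gt_eqF m0) ?implybT//.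
  by congr (_ `^ _); field.
rewrite cosD [cos (_ + t)]cosD C S; move: (cos ((b - 1) * A + th)) (sin ((b - 1) * A + th)) => x y.
by field; rewrite gt_eqF.
Qed.

(** The real part of [e^{i th} (1 - z)^b S_N(z)] at [z = s e^{it}], where [S_N] is the partial sum
    of [(1 - z)^(-b)]. *)
Definition bsum b N th t s : R :=
  \sum_(n < N) bcoef b n * s ^+ n * bpow b (th + n%:R * t) t s.

(** The derivative of [(1 - z)^b S_N(z)] is [- N c_N z^(N-1) (1 - z)^(b-1)] with [c_N = bcoef b N]:
    the recursion [bcoefS] cancels all other terms. *)
Lemma der_bsum b N th t s : 0 <= s < 1 ->
  der s (bsum b N th t) (- (N%:R * bcoef b N * s ^+ N.-1 * bpow (b - 1) (th + N%:R * t) t s)).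
Proof.
move=> hs; elim: N => [|N ih].
  rewrite (_ : bsum b 0 th t = fun=> 0); last by apply/funext => x; rewrite /bsum big_ord0.
  by apply: derE (der_cst _ _) _; rewrite !mul0r oppr0.
rewrite (_ : bsum b N.+1 th t = fun x => bsum b N th t x +
    bcoef b N * x ^+ N * bpow b (th + N%:R * t) t x); last first.
  by apply/funext => x; rewrite /bsum big_ord_recr.
set phi := th + N%:R * t.
have d1 := der_cpow b phi (- sin t) (bpow_base_gt0 t hs).
rewrite bpow_rot in d1.
have d2 : der s (fun x => bcoef b N * x ^+ N) (bcoef b N * (N%:R * s ^+ N.-1)).
  by der_auto; ring.
have d3 := @derM _ _ _ _ _ _ d2 d1.
apply: derE (@derD _ _ _ _ _ _ ih d3) _.
rewrite -/phi (_ : th + N.+1%:R * t = phi + t); last by rewrite /phi -natr1; ring.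
rewrite (bpow_mul b phi t hs) (bcoefS b N).
have sN : N%:R * s ^+ N = N%:R * (s * s ^+ N.-1).
  by case: (N) => [|n]; rewrite ?mul0r// -exprS.
rewrite [N.+1.-1]/=.
move: (bpow (b - 1) phi t s) (bpow (b - 1) (phi + t) t s) => X Y.
transitivity (- (b * bcoef b N * s ^+ N * Y) - bcoef b N * (N%:R * (s * s ^+ N.-1)) * Y); first by ring.
by rewrite -sN; ring.
Qed.

Lemma bpow_bound b th t s r : 0 <= b <= 1 -> 0 <= s <= r -> r < 1 ->
  `|bpow (b - 1) th t s| <= (1 - r)^-1.
Proof.
move=> /andP[b0 b1] /andP[s0 sr] r1; have q0 : 0 < 1 - r by lra.
have m1 : (1 - r) ^+ 2 <= bmod t s.
  by apply: le_trans (bmod_ge t s0); rewrite ler_sqr ?nnegrE; lra.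
have m0 : 0 < bmod t s by apply: lt_le_trans m1; exact: exprn_gt0.
rewrite /cpow normrM (ger0_norm (powR_ge0 _ _)).
apply: (@le_trans _ _ (bmod t s `^ ((b - 1) / 2))).
  by rewrite ler_piMr ?powR_ge0// ler_norml cos_geN1 cos_le1.
have -> : (b - 1) / 2 = - ((1 - b) / 2) by ring.
rewrite powRN lef_pV2 ?posrE ?powR_gt0//.
apply: (@le_trans _ _ (((1 - r) ^+ 2) `^ ((1 - b) / 2))); last first.
  by apply: ge0_ler_powR => //; rewrite ?nnegrE ?sqr_ge0// ?(ltW m0)//; lra.
have -> : ((1 - r) ^+ 2) `^ ((1 - b) / 2) = (1 - r) `^ (1 - b).
  by rewrite -powR_mulrn ?(ltW q0)// -powRrM; congr (_ `^ _); field.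
rewrite -[leLHS](powRr1 (ltW q0)); apply: ger_powR; last by lra.
by apply/andP; split; lra.
Qed.

(** Along the ray from 0, where [(1 - z)^b S_N(z)] is 1, the derivative of [der_bsum] is so small
    that the product stays near 1 up to [r]; the infinite series never enters. Subtracting
    [b barg t r] from the phase undoes the argument of [(1 - z)^b]. *)
Theorem bsum_approx b N phi t r : (0 < N)%N -> 0 <= b <= 1 -> 0 <= r < 1 ->
  `|bmod t r `^ (b / 2) * \sum_(n < N) bcoef b n * r ^+ n * cos (phi + n%:R * t)
    - cos (phi - b * barg t r)| <= N%:R * r ^+ N / (1 - r).
Proof.
move=> N0 hb /andP[r0 r1]; have q0 : 0 < 1 - r by lra.
set th := phi - b * barg t r.
have -> : bmod t r `^ (b / 2) * \sum_(n < N) bcoef b n * r ^+ n * cos (phi + n%:R * t) = bsum b N th t r.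
  rewrite big_distrr /bsum; apply: eq_bigr => n _ /=.
  rewrite /cpow /th; have -> : b * barg t r + (phi - b * barg t r + n%:R * t) = phi + n%:R * t by ring.
  by ring.
have U0 : bsum b N th t 0 = cos th.
  case: N N0 => // n _; rewrite /bsum big_ord_recl big1 => [|i _]; last by rewrite exprS !mul0r mulr0 mul0r.
  by rewrite /= expr0 !mul1r cpow0 mul0r !addr0.
case: N N0 U0 => // N _ U0.
set K := N.+1%:R * r ^+ N / (1 - r).
have dU s : 0 <= s <= r -> der s (bsum b N.+1 th t)
    (- (N.+1%:R * bcoef b N.+1 * s ^+ N * bpow (b - 1) (th + N.+1%:R * t) t s)).
  by move=> /andP[s0 sr]; apply: der_bsum; rewrite s0; lra.
have dB s : 0 <= s <= r ->
    `|- (N.+1%:R * bcoef b N.+1 * s ^+ N * bpow (b - 1) (th + N.+1%:R * t) t s)| <= K.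
  move=> /andP[s0 sr]; have /andP[c0 c1] := bcoef_bounds N.+1 hb.
  rewrite normrN normrM; apply: ler_pM => //; last by apply: bpow_bound => //; rewrite s0.
  rewrite ger0_norm; last by rewrite mulr_ge0 ?exprn_ge0// mulr_ge0.
  apply: ler_pM; rewrite ?exprn_ge0//; first by rewrite mulr_ge0.
    by rewrite ler_piMr.
  by rewrite lerXn2r ?nnegrE.
have dK s : der s (fun x => K * x) K by der_auto; ring.
have -> : N.+1%:R * r ^+ N.+1 / (1 - r) = K * r by rewrite /K exprS; ring.
rewrite -U0 ler_norml; apply/andP; split.
  have /(_ _) H := @der_le R (fun x => bsum b N.+1 th t x + K * x) _ 0 r r0.
  have : bsum b N.+1 th t 0 + K * 0 <= bsum b N.+1 th t r + K * r; last by lra.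
  apply: H.
  - apply: within_cont => x hx; exact: der_cont (@derD _ _ _ _ _ _ (dU x hx) (dK x)).
  - by move=> x /andP[x0 x1]; apply: (@derD _ _ _ _ _ _ (dU x _) (dK x)); rewrite (ltW x0) (ltW x1).
  - move=> x /andP[x0 x1] /=; have := dB x; rewrite (ltW x0) (ltW x1) => /(_ isT).
    by rewrite ler_norml => /andP[h _]; rewrite -lerBlDr sub0r.
have /(_ _) H := @der_ge R (fun x => bsum b N.+1 th t x + - (K * x)) _ 0 r r0.
have : bsum b N.+1 th t r - K * r <= bsum b N.+1 th t 0 - K * 0; last by lra.
apply: H.
- apply: within_cont => x hx; exact: der_cont (@derD _ _ _ _ _ _ (dU x hx) (@derN _ _ _ _ (dK x))).
- by move=> x /andP[x0 x1]; apply: (@derD _ _ _ _ _ _ (dU x _) (@derN _ _ _ _ (dK x))); rewrite (ltW x0) (ltW x1).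
- move=> x /andP[x0 x1] /=; have := dB x; rewrite (ltW x0) (ltW x1) => /(_ isT).
  by rewrite ler_norml => /andP[_ h]; rewrite subr_le0.
Qed.

Lemma abs_cosD x y : `|cos (x + y)| <= `|cos x| + `|sin y|.
Proof.
rewrite cosD; apply: le_trans (ler_normB _ _) _; rewrite !normrM; apply: lerD.
  by rewrite ler_piMr// ler_norml cos_geN1 cos_le1.
by rewrite ler_piMl// ler_norml sin_geN1 sin_le1.
Qed.

(* Where [1 - r e^{it}] is small but much larger than [1 - r], its argument is
   close to [pi / 2] or [- pi / 2]. *)
Lemma barg_dichotomy b del m M t r : 0 <= b <= 1 -> 1 <= M -> 2^-1 <= r < 1 ->
  `|cos (del - b * (pi / 2))| <= m -> `|cos (del + b * (pi / 2))| <= m ->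
  `|cos (del + t - b * barg t r)| <= m + 5 / M \/
  Num.sqrt (bmod t r) <= M * (bmod t r + (1 - r)).
Proof.
move=> /andP[b0 b1] M1 /andP[r0 r1] Hm Hp; have pi0 := pi_gt0 R; have M0 : 0 < M by lra.
have hr : 0 <= r < 1 by apply/andP; split; lra.
have h := bpow_base_gt0 t hr; have S0 := sqmod_gt0 (- sin t) h.
have C := cos_argt (- sin t) h.
set rho := Num.sqrt (bmod t r) in C *; have rho0 : 0 < rho by rewrite sqrtr_gt0.
have rho2 : bmod t r = rho ^+ 2 by rewrite sqr_sqrtr// ltW.
have [hh|hh] := leP rho (M * (bmod t r + (1 - r))); [by right|left].
rewrite rho2 in hh.
have e1 : M * rho < 1.
  rewrite -(ltr_pM2r rho0) mul1r; apply: le_lt_trans hh.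
  have : 0 <= M * (1 - r) by rewrite mulr_ge0; lra.
  by have -> : M * rho * rho = M * rho ^+ 2; [ring|lra].
have rM : rho <= M^-1 by rewrite -[leRHS]mulr1 ler_pdivlMl// (ltW e1).
have e2 : M * (1 - r) <= rho.
  by apply: ltW; apply: le_lt_trans hh; rewrite ler_pM2l// lerDr sqr_ge0.
have e3 : 1 - r <= rho / M by rewrite ler_pdivlMr// mulrC.
have bE := bmodE t r; rewrite rho2 in bE.
have ct := cos_le1 t.
have c1 : 1 - cos t <= rho ^+ 2.
  have h1 : 1 - cos t <= 2 * r * (1 - cos t) by rewrite ler_peMl; lra.
  by have := sqr_ge0 (1 - r); lra.
have CA : cos (barg t r) <= 2 / M.
  rewrite C ler_pdivrMr//.
  have h1 : rho * rho <= rho / M by rewrite ler_pM2l.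
  have h2 : r * (1 - cos t) <= rho * rho.
    by rewrite -expr2; apply: le_trans c1; rewrite ler_piMl; lra.
  have -> : 2 / M * rho = rho / M + rho / M by ring.
  have -> : 1 + r * - cos t = (1 - r) + r * (1 - cos t) by ring.
  lra.
have st : `|sin t| <= 2 / M.
  apply: (@le_trans _ _ (2 * rho)); last by rewrite ler_pM2l.
  rewrite -ler_sqr ?nnegrE ?mulr_ge0 ?(ltW rho0)// real_normK ?num_real//.
  have := cos2Dsin2 t => cs; have cg := cos_geN1 t.
  have h1 : (1 - cos t) * (1 + cos t) <= rho ^+ 2 * 2.
    by apply: ler_pM; lra.
  have -> : sin t ^+ 2 = (1 - cos t) * (1 + cos t) by have -> : sin t ^+ 2 = 1 - cos t ^+ 2; [lra|ring].
  by apply: le_trans h1 _; rewrite exprMn; have := sqr_ge0 rho; lra.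
have -> : del + t - b * barg t r = (del - b * barg t r) + t by ring.
apply: le_trans (abs_cosD _ _) _.
suff : `|cos (del - b * barg t r)| <= m + 2 / M.
  have Mi : 0 <= M^-1 by rewrite invr_ge0 ltW.
  by move: Mi st; lra.
have A1 : barg t r < pi / 2 by exact: atan_ltpi2.
have A2 : - (pi / 2) < barg t r by exact: atan_gtNpi2.
move: (barg t r) A1 A2 CA => A A1 A2 CA.
have key y z : 0 <= z <= pi / 2 -> sin z = cos A -> `|y| = b * z -> `|sin y| <= 2 / M.
  move=> /andP[z0 z1] sz yE; have bz : b * z <= z by rewrite ler_piMl.
  have bz0 : 0 <= b * z by rewrite mulr_ge0.
  have -> : `|sin y| = sin (b * z).
    have s0 : 0 <= sin (b * z) by apply: sin_ge0_pi; apply/andP; split; lra.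
    have [y0|y0] := leP 0 y; first by move: yE; rewrite ger0_norm// => ->; rewrite ger0_norm.
    by move: yE; rewrite ltr0_norm// => yE; rewrite -[y]opprK yE sinN normrN ger0_norm.
  apply: le_trans CA; rewrite -sz leNgt ltr_sin; first by rewrite -leNgt.
    by rewrite in_itv/=; apply/andP; split; lra.
  by rewrite in_itv/=; apply/andP; split; lra.
have [Ap|An] := leP 0 A.
  have -> : del - b * A = (del - b * (pi / 2)) + b * (pi / 2 - A) by ring.
  apply: le_trans (abs_cosD _ _) _; apply: lerD => //; apply: (key _ (pi / 2 - A)).
  - by apply/andP; split; lra.
  - by rewrite sinB cos_pihalf sin_pihalf; ring.
  - by rewrite ger0_norm// mulr_ge0//; lra.
have -> : del - b * A = (del + b * (pi / 2)) + - (b * (pi / 2 + A)) by ring.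
apply: le_trans (abs_cosD _ _) _; apply: lerD => //; apply: (key _ (pi / 2 + A)).
- by apply/andP; split; lra.
- by rewrite sinD cos_pihalf sin_pihalf; ring.
- by rewrite normrN ger0_norm// mulr_ge0//; lra.
Qed.

End Binomial.

(** * Extremal polynomials and the integrals that govern them *)

Section Extremal.
Context {R : realType}.
Notation pi := (@pi R).
Implicit Types (b k p th t s r x y M m del e B : R).
Notation bmod t s := (sqmod (- cos t) (- sin t) s).
Notation barg t s := (argt (- cos t) (- sin t) s).

(** This is [e^{i del} z S_N(r z)]; the factor [z] makes it vanish at 0 and on the circle only
    shifts the phase by [t]. *)
Definition bpoly b del N r : {poly R[i]} :=
  \sum_(n < N) (expi del * (bcoef b n * r ^+ n)%:C) *: 'X^(n.+1).

Lemma bpoly0 b del N r : (bpoly b del N r).[0] = 0.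
Proof.
rewrite /bpoly horner_sum big1// => n _.
by rewrite hornerZ hornerXn expr0n mulr0.
Qed.

Lemma Re_expi_bpoly psi b del N r t : complex.Re (expi psi * (bpoly b del N r).[expi t]) =
  \sum_(n < N) bcoef b n * r ^+ n * cos (psi + del + t + n%:R * t).
Proof.
rewrite /bpoly horner_sum big_distrr Re_sum; apply: eq_bigr => n _ /=.
rewrite hornerZ hornerXn expiX.
have -> : psi + del + t + n%:R * t = (psi + del) + n.+1%:R * t by rewrite -natr1; ring.
have -> : expi psi * (expi del * (bcoef b n * r ^+ n)%:C * expi (n.+1%:R * t)) =
   (bcoef b n * r ^+ n)%:C * expi ((psi + del) + n.+1%:R * t) by rewrite !expiD; ring.
by rewrite Re_mul /= mul0r subr0.
Qed.

Lemma bpoly_bounds b del N r t : (0 < N)%N -> 0 <= b <= 1 -> 0 <= r < 1 ->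
  let e := N%:R * r ^+ N / (1 - r) in let z := (bpoly b del N r).[expi t] in
  1 - e <= bmod t r `^ (b / 2) * normc z /\
  bmod t r `^ (b / 2) * `|complex.Re z| <= `|cos (del + t - b * barg t r)| + e.
Proof.
move=> N0 hb hr e z; set q := bmod t r `^ (b / 2); have q0 : 0 <= q by exact: powR_ge0.
split.
  have := bsum_approx (b * barg t r) t N0 hb hr; rewrite subrr cos0 -/e -/q => h.
  apply: (@le_trans _ _ (q * complex.Re (expi (b * barg t r - del - t) * z))).
    rewrite Re_expi_bpoly.
    have -> : b * barg t r - del - t + del + t = b * barg t r by ring.
    by move: h; rewrite ler_norml => /andP[h _]; move: h; lra.
  rewrite ler_wpM2l//; apply: le_trans (ler_norm _) _; apply: le_trans (abs_Re_le _) _.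
  by rewrite normcM normc_expi mul1r.
have := bsum_approx (del + t) t N0 hb hr; rewrite -/e -/q => h.
have zE : complex.Re z = \sum_(n < N) bcoef b n * r ^+ n * cos (del + t + n%:R * t).
  have := Re_expi_bpoly 0 b del N r t; rewrite add0r -/z => <-.
  by rewrite Re_mul /= cos0 sin0 mul1r mul0r subr0.
rewrite -{1}(ger0_norm q0) -normrM zE; apply: le_trans _ (lerD (lexx _) h).
by rewrite -{1}[X in `|X|](subrK (cos (del + t - b * barg t r))) addrC ler_normD.
Qed.

Lemma bmod_gt0 t r : 0 <= r < 1 -> 0 < bmod t r.
Proof. by move=> hr; apply: sqmod_gt0; exact: bpow_base_gt0. Qed.

Lemma continuous_bmod r : continuous (fun t => bmod t r).
Proof.
move=> t; apply: (contE (f := fun t => (1 - r) ^+ 2 + 2 * r * (1 - cos t))).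
  by apply/funext => x; rewrite bmodE.
by cont_auto; exact: continuous_cos.
Qed.

Lemma continuous_bmodV r : 0 <= r < 1 -> continuous (fun t => (bmod t r)^-1).
Proof.
move=> hr t; have n0 := lt0r_neq0 (bmod_gt0 t hr).
by refine (contV (f := fun t => bmod t r) _ _) => //; exact: continuous_bmod.
Qed.

Lemma continuous_sqrt_bmodV r : 0 <= r < 1 -> continuous (fun t => (Num.sqrt (bmod t r))^-1).
Proof.
move=> hr t; have n0 : Num.sqrt (bmod t r) != 0 by rewrite gt_eqF// sqrtr_gt0 bmod_gt0.
refine (contV (f := fun t => Num.sqrt (bmod t r)) _ _) => //.
by apply: cont_sqrt; exact: continuous_bmod.
Qed.

(** The factor in parentheses is a partial sum of the Poisson kernel
    [(1 - r^2) / |1 - r e^{it}|^2]. *)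
Lemma poisson_telescope n r t :
  bmod t r * (1 + 2 * \sum_(i < n) r ^+ i.+1 * cos (i.+1%:R * t)) =
  (1 - r ^+ 2) - 2 * r ^+ n.+1 * cos (n.+1%:R * t) + 2 * r ^+ n.+2 * cos (n%:R * t).
Proof.
elim: n => [|n ih].
  by rewrite big_ord0 mulr0 addr0 mulr1 mul0r cos0 bmodE mul1r; ring.
rewrite big_ord_recr /= (mulrDr 2) addrA (mulrDr (bmod t r)) ih bmodE.
have c1 : cos (n.+2%:R * t) = cos (n.+1%:R * t) * cos t - sin (n.+1%:R * t) * sin t.
  by rewrite -cosD; congr cos; rewrite -[n.+2%:R]natr1; ring.
have c2 : cos (n%:R * t) = cos (n.+1%:R * t) * cos t + sin (n.+1%:R * t) * sin t.
  by rewrite -cosB; congr cos; rewrite -natr1; ring.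
by rewrite c1 c2 !exprS; ring.
Qed.

Lemma exp_small r e : 0 <= r < 1 -> 0 < e -> exists2 n, (0 < n)%N & r ^+ n <= e.
Proof.
move=> /andP[r0 r1] e0; have nr : `|r| < 1 by rewrite ger0_norm.
have /cvgr0_norm_le /(_ _ e0) [n _ Hn] := cvg_expr nr.
exists n.+1 => //; apply: le_trans (ler_norm _) _; exact: (Hn n.+1 (leqnSn n)).
Qed.

(** With [r = s^2], one factor [s^n] absorbs [n], since [n s^n (1 - s) <= 1], and the other tends to
    0. *)
Lemma nexp_small r e : 0 <= r < 1 -> 0 < e -> exists2 n, (0 < n)%N & n%:R * r ^+ n <= e.
Proof.
move=> /andP[r0 r1] e0; pose s := Num.sqrt r.
have s0 : 0 <= s by exact: sqrtr_ge0.
have rE : r = s ^+ 2 by rewrite sqr_sqrtr.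
have s1 : s < 1 by rewrite -(sqrtr1 R) ltr_sqrt.
have sn : 0 < 1 - s by lra.
have hs : 0 <= s < 1 by rewrite s0.
have [n n0 Hn] := exp_small hs (mulr_gt0 e0 sn).
have hn (j : nat) : j%:R * s ^+ j * (1 - s) <= 1 - s ^+ j.
  elim: j => [|k ih]; first by rewrite !mul0r expr0 subrr.
  have h1 := ler_wpM2l s0 ih; have h2 : 0 <= s ^+ k by exact: exprn_ge0.
  have h3 : 0 <= s ^+ k <= 1 by rewrite h2 exprn_ile1// ltW.
  rewrite -natr1 exprS; move: h1 h3; move: (k%:R : R) (s ^+ k) => a c h1 /andP[c0 c1].
  have : 0 <= (1 - s) * (1 - s * c) by rewrite mulr_ge0 ?subr_ge0 ?(ltW s1)// mulr_ile1// ltW.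
  by move: h1; lra.
exists n => //; rewrite rE exprAC expr2 -(ler_pM2r sn).
have h4 : n%:R * s ^+ n * (1 - s) <= 1.
  by apply: le_trans (hn n) _; rewrite gerBl exprn_ge0.
have -> : n%:R * (s ^+ n * s ^+ n) * (1 - s) = n%:R * s ^+ n * (1 - s) * s ^+ n by ring.
apply: le_trans Hn; rewrite ler_piMl// exprn_ge0//.
Qed.

(** Once [r^n <= (1 - r)^2 / 4], the tail in [poisson_telescope] is dominated by
    [bmod t r >= (1 - r)^2], so [2 + 2 S] is a majorant, and its cosines integrate to 0. The bound
    is uniform in [r]. *)
Lemma per_int_poisson r : 0 <= r < 1 -> per_int (fun t => (1 - r) * (bmod t r)^-1) <= 4 * pi.
Proof.
move=> hr; have /andP[r0 r1] := hr; have q0 : 0 < 1 - r by lra.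
have e0 : 0 < (1 - r) ^+ 2 / 4 by rewrite divr_gt0// exprn_gt0.
have [n n0 Hn] := exp_small hr e0.
pose S t := \sum_(i < n) r ^+ i.+1 * cos (i.+1%:R * t).
have iS : intg S by apply: intg_sum => i _; apply: intgZ; apply: intg_cont; exact: continuous_cosM.
have S0 : per_int S = 0.
  rewrite per_int_sum => [|i _]; last by apply: intgZ; apply: intg_cont; exact: continuous_cosM.
  apply: big1 => i _; rewrite per_intZ; last by apply: intg_cont; exact: continuous_cosM.
  by rewrite per_int_cos mul0r mulr0.
apply: (@le_trans _ _ (per_int (fun t => 2 + 2 * S t))); last first.
  by rewrite (per_intD (intg_cst 2) (intgZ 2 iS)) (per_intZ _ iS) S0 per_int_cst; lra.
apply: per_int_le.
- by apply: intgZ; apply: intg_cont; exact: continuous_bmodV.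
- by apply: intgD; [exact: intg_cst|exact: intgZ].
move=> t _; have m0 := bmod_gt0 t hr; rewrite ler_pdivrMr//.
have -> : (2 + 2 * S t) * bmod t r = bmod t r * (1 + 2 * S t) + bmod t r by ring.
rewrite poisson_telescope; have bm := bmod_ge t r0.
have h1 : r ^+ n.+1 <= (1 - r) ^+ 2 / 4.
  by apply: le_trans Hn; rewrite exprS ler_piMl ?exprn_ge0// ltW.
have h2 : r ^+ n.+2 <= (1 - r) ^+ 2 / 4.
  by apply: le_trans h1; rewrite [leLHS]exprS ler_piMl ?exprn_ge0// ltW.
have p1 : 0 <= r ^+ n.+1 by exact: exprn_ge0.
have p2 : 0 <= r ^+ n.+2 by exact: exprn_ge0.
have k1 : r ^+ n.+1 * cos (n.+1%:R * t) <= r ^+ n.+1 by rewrite ler_piMr ?cos_le1.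
have k2 : - r ^+ n.+2 <= r ^+ n.+2 * cos (n%:R * t).
  by rewrite -mulrN1 ler_wpM2l ?cos_geN1.
have k3 : 0 <= r * (1 - r) by rewrite mulr_ge0// ltW.
by move: (r ^+ n.+1) (r ^+ n.+2) h1 h2 p1 p2 k1 k2 => x y; lra.
Qed.

Lemma sin_le_id t : 0 <= t -> sin t <= t.
Proof.
move=> t0; suff : 0 - sin 0 <= t - sin t by rewrite sin0; lra.
have d x : der x (fun x => x - sin x) (1 - cos x) by der_auto; ring.
apply: (@der_le R (fun x => x - sin x) (fun x => 1 - cos x) 0 t t0).
- by apply: within_cont => x _; exact: der_cont (d x).
- by move=> x _; rewrite subr_ge0 cos_le1.
Qed.

Lemma bmod_le t r : 0 <= t -> 0 <= r < 1 -> bmod t r <= (1 - r) ^+ 2 + t ^+ 2.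
Proof.
move=> t0 /andP[r0 r1]; rewrite bmodE lerD2l.
have h : 1 - cos t <= t ^+ 2 / 2.
  suff : 0 ^+ 2 / 2 + cos 0 <= t ^+ 2 / 2 + cos t by rewrite cos0 expr0n mul0r add0r; lra.
  have d x : der x (fun x => x ^+ 2 / 2 + cos x) (x - sin x) by der_auto; rewrite /=; field.
  apply: (@der_le R (fun x => x ^+ 2 / 2 + cos x) (fun x => x - sin x) 0 t t0).
  - by apply: within_cont => x _; exact: der_cont (d x).
  - by move=> x /andP[x0 _]; rewrite subr_ge0 sin_le_id// ltW.
have c0 : 0 <= 1 - cos t by rewrite subr_ge0 cos_le1.
apply: (@le_trans _ _ (2 * (1 - cos t))); last by lra.
by rewrite ler_wpM2r//; lra.
Qed.

(** The source of the logarithmic divergence: [bmod t r <= (1 - r)^2 + t^2], and the minorant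
    [t / ((1 - r)^2 + t^2)] has the primitive [ln ((1 - r)^2 + t^2) / 2], which rises from
    [ln (1 - r) = - B] to a nonnegative value. *)
Lemma per_int_sqrt_bmodV B r : r = 1 - expR (- B) -> 0 <= r < 1 ->
  B <= per_int (fun t => (Num.sqrt (bmod t r))^-1).
Proof.
move=> rE hr; have pi2 := pi_ge2 R; have q0 : 0 < 1 - r by lra.
pose D t := (1 - r) ^+ 2 + t ^+ 2.
have D0 t : 0 < D t by rewrite /D ltr_pwDl ?exprn_gt0// sqr_ge0.
have Gc : continuous (fun t => t / D t).
  move=> t; refine (contM (f := fun t => t) (g := fun t => (D t)^-1) (@cont_id R t) _).
  have n0 : D t != 0 by rewrite gt_eqF.
  by refine (contV (f := D) _ _) => //; rewrite /D; cont_auto.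
have dG x : der x (fun t => ln (D t) / 2) (x / D x).
  by rewrite /D; der_auto; [exact: D0|rewrite /= -/(D x); field; rewrite gt_eqF].
apply: (@le_trans _ _ (per_int (fun t => t / D t))).
  rewrite (per_int_ftc Gc dG).
  have h0 : ln (D 0) = - B + - B.
    rewrite /D expr0n addr0 expr2 lnM ?posrE//.
    by have -> : 1 - r = expR (- B); [rewrite rE; ring|rewrite expRK].
  have h1 : 0 <= ln (D (2 * pi)).
    rewrite ln_ge0// /D; have := sqr_ge0 (1 - r).
    by have : 4 <= (2 * pi) ^+ 2; [nra|lra].
  by rewrite h0; lra.
have iG := intg_cont Gc; have iS := intg_cont (continuous_sqrt_bmodV hr).
apply: (per_int_le iG iS).
move=> t /andP[t0 _]; have m0 := bmod_gt0 t hr; have mD := bmod_le t0 hr.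
have s0 : 0 < Num.sqrt (bmod t r) by rewrite sqrtr_gt0.
have sD : Num.sqrt (bmod t r) <= Num.sqrt (D t) by rewrite ler_wsqrtr.
apply: (@le_trans _ _ (Num.sqrt (D t))^-1).
  have sD0 : 0 < Num.sqrt (D t) by rewrite sqrtr_gt0.
  rewrite ler_pdivrMr// -{2}(sqr_sqrtr (ltW (D0 t))) expr2 mulrA mulVf ?gt_eqF// mul1r.
  by rewrite -[leLHS](ger0_norm t0) -sqrtr_sqr ler_wsqrtr// /D lerDr sqr_ge0.
by rewrite lef_pV2 ?posrE// sqrtr_gt0.
Qed.

End Extremal.

(** * The lower bound *)

Section LowerBound.
Context {R : realType}.
Notation pi := (@pi R).
Implicit Types (b k p th t s r x y M m del e B C : R) (H : {poly R[i]}).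
Notation bmod t s := (sqmod (- cos t) (- sin t) s).
Notation barg t s := (argt (- cos t) (- sin t) s).

(** Raised to the power [p], the weight [bmod ^ (1 / (2 p))] is [rho = |1 - r e^{it}|].
    [barg_dichotomy] is used with [M = 5 / e]. In its first case [|Re z|] is at most about [m |z|];
    in its second, [1 / rho] is at most [5 / e] times [1 + (1 - r) / bmod], whose integral stays
    bounded as [r -> 1]. *)
Lemma extremal_pointwise p m del e r N t : 1 < p -> 0 <= m <= 1 ->
  `|cos (del - p^-1 * (pi / 2))| <= m -> `|cos (del + p^-1 * (pi / 2))| <= m ->
  0 < e <= 2^-1 -> 2^-1 <= r < 1 -> (0 < N)%N -> N%:R * r ^+ N / (1 - r) <= e ->
  let z := (bpoly p^-1 del N r).[expi t] in
  (1 - e) `^ p * (Num.sqrt (bmod t r))^-1 <= normc z `^ p /\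
  normc (z + z^*) `^ p <= 2 `^ p * ((m + 2 * e) `^ p * (Num.sqrt (bmod t r))^-1 +
     2 `^ p * (5 / e) * (1 + (1 - r) * (bmod t r)^-1)).
Proof.
move=> p1 /andP[m0 m1] Hm Hp /andP[e0 e2] /andP[r2 r1] N0 HN z; have p0 : 0 < p by lra.
have e1 : e <= 1 by lra.
have hb : 0 <= p^-1 <= 1 by rewrite invr_ge0 (ltW p0) invf_le1// ltW.
have hr : 0 <= r < 1 by apply/andP; split; lra.
have [B1 B2] := bpoly_bounds del t N0 hb hr; rewrite -/z in B1 B2.
have S0 := bmod_gt0 t hr; set S := bmod t r in S0 B1 B2 *.
set rho := Num.sqrt S; have rho0 : 0 < rho by rewrite sqrtr_gt0.
have rhoE : S = rho ^+ 2 by rewrite sqr_sqrtr// ltW.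
have qE : (S `^ (p^-1 / 2)) `^ p = rho.
  rewrite -powRrM (_ : p^-1 / 2 * p = 2^-1); last by field; rewrite gt_eqF.
  exact: powR12_sqrt (ltW S0).
have q0 := powR_ge0 S (p^-1 / 2); set q := S `^ (p^-1 / 2) in B1 B2 qE q0.
have z0 := normc_ge0 z.
have lo : (1 - e) `^ p <= rho * normc z `^ p.
  rewrite -qE -(powRM _ q0 z0); apply: ge0_ler_powR; rewrite ?nnegrE ?mulr_ge0//; lra.
split; first by rewrite ler_pdivrMr// mulrC.
set cc := `|cos (del + t - p^-1 * barg t r)| in B2 *.
have cc0 : 0 <= cc by exact: normr_ge0.
have zE : normc (z + z^*) = 2 * `|complex.Re z|.
  have -> : z + z^* = (2 * complex.Re z)%:C.
    by apply: complex_eqP; case: (z) => a b' /=; [ring|rewrite subrr].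
  by rewrite normc_real normrM ger0_norm.
rewrite zE (powRM _ (ler0n R 2) (normr_ge0 _)) ler_wpM2l ?powR_ge0//.
have up : `|complex.Re z| `^ p * rho <= (cc + e) `^ p.
  rewrite -qE mulrC -(powRM _ q0 (normr_ge0 _)).
  apply: ge0_ler_powR; [exact: ltW|by rewrite nnegrE mulr_ge0| |].
    by rewrite nnegrE addr_ge0// ltW.
  by apply: le_trans B2 _; rewrite lerD2l.
have T0 : 0 <= 1 + (1 - r) * S^-1.
  by rewrite addr_ge0// mulr_ge0 ?invr_ge0 ?(ltW S0)// subr_ge0 ltW.
have M1 : 1 <= 5 / e by rewrite ler_pdivlMr//; lra.
have M0 : 0 < 5 / e by lra.
have Me : 5 / (5 / e) = e by field; rewrite gt_eqF.
have h2p : 0 <= 2 `^ p * (5 / e) by rewrite mulr_ge0 ?powR_ge0// ltW.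
have hm2 : 0 <= (m + 2 * e) `^ p * rho^-1 by rewrite mulr_ge0 ?powR_ge0// invr_ge0 ltW.
apply: (@le_trans _ _ ((cc + e) `^ p * rho^-1)); first by rewrite ler_pdivlMr.
have hd : cc <= m + 5 / (5 / e) \/ rho <= 5 / e * (S + (1 - r)).
  by apply: barg_dichotomy => //; apply/andP; split.
case: hd => hd.
  rewrite Me in hd; apply: (@le_trans _ _ ((m + 2 * e) `^ p * rho^-1)).
    have ri : 0 <= rho^-1 by rewrite invr_ge0 ltW.
    apply: (ler_wpM2r ri); apply: ge0_ler_powR; first exact: ltW.
    - by rewrite nnegrE addr_ge0// ltW.
    - by rewrite nnegrE addr_ge0// mulr_ge0// ltW.
    - by rewrite (_ : m + 2 * e = m + e + e); [rewrite lerD2r|ring].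
  by rewrite lerDl; apply: mulr_ge0.
have cc1 : cc <= 1 by rewrite ler_norml cos_geN1 cos_le1.
apply: (@le_trans _ _ (2 `^ p * (5 / e * (1 + (1 - r) * S^-1)))); last first.
  by rewrite [leRHS]addrC -[X in _ <= X + _]mulrA lerDl.
apply: ler_pM; rewrite ?powR_ge0 ?invr_ge0 ?(ltW rho0)//.
  apply: ge0_ler_powR; [exact: ltW|by rewrite nnegrE addr_ge0// ltW|by rewrite nnegrE|].
  by have := lerD cc1 e1.
have -> : rho^-1 = rho * S^-1 by rewrite rhoE; field; rewrite gt_eqF.
have -> : 5 / e * (1 + (1 - r) * S^-1) = 5 / e * (S + (1 - r)) * S^-1.
  by field; rewrite !gt_eqF.
by rewrite ler_wpM2r// invr_ge0 ltW.
Qed.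

(** [L] is the integral of [1 / |1 - r e^{it}|] for [r = 1 - exp (- B)]. Both main terms are
    multiples of [L], whereas the remainder, with [6 pi = 2 pi + 4 pi], does not depend on [B]. *)
Theorem extremal_integrals p m del e B : 1 < p -> 0 <= m <= 1 ->
  `|cos (del - p^-1 * (pi / 2))| <= m -> `|cos (del + p^-1 * (pi / 2))| <= m ->
  0 < e <= 2^-1 -> 1 <= B -> exists H (L : R),
  [/\ H.[0] = 0, B <= L, (1 - e) `^ p * L <= per_int (fun t => normc H.[expi t] `^ p) &
   per_int (fun t => normc (H.[expi t] + H.[expi t]^*) `^ p) <=
    2 `^ p * ((m + 2 * e) `^ p * L + 2 `^ p * (5 / e) * (6 * pi))].
Proof.
move=> p1 hm Hm Hp he B1; have p0 : 0 < p by lra.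
have pi0 := pi_gt0 R.
pose r := 1 - expR (- B).
have eB : expR (- B) <= 2^-1.
  rewrite expRN lef_pV2 ?posrE ?expR_gt0//.
  by apply: le_trans (expR_ge1Dx B); lra.
have eB0 := expR_gt0 (- B).
have hr2 : 2^-1 <= r < 1 by rewrite /r; apply/andP; split; lra.
have hr : 0 <= r < 1 by move: hr2 => /andP[h1 h2]; apply/andP; split; lra.
have q0 : 0 < 1 - r by move: hr => /andP[_]; lra.
have /andP[e0 e2] := he.
have [N N0 HN] := nexp_small hr (mulr_gt0 e0 q0).
have HN' : N%:R * r ^+ N / (1 - r) <= e by rewrite ler_pdivrMr.
pose H := bpoly p^-1 del N r; pose L := per_int (fun t => (Num.sqrt (bmod t r))^-1).
have iL := intg_cont (continuous_sqrt_bmodV hr).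
have iK := intg_cont (continuous_bmodV hr).
have [i1 i2] := intg_poly_powR H p0.
have pw t := extremal_pointwise t p1 hm Hm Hp he hr2 N0 HN'.
exists H, L; split; first exact: bpoly0.
- exact: per_int_sqrt_bmodV.
- rewrite -(per_intZ _ iL); apply: (per_int_le (intgZ _ iL) i1) => t _; exact: (pw t).1.
set A := (m + 2 * e) `^ p; set K := 2 `^ p * (5 / e).
have K0 : 0 <= K by rewrite /K mulr_ge0 ?powR_ge0// divr_ge0// ltW.
have j1 : intg (fun t => A * (Num.sqrt (bmod t r))^-1) by exact: intgZ.
have j2 : intg (fun t => (1 - r) * (bmod t r)^-1) by exact: intgZ.
have j3 : intg (fun t => 1 + (1 - r) * (bmod t r)^-1) by apply: intgD => //; exact: intg_cst.
have j4 : intg (fun t => K * (1 + (1 - r) * (bmod t r)^-1)) by exact: intgZ.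
have j5 := intgD j1 j4.
apply: le_trans (per_int_le i2 (intgZ (2 `^ p) j5) (fun t _ => (pw t).2)) _.
rewrite (per_intZ _ j5) ler_wpM2l ?powR_ge0//.
rewrite (per_intD j1 j4) (per_intZ _ iL) (per_intZ _ j3) (per_intD (intg_cst 1) j2) per_int_cst.
rewrite lerD2l ler_wpM2l//; have := per_int_poisson hr; lra.
Qed.

Theorem riesz_lower p s m del C : 1 < p -> 0 < s -> 0 < m <= 1 ->
  `|cos (del - p^-1 * (pi / 2))| <= m -> `|cos (del + p^-1 * (pi / 2))| <= m ->
  @riesz_bound R s p C -> 2 `^ s^-1 / (2 * m) <= C.
Proof.
move=> p1 s0 /andP[m0 m1] Hm Hp HC; have p0 : 0 < p by lra.
have hm : 0 <= m <= 1 by rewrite (ltW m0).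
have pi0 := pi_gt0 R.
set c := 2 `^ s^-1; have c0 : 0 < c by rewrite powR_gt0.
have C0 : 0 < C.
  have he : 0 < (2^-1 : R) <= 2^-1 by rewrite lexx andbT.
  have [H [L [H0 L1 h1 _]]] := extremal_integrals p1 hm Hm Hp he (lexx 1).
  have := riesz_lower_poly p1 s0 HC H0; rewrite -/c => h.
  rewrite ltNge; apply/negP => C0; move: h; rewrite leNgt => /negP; apply.
  apply: (@le_lt_trans _ _ 0); first by rewrite mulr_le0_ge0// powR_ge0.
  rewrite mulr_gt0// powR_gt0//; apply: lt_le_trans h1.
  by rewrite mulr_gt0 ?powR_gt0//; lra.
rewrite ler_pdivrMr ?mulr_gt0// leNgt; apply/negP => hc.
pose d := c - C * (2 * m); have d0 : 0 < d by rewrite subr_gt0.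
have k0 : 0 < 3 * c + 12 * C by lra.
(* With [d] the assumed defect, this choice gives [2 C (m + 2 e) < c (1 - e)], that is [x < y]
   below. *)
pose e := Num.min 2^-1 (d / (3 * c + 12 * C)).
have e0 : 0 < e by rewrite lt_min divr_gt0// andbT invr_gt0.
have he : 0 < e <= 2^-1 by rewrite e0 ge_min lexx.
have ed : e * (3 * c + 12 * C) <= d by rewrite -ler_pdivlMr// ge_min lexx orbT.
have e1 : 0 <= 1 - e by move: he => /andP[_]; lra.
have me : 0 <= m + 2 * e by lra.
have C2 : 0 <= 2 * C by lra.
have ec0 : 0 < e * c by rewrite mulr_gt0.
have eC0 : 0 < e * C by rewrite mulr_gt0.
pose x := 2 * C * (m + 2 * e); pose y := c * (1 - e).
have x0 : 0 < x by rewrite /x mulr_gt0//; lra.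
have xy : x < y.
  rewrite /x /y; move: ed; rewrite /d.
  have -> : e * (3 * c + 12 * C) = 3 * (e * c) + 12 * (e * C) by ring.
  have -> : 2 * C * (m + 2 * e) = C * (2 * m) + 4 * (e * C) by ring.
  have -> : c * (1 - e) = c - e * c by ring.
  by move: (C * (2 * m)) hc => a hc; lra.
have xyp : x `^ p < y `^ p by apply: gt0_ltr_powR; rewrite ?nnegrE//; lra.
pose D := y `^ p - x `^ p; have D0 : 0 < D by rewrite subr_gt0.
pose Q := (2 * C) `^ p * (2 `^ p * (5 / e) * (6 * pi)).
have Q0 : 0 <= Q.
  rewrite mulr_ge0 ?powR_ge0// mulr_ge0//; last by lra.
  by rewrite mulr_ge0 ?powR_ge0// divr_ge0// ltW.
(* The integrals will give [D L <= Q] with [Q] and [D] independent of [L]; taking [L] at least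
   [Q / D + 1] contradicts this. *)
have B1 : 1 <= Q / D + 1 by rewrite lerDr divr_ge0// ltW.
have [H [L [H0 LB h1 h2]]] := extremal_integrals p1 hm Hm Hp he B1.
have h := riesz_lower_poly p1 s0 HC H0; rewrite -/c in h.
set X := per_int (fun t => normc H.[expi t] `^ p) in h h1.
set Y := per_int (fun t => normc (H.[expi t] + _) `^ p) in h h2.
have X0 : 0 <= X by apply: per_int_ge0 => t _; exact: powR_ge0.
have Y0 : 0 <= Y by apply: per_int_ge0 => t _; exact: powR_ge0.
have pw a I' : 0 <= a -> 0 <= I' -> (a * I' `^ p^-1) `^ p = a `^ p * I'.
  move=> a0 I0; rewrite (powRM _ a0 (powR_ge0 _ _)) -powRrM mulVf ?gt_eqF//.
  by rewrite (powRr1 I0).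
have hp : c `^ p * X <= C `^ p * Y.
  have n1 : c * X `^ p^-1 \is Num.nneg.
    by rewrite nnegrE; exact: mulr_ge0 (ltW c0) (powR_ge0 _ _).
  have n2 : C * Y `^ p^-1 \is Num.nneg.
    by rewrite nnegrE; exact: mulr_ge0 (ltW C0) (powR_ge0 _ _).
  by rewrite -(pw _ _ (ltW c0) X0) -(pw _ _ (ltW C0) Y0) (ge0_ler_powR (ltW p0) n1 n2 h).
have l1 : y `^ p * L <= c `^ p * X.
  by rewrite /y (powRM _ (ltW c0) e1) -mulrA (ler_wpM2l (powR_ge0 c p) h1).
have l2 : C `^ p * Y <= x `^ p * L + Q.
  apply: le_trans (ler_wpM2l (powR_ge0 C p) h2) _.
  rewrite /x /Q (powRM _ C2 me) (powRM _ (ler0n R 2) (ltW C0)).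
  by rewrite le_eqVlt; apply/orP; left; apply/eqP; ring.
have fin : D * L <= Q.
  by rewrite /D mulrBl lerBlDr addrC; exact: le_trans l1 (le_trans hp l2).
have : D * (Q / D + 1) <= Q by apply: le_trans fin; rewrite ler_pM2l.
by rewrite mulrDr mulr1 mulrCA divff ?gt_eqF// mulr1 gerDl leNgt D0.
Qed.

End LowerBound.

Theorem theorem1p1 (R : realType) (p s : R) (hp : 1 < p) (hs : 0 < s) :
  ((p <= 5 / 4 /\ s <= 4) \/ (5 / 4 < p /\ p < 2 /\ s <= 2) ->
    is_optimal_riesz_constant s p
      (2 `^ s^-1 / (2 * cos (pi / (2 * p))))) /\
  (2 <= p /\ s <= p ->
    is_optimal_riesz_constant s p
      (2 `^ s^-1 / (2 * sin (pi / (2 * p))))).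
Proof.
have pi0 := pi_gt0 R; have p0 : 0 < p by lra.
have pg : p^-1 * (pi / 2) = pi / (2 * p) by rewrite invfM; ring.
have g0 : 0 < pi / (2 * p) by rewrite divr_gt0// mulr_gt0.
have g1 : pi / (2 * p) < pi / 2 by rewrite -pg -[ltRHS]mul1r ltr_pM2r ?divr_gt0// invf_lt1.
have cg : 0 < cos (pi / (2 * p)) by apply: cos_gt0_pihalf; apply/andP; split; lra.
have sg : 0 < sin (pi / (2 * p)) by apply: sin_gt0_pihalf; apply/andP; split.
split=> h.
- have C0 : 0 <= 2 `^ s^-1 / (2 * cos (pi / (2 * p))) by rewrite divr_ge0 ?powR_ge0// mulr_ge0// ltW.
  split.
    apply: riesz_upper => //; case: h => [[p5 s4]|[p5 [p2 s2]]].
      by apply: (@riesz_majorant_lt2 R p s 4) => //; [lra|right].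
    by apply: (@riesz_majorant_lt2 R p s 2) => //; left.
  (* The rotation [del = 0] leaves the limiting arguments of [H] at [+- pi / (2 p)], with cosine
     [m]. *)
  move=> C' HC'; apply: (@riesz_lower R p s _ 0) HC' => //; rewrite ?pg.
  + by rewrite cg cos_le1.
  + by rewrite sub0r cosN gtr0_norm.
  + by rewrite add0r gtr0_norm.
- case: h => p2 sp.
  have C0 : 0 <= 2 `^ s^-1 / (2 * sin (pi / (2 * p))) by rewrite divr_ge0 ?powR_ge0// mulr_ge0// ltW.
  split; first by apply: riesz_upper => //; exact: riesz_majorant_ge2.
  (* Rotation by [- pi / 2] turns the cosine of the limiting arguments, in absolute value, into the
     sine. *)
  move=> C' HC'; apply: (@riesz_lower R p s _ (- (pi / 2))) HC' => //; rewrite ?pg.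
  + by rewrite sg sin_le1.
  + by rewrite cosD !cosN !sinN cos_pihalf sin_pihalf mul0r mulNr mul1r opprK sub0r normrN gtr0_norm.
  + by rewrite cosD cosN sinN cos_pihalf sin_pihalf mul0r mulN1r opprK add0r gtr0_norm.
Qed.
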